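(* Let $d\geq 1$ be an integer, written as $d=2m$ or $d=2m-1$ with $m\geq 1$. For every integer $e\geq 1$, the Hilbert–Kunz function of an $A_2$ singularity in characteristic 2 is $$\mathrm{HK}_e(S_{2,d})=\begin{cases}\dfrac{2^{m+1}+1}{2^{m+1}-1}2^{de}-\dfrac{2}{2^{m+1}-1}2^{e(m-1)} & (d=2m);\\[2mm] \dfrac{2^{m-1}+1}{2^{m-1}}2^{de} & (d=2m-1).\end{cases}$$ In particular, the Hilbert–Kunz multiplicity of an $A_2$ singularity in characteristic 2 is $$e_{\mathrm{HK}}(S_{2,d})=\begin{cases}\dfrac{2^{m+1}+1}{2^{m+1}-1} & (d=2m);\\[2mm] \dfrac{2^{m-1}+1}{2^{m-1}} & (d=2m-1).\end{cases}$$
   Context: For a Noetherian local ring $(R,\mathfrak{m})$ of prime characteristic $p$ and dimension $d$, let $\mathfrak{m}^{[p^e]}=(a^{p^e}:a\in\mathfrak{m})$, $\mathrm{HK}_e(R)=\operatorname{length}_R(R/\mathfrak{m}^{[p^e]})$ (the Hilbert–Kunz function), and $e_{\mathrm{HK}}(R)=\lim_{e\to\infty}\mathrm{HK}_e(R)/p^{ed}$ (the Hilbert–Kunz multiplicity). The $A_2$ singularity in characteristic 2 is $S_{2,d}=\mathbb{F}_2[[x_0,\dots,x_d]]/(P_d)$, where $P_d=x_0x_1+\dots+x_{d-3}x_{d-2}+x_{d-1}^2+x_d^3$ if $d$ is odd (so $P_1=x_0^2+x_1^3$) and $P_d=x_0x_1+\dots+x_{d-2}x_{d-1}+x_d^3$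 if $d$ is even. *)

(* Defs.v *)
From HB Require Import structures.
From mathcomp Require Import all_boot all_order all_algebra.
From mathcomp Require Import generic_quotient ring_quotient.
From mathcomp Require Import all_classical all_reals all_analysis.
Import GRing.Theory numFieldNormedType.Exports.

Set Implicit Arguments.
Unset Strict Implicit.
Unset Printing Implicit Defensive.

Local Open Scope classical_set_scope.
Local Open Scope ring_scope.

(** * Formal power series [k[[x_0, ..., x_(n-1)]]] *)

(* A series is its family of coefficients; the multi-index [a] stands for the
   monomial [\prod_i x_i ^ (a i)], and multi-indices are added pointwise. *)
Record mpseries (n : nat) (k : Type) :=
  MPSeries { mpcoef : {ffun 'I_n -> nat} -> k }.

HB.instance Definition _ n k := gen_eqMixin (mpseries n k).
HB.instance Definition _ n k := gen_choiceMixin (mpseries n k).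

Lemma mpseriesP n k (f g : mpseries n k) : f = g <-> mpcoef f =1 mpcoef g.
Proof.
split=> [->//|]; case: f g => [f] [g] /= fg; congr MPSeries.
exact/funext.
Qed.

Section MPSeriesRing.
Variables (n : nat) (k : comNzRingType).
Implicit Types (f g h : mpseries n k) (a u v : {ffun 'I_n -> nat}).

Definition mps_zero : mpseries n k := MPSeries (fun=> 0).
Definition mps_opp f : mpseries n k := MPSeries (fun a => - mpcoef f a).
Definition mps_add f g : mpseries n k :=
  MPSeries (fun a => mpcoef f a + mpcoef g a).

Definition mps_one : mpseries n k := MPSeries (fun a => (a == 0)%:R).
Definition mps_mul f g : mpseries n k :=
  MPSeries (fun a =>
    \sum_(uv \in [set uv | uv.1 + uv.2 = a]) mpcoef f uv.1 * mpcoef g uv.2).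

Lemma mps_addA : associative mps_add.
Proof. by move=> f g h; apply/mpseriesP => a /=; rewrite addrA. Qed.

Lemma mps_addC : commutative mps_add.
Proof. by move=> f g; apply/mpseriesP => a /=; rewrite addrC. Qed.

Lemma mps_add0 : left_id mps_zero mps_add.
Proof. by move=> f; apply/mpseriesP => a /=; rewrite add0r. Qed.

Lemma mps_addN : left_inverse mps_zero mps_opp mps_add.
Proof. by move=> f; apply/mpseriesP => a /=; rewrite addNr. Qed.

HB.instance Definition _ :=
  GRing.isZmodule.Build (mpseries n k) mps_addA mps_addC mps_add0 mps_addN.

Definition mps_box a : seq {ffun 'I_n -> nat} :=
  [seq [ffun i => val (c i)] | c : {ffun 'I_n -> 'I_(\sum_i a i).+1}].

Lemma mps_box_uniq a : uniq (mps_box a).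
Proof.
rewrite map_inj_uniq ?enum_uniq// => c d /ffunP cd; apply/ffunP => i.
by apply: val_inj; have := cd i; rewrite !ffunE.
Qed.

Lemma mem_mps_box a u v : u + v = a -> u \in mps_box a.
Proof.
move=> uva; apply/mapP.
have le i : (u i < (\sum_i a i).+1)%N.
  by rewrite ltnS (bigD1 i)//= -uva ffunE -addnA leq_addr.
exists [ffun i => Ordinal (le i)]; first by rewrite mem_enum.
by apply/ffunP => i; rewrite !ffunE.
Qed.

Lemma mpcoefM a (s : seq {ffun 'I_n -> nat}) f g :
  uniq s -> (forall u v, u + v = a -> u \in s) ->
  mpcoef (mps_mul f g) a =
  \sum_(u <- s) \sum_(v <- s) (u + v == a)%:R * (mpcoef f u * mpcoef g v).
Proof.
move=> us sP /=.
have sP2 u v : u + v = a -> v \in s by rewrite addrC; apply: sP.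
rewrite (fsbig_fwiden [seq (u, v) | u <- s, v <- [seq v <- s | u + v == a]]).
- rewrite big_allpairs_dep; apply: eq_bigr => u _.
  rewrite big_filter big_mkcond; apply: eq_bigr => v _ /=.
  by case: (u + v == a); rewrite ?mul1r ?mul0r.
- move=> [u v] /= uva; apply/allpairsPdep; exists u, v.
  by rewrite mem_filter uva eqxx (sP u v) ?(sP2 u v).
- apply: allpairs_uniq_dep => //.
  + by move=> u _; exact: filter_uniq.
  + by move=> [u v] [u' v'] _ _ [-> ->].
- move=> [u v] [] /= /allpairsPdep[u' [v' [_ + [-> ->]]]].
  by rewrite mem_filter => /andP[/eqP].
Qed.

Lemma mps_mulC : commutative mps_mul.
Proof.
move=> f g; apply/mpseriesP => a.
rewrite !(mpcoefM _ _ (mps_box_uniq a) (@mem_mps_box a)) exchange_big.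
apply: eq_bigr => u _; apply: eq_bigr => v _.
by rewrite addrC [mpcoef f _ * _]mulrC.
Qed.

Lemma mps_mulAl f g h a : mpcoef (mps_mul (mps_mul f g) h) a =
  \sum_(u <- mps_box a) \sum_(v <- mps_box a) \sum_(w <- mps_box a)
    (u + v + w == a)%:R * (mpcoef f u * mpcoef g v * mpcoef h w).
Proof.
have boxP := @mem_mps_box a; have boxU := mps_box_uniq a.
rewrite (mpcoefM _ _ boxU boxP).
transitivity (\sum_(t <- mps_box a) \sum_(w <- mps_box a)
   \sum_(u <- mps_box a) \sum_(v <- mps_box a)
     ((t + w == a) && (u + v == t))%:R
       * (mpcoef f u * mpcoef g v * mpcoef h w)).
  apply: eq_bigr => t _; apply: eq_bigr => w _.
  have [twa|_] := eqVneq (t + w) a; last first.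
    by rewrite mul0r big1// => u _; rewrite big1// => v _; rewrite mul0r.
  rewrite mul1r (mpcoefM _ _ boxU) => [|u v uvt]; last first.
    by apply: (boxP _ (v + w)); rewrite addrA uvt.
  rewrite mulr_suml; apply: eq_bigr => u _.
  by rewrite mulr_suml; apply: eq_bigr => v _ /=; rewrite -mulrA.
rewrite exchange_big /=.
transitivity (\sum_(w <- mps_box a) \sum_(u <- mps_box a) \sum_(v <- mps_box a)
    (u + v + w == a)%:R * (mpcoef f u * mpcoef g v * mpcoef h w)); last first.
  rewrite exchange_big /=; apply: eq_bigr => u _.
  by rewrite exchange_big.
apply: eq_bigr => w _; rewrite exchange_big /=.
apply: eq_bigr => u _; rewrite exchange_big /=.
apply: eq_bigr => v _; rewrite -mulr_suml; congr *%R.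
have [uvwa|uvwa] := eqVneq (u + v + w) a.
  rewrite (bigD1_seq (u + v)) ?(boxP _ w)//= uvwa !eqxx big1 ?addr0// => t.
  by rewrite eq_sym => /negPf ->; rewrite andbF.
rewrite big1// => t _; case: eqP => //= twa; case: eqP => // uvt.
by rewrite uvt twa eqxx in uvwa.
Qed.

Lemma mps_mulA : associative mps_mul.
Proof.
move=> f g h; rewrite mps_mulC; apply/mpseriesP => a; rewrite !mps_mulAl.
under [LHS]eq_bigr do rewrite exchange_big; rewrite [LHS]exchange_big.
apply: eq_bigr => u _; apply: eq_bigr => v _; apply: eq_bigr => w _ /=.
by rewrite -[u + v + w]addrA [u + _]addrC -[_ * _ * mpcoef h w]mulrA [mpcoef f u * _]mulrC.
Qed.

Lemma mps_mul1 : left_id mps_one mps_mul.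
Proof.
move=> f; apply/mpseriesP => a; rewrite (mpcoefM _ _ (mps_box_uniq a) (@mem_mps_box a)).
have a0 : 0 \in mps_box a by apply: (@mem_mps_box a 0 a); rewrite add0r.
have aa : a \in mps_box a by apply: (@mem_mps_box a a 0); rewrite addr0.
rewrite (bigD1_seq 0) ?mps_box_uniq//= (bigD1_seq a) ?mps_box_uniq//=.
rewrite add0r !eqxx !mul1r big1 ?addr0 => [|v /negPf va]; last first.
  by rewrite add0r va mul0r.
rewrite big1 ?addr0// => u /negPf u0.
by rewrite big1// => v _; rewrite u0 mul0r mulr0.
Qed.

Lemma mps_mulDl : left_distributive mps_mul mps_add.
Proof.
move=> f g h; apply/mpseriesP => a.
have coM := mpcoefM _ _ (mps_box_uniq a) (@mem_mps_box a).
rewrite [RHS]/= -![\sum_(uv \in _) _]/(mpcoef (mps_mul _ _) a) !coM -big_split.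
apply: eq_bigr => u _; rewrite -big_split; apply: eq_bigr => v _ /=.
by rewrite mulrDl mulrDr.
Qed.

Lemma mps_oner_neq0 : mps_one != mps_zero.
Proof.
apply/eqP => /mpseriesP/(_ 0) /= /eqP.
by rewrite eqxx oner_eq0.
Qed.

HB.instance Definition _ := GRing.Zmodule_isComNzRing.Build (mpseries n k)
  mps_mulA mps_mulC mps_mul1 mps_mulDl mps_oner_neq0.

Definition mpsX (i : 'I_n) : mpseries n k :=
  MPSeries (fun a => (a == [ffun j => nat_of_bool (j == i)])%:R).

End MPSeriesRing.

(** * Ideals, length, Krull dimension *)

Definition is_submod (R : comNzRingType) (M : lmodType R) (N : set M) : Prop :=
  N 0 /\ forall (a : R) x y, N x -> N y -> N (a *: x + y).

Definition is_ideal (R : comNzRingType) (I : set R) : Prop :=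
  I 0 /\ forall a x y, I x -> I y -> I (a * x + y).

Definition is_prime_ideal (R : comNzRingType) (I : set R) : Prop :=
  [/\ is_ideal I, ~ I 1 & forall a b, I (a * b) -> I a \/ I b].

Definition gen_ideal (R : comNzRingType) (A : set R) : set R :=
  smallest (@is_ideal R) A.

Lemma gen_ideal_is_ideal (R : comNzRingType) (A : set R) :
  is_ideal (gen_ideal A).
Proof.
split=> [I [[]]//|a x y Ix Iy I [II AI]].
by apply: II.2; [exact: Ix|exact: Iy].
Qed.

(* [gen_ideal A] as the boolean predicate required by [Quotient.quot]. *)
Definition gen_idealb (R : comNzRingType) (A : set R) : {pred R} := fun x =>
  `[< gen_ideal A x >].

Lemma gen_idealb_closed (R : comNzRingType) (A : set R) :
  zmod_closed (gen_idealb A).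
Proof.
have [I0 IM] := gen_ideal_is_ideal A.
split=> [|x y]; first exact/asboolP.
by move=> /asboolP Ix /asboolP Iy; apply/asboolP; rewrite addrC -mulN1r; exact: IM.
Qed.

HB.instance Definition _ (R : comNzRingType) (A : set R) :=
  GRing.isZmodClosed.Build R (gen_idealb A) (gen_idealb_closed A).

Section QuotientModule.
Variables (R : comNzRingType) (A : set R).

(* The [R]-module [R / (A)]. *)
Definition quot_module := {ideal_quot gen_idealb A}.
HB.instance Definition _ := GRing.Zmodule.on quot_module.

Local Open Scope quotient_scope.

Definition qm_pi (x : R) : quot_module := \pi_{ideal_quot gen_idealb A} x.
Definition qm_scale (a : R) (x : quot_module) : quot_module :=
  qm_pi (a * repr x).

Lemma qm_piK (x : quot_module) : qm_pi (repr x) = x.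
Proof. exact: reprK. Qed.

Lemma qm_piP x y : qm_pi x = qm_pi y <-> gen_ideal A (x - y).
Proof.
split=> [/eqP|xy].
  by rewrite -[_ == _]Quotient.idealrBE => /asboolP.
by apply/eqP; rewrite -[_ == _]Quotient.idealrBE; apply/asboolP.
Qed.

Lemma qm_piD x y : qm_pi (x + y) = qm_pi x + qm_pi y.
Proof. exact: (raddfD \pi_{ideal_quot gen_idealb A}). Qed.

Lemma qm_scale_pi a x : qm_scale a (qm_pi x) = qm_pi (a * x).
Proof.
apply/qm_piP; rewrite -mulrBr -[_ * _]addr0.
have [I0 IM] := gen_ideal_is_ideal A; apply: IM => //.
by apply/qm_piP; rewrite qm_piK.
Qed.

Lemma qm_scaleA a b x : qm_scale a (qm_scale b x) = qm_scale (a * b) x.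
Proof. by rewrite -[x]qm_piK !qm_scale_pi mulrA. Qed.

Lemma qm_scale1 : left_id 1 qm_scale.
Proof. by move=> x; rewrite -[x]qm_piK qm_scale_pi mul1r. Qed.

Lemma qm_scaleDr : right_distributive qm_scale +%R.
Proof.
move=> a x y; rewrite -[x]qm_piK -[y]qm_piK -qm_piD !qm_scale_pi.
by rewrite mulrDr qm_piD.
Qed.

Lemma qm_scaleDl x : {morph qm_scale^~ x : a b / a + b >-> a + b}.
Proof. by move=> a b; rewrite -[x]qm_piK !qm_scale_pi mulrDl qm_piD. Qed.

HB.instance Definition _ := GRing.Zmodule_isLmodule.Build R quot_module
  qm_scaleA qm_scale1 qm_scaleDr qm_scaleDl.

End QuotientModule.

(* There are sets [N 0 < N 1 < ... < N n] satisfying [C]: a chain of length [n]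
   has [n + 1] members. *)
Definition has_chain (T : Type) (C : set T -> Prop) (n : nat) : Prop :=
  exists N : nat -> set T,
    (forall i, (i <= n)%N -> C (N i)) /\
    (forall i, (i < n)%N -> N i `<` N i.+1).

(* The largest length of a chain of sets satisfying [C]; by convention it is
   [0] when there is no such maximum. *)
Definition chain_length (T : Type) (C : set T -> Prop) : nat :=
  xget 0%N [set n | has_chain C n /\ forall m, has_chain C m -> (m <= n)%N].

Definition module_length (R : comNzRingType) (M : lmodType R) : nat :=
  chain_length (@is_submod R M).

Definition krull_dim (R : comNzRingType) : nat :=
  chain_length (@is_prime_ideal R).

(** * Hilbert-Kunz function and multiplicity *)

(* The set of nonunits: the maximal ideal, when [R] is local. *)
Definition max_ideal (R : comNzRingType) : set R :=
  [set a | ~ exists b, a * b = 1].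
Arguments max_ideal : clear implicits.

Definition HK (p : nat) (R : comNzRingType) (e : nat) : nat :=
  module_length (quot_module [set a ^+ (p ^ e) | a in max_ideal R]).

Definition HK_ratio (K : realType) (p : nat) (R : comNzRingType) (e : nat) : K :=
  (HK p R e)%:R / p%:R ^+ (e * krull_dim R).

Definition HK_multiplicity (K : realType) (p : nat) (R : comNzRingType) : K :=
  limn (HK_ratio K p R).

(** * The [A_2] singularity in characteristic 2 *)

Definition A2_poly (d : nat) : mpseries d.+1 'F_2 :=
  let x i := mpsX 'F_2 (inord i : 'I_d.+1) in
  if odd d then \sum_(i < d./2) x i.*2 * x i.*2.+1 + x d.-1 ^+ 2 + x d ^+ 3
  else \sum_(i < d./2) x i.*2 * x i.*2.+1 + x d ^+ 3.

Lemma mpcoefD n (k : comNzRingType) (f g : mpseries n k) a :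
  mpcoef (f + g) a = mpcoef f a + mpcoef g a.
Proof. by []. Qed.

Lemma mpcoef0M n (k : comNzRingType) (f g : mpseries n k) :
  mpcoef (f * g) 0 = mpcoef f 0 * mpcoef g 0.
Proof.
rewrite (mpcoefM (s := [:: 0])) ?big_seq1 ?addr0 ?eqxx ?mul1r// => u v uv0.
rewrite inE; apply/eqP/ffunP => i; apply/eqP.
by move/ffunP/(_ i)/eqP: uv0; rewrite !ffunE addn_eq0 => /andP[].
Qed.

Lemma mpcoef0X n (k : comNzRingType) (i : 'I_n) : mpcoef (mpsX k i) 0 = 0.
Proof.
rewrite /=; case: eqP => // /ffunP/(_ i); rewrite !ffunE eqxx.
by [].
Qed.

Lemma A2_poly_coef0 d : mpcoef (A2_poly d) 0 = 0.
Proof.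
have S0 : mpcoef (\sum_(i < d./2) mpsX 'F_2 (inord i.*2 : 'I_d.+1) *
                     mpsX 'F_2 (inord i.*2.+1 : 'I_d.+1)) 0 = 0.
  elim/big_rec: _ => // i f _ f0.
  by rewrite mpcoefD mpcoef0M mpcoef0X mul0r f0 addr0.
have X0 i j : mpcoef (mpsX 'F_2 (i : 'I_d.+1) ^+ j.+1) 0 = 0.
  by rewrite exprS mpcoef0M mpcoef0X mul0r.
rewrite /A2_poly; case: ifP => _.
  by rewrite !mpcoefD S0 !X0 !addr0.
by rewrite mpcoefD S0 X0 addr0.
Qed.

Definition A2_ideal (d : nat) : {pred mpseries d.+1 'F_2} :=
  gen_idealb [set A2_poly d].
Arguments A2_ideal : clear implicits.

Lemma A2_ideal_closed d : idealr_closed (A2_ideal d).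
Proof.
have [I0 IM] := gen_ideal_is_ideal [set A2_poly d].
split; first exact/asboolP.
  apply/asboolP => I1.
  have : mpcoef (1 : mpseries d.+1 'F_2) 0 = 0.
    apply: (I1 [set f | mpcoef f 0 = 0]); split; last first.
      by move=> _ ->; exact: A2_poly_coef0.
    split=> // a f g f0 g0; change (mpcoef (a * f + g) 0 = 0).
    by rewrite mpcoefD mpcoef0M [mpcoef f 0]f0 [mpcoef g 0]g0 mulr0 addr0.
  by rewrite /= eqxx => /eqP; rewrite oner_eq0.
by move=> a x y /asboolP Ix /asboolP Iy; apply/asboolP; exact: IM.
Qed.

HB.instance Definition _ d :=
  isIdealr.Build (mpseries d.+1 'F_2) (A2_ideal d) (A2_ideal_closed d).

(* The ring [S_{2,d}]. *)
Definition A2_ring (d : nat) : comNzRingType := {ideal_quot A2_ideal d}.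

(* Main.v *)
From HB Require Import structures.
Require Import Defs.
From mathcomp Require Import all_boot all_order all_algebra.
From mathcomp Require Import all_classical all_reals all_analysis.
From mathcomp Require Import ring lra zify.
Import Order.TTheory GRing.Theory Num.Theory numFieldNormedType.Exports.

Set Implicit Arguments.
Unset Strict Implicit.
Unset Printing Implicit Defensive.

Local Open Scope ring_scope.

(** Let [q = 2 ^ e], let [P] be the equation and let [T] be the space of
    polynomials over the field with two elements in which all exponents are
    below [q]. Since taking [q]-th powers is additive, the quotient that defines
    [HK_e] is [T / P T]; so its length is the dimension of the kernel of [P] on
    [T] ([HK_contract]). Reversing the exponents turns [P] into a contraction
    operator on the functions on the box of exponents ([trunc_mono_seq]).

    The equation is a sum of monomials in disjoint sets of variables, so this
    operator is a sum of commuting nilpotent operators on the factors of a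
    tensor product, each of which permutes the monomials along strings. A
    nilpotent operator has a profile [n], where [n b] is the number of Jordan
    blocks of size larger than [b]. In characteristic 2, adding a string of
    length [i] to an operator of profile [n] gives the profile
    [\sum_(a < i) n (a xor b)] ([card_string_kernel]): as
    [(f + X) ^ R = f ^ R + X ^ R] for a power [R] of 2, the binary digits can be
    treated one at a time, and a duality handles the strings longer than [R].

    Convolutions for the exclusive or are diagonalized by the characters
    [chi l b], the signs given by the binary digits of [b] ([sum_ord_chi]). A
    product [x * y] multiplies the coefficient of [chi l] by [2 ^ l * q], a
    square keeps only the leading character, and the final cube contributes
    [2 ^ l.+1] ([sum_chi_min], [sum_chi_half], [sum_chi_third]). For even [d]
    the dimension of the kernel is therefore [2 ^ (d * e)] plus a geometric sum
    over [l < e], and for odd [d] only [l = e - 1] contributes to that sum; this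
    gives the closed formulas.

    The multiplicity also requires the dimension of the ring, which is [d]
    ([krull_dim_A2]). It is at most [d], because the preimages of a chain of
    primes, together with the zero ideal, form a chain in the ring of power
    series, whose dimension is bounded by a Weierstrass division along a monomial curve and by
    incomparability in finite extensions ([weierstrass_finite],
    [incomparable], [series_dim_le]). It is at least [d], because a chart of the
    blow-up, or for [d = 1] the parametrization of the cusp, maps the ring to
    power series in [d] variables with an image large enough to separate the
    contracted coordinate primes ([A2_dim_ge]). *)

(** * Counting kernels *)

Section KernelCounting.
Local Open Scope nat_scope.

(** All kernels below are counted in groups killed by 2. There a subset closed
    under sums and containing 0 is a subgroup, and only additivity is asked of
    the maps. *)
Definition char2 (V : zmodType) := forall v : V, (v + v = 0)%R.

Definition is_subgroup (V : finZmodType) (G : {set V}) :=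
  (0%R \in G) /\ {in G &, forall x y, (x + y)%R \in G}.

Variables (V W : finZmodType) (f : V -> W).
Hypotheses (V2 : char2 V) (fD : {morph f : x y / (x + y)%R}).

Lemma morph_add0 : f 0%R = 0%R.
Proof. by apply: (addIr (f 0%R)); rewrite -fD !add0r. Qed.

Lemma card_image_kernel (G : {set V}) : is_subgroup G ->
  #|G| = #|f @: G| * #|[set x in G | f x == 0%R]|.
Proof.
move=> [G0 GD]; rewrite -sum1_card (partition_big_imset f) /=.
rewrite -sum_nat_const; apply: eq_bigr => _ /imsetP[x Gx ->].
rewrite sum1dep_card -(card_imset _ (addIr x)).
apply: eq_card => z; rewrite !inE; apply/imsetP/andP => [[y]|[Gz /eqP fz]].
  rewrite inE => /andP[Gy /eqP fy] ->.
  by rewrite GD// fD fy -fD V2 morph_add0.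
exists (z + x)%R; last by rewrite -addrA V2 addr0.
by rewrite inE GD//= fD fz add0r.
Qed.

Lemma subgroup_kernel (G : {set V}) :
  is_subgroup G -> is_subgroup [set x in G | f x == 0%R].
Proof.
move=> [G0 GD]; split=> [|x y]; first by rewrite inE G0 morph_add0 eqxx.
rewrite !inE => /andP[Gx /eqP fx] /andP[Gy /eqP fy].
by rewrite GD// fD fx fy addr0 eqxx.
Qed.

Lemma subgroup_image (G : {set V}) : is_subgroup G -> is_subgroup (f @: G).
Proof.
move=> [G0 GD]; split=> [|_ _ /imsetP[x Gx ->] /imsetP[y Gy ->]].
  by apply/imsetP; exists 0%R; rewrite ?morph_add0.
by rewrite -fD; apply: imset_f; exact: GD.
Qed.

End KernelCounting.

(** Functions on a finite set are a finite group, not only a finite type and a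
    group. *)
HB.instance Definition _ (I : finType) (V : finZmodType) :=
  GRing.Zmodule.on {ffun I -> V}.

(** * Exclusive or *)

Section NimSum.
Local Open Scope nat_scope.

(** Bitwise exclusive or of the [e] lowest binary digits. *)
Fixpoint nim e a b :=
  if e is e'.+1 then
    (if (a < 2 ^ e') == (b < 2 ^ e') then 0 else 2 ^ e')
      + nim e' (a %% 2 ^ e') (b %% 2 ^ e')
  else 0.

Lemma nim_lt e a b : nim e a b < 2 ^ e.
Proof.
elim: e a b => //= e IH a b; rewrite expnS mul2n -addnn -addnS.
by apply: leq_add; [case: ifP|exact: IH].
Qed.

Lemma nimS_lt e a b : a < 2 ^ e -> b < 2 ^ e -> nim e.+1 a b = nim e a b.
Proof. by move=> ae be /=; rewrite ae be eqxx !modn_small. Qed.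

Lemma nimS_geR e a b : a < 2 ^ e -> b < 2 ^ e ->
  nim e.+1 a (2 ^ e + b) = 2 ^ e + nim e a b.
Proof.
by move=> ae be /=; rewrite ae ltnNge leq_addr/= modnDl !modn_small.
Qed.

Lemma nimC e a b : nim e a b = nim e b a.
Proof. by elim: e a b => //= e IH a b; rewrite IH eq_sym. Qed.

(** Complementing the digits of both arguments does not change where they
    differ. *)
Lemma nim_compl e a b : a < 2 ^ e -> b < 2 ^ e ->
  nim e ((2 ^ e).-1 - a) ((2 ^ e).-1 - b) = nim e a b.
Proof.
elim: e a b => //= e IH a b ae be.
have p : 0 < 2 ^ e by rewrite expn_gt0.
have aux x : x < 2 ^ e.+1 ->
  [/\ ((2 ^ e.+1).-1 - x < 2 ^ e) = ~~ (x < 2 ^ e) &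
      ((2 ^ e.+1).-1 - x) %% 2 ^ e = (2 ^ e).-1 - x %% 2 ^ e].
  rewrite expnS mul2n => xe; have [lt|ge] := ltnP x (2 ^ e).
    split; first by apply/negbTE; rewrite -leqNgt; lia.
    rewrite (modn_small lt).
    have -> : (2 ^ e).*2.-1 - x = 2 ^ e + ((2 ^ e).-1 - x) by lia.
    by rewrite modnDl modn_small//; lia.
  split; first by rewrite /=; have -> : ((2 ^ e).*2.-1 - x < 2 ^ e) by lia.
  have -> : x = 2 ^ e + (x - 2 ^ e) by lia.
  rewrite modnDl !modn_small; lia.
have [-> ->] := aux _ ae; have [-> ->] := aux _ be.
by rewrite IH ?ltn_pmod//; case: (_ < _); case: (_ < _).
Qed.

Lemma sum_half (n : nat -> nat) r :
  \sum_(0 <= i < r + r) n i =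
  \sum_(0 <= i < r) n i + \sum_(0 <= i < r) n (r + i).
Proof.
rewrite (@big_cat_nat _ _ _ r)//= ?leq_addr//; congr addn.
by rewrite -{1}[r]add0n big_addn addnK; apply: eq_bigr => i _; rewrite addnC.
Qed.

Lemma expn2S e : 2 ^ e.+1 = 2 ^ e + 2 ^ e.
Proof. by rewrite expnS mul2n addnn. Qed.

(** Exclusive or with [a] permutes the numbers below [2 ^ e]. *)
Lemma sum_nim e (n : nat -> nat) a : a < 2 ^ e ->
  \sum_(0 <= b < 2 ^ e) n (nim e a b) = \sum_(0 <= b < 2 ^ e) n b.
Proof.
elim: e n a => [|e IH] n a; first by rewrite !big_nat1.
move=> ae; rewrite expn2S !sum_half.
have half x : x < 2 ^ e ->
    \sum_(0 <= i < 2 ^ e) n (nim e.+1 x i) = \sum_(0 <= i < 2 ^ e) n i /\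
    \sum_(0 <= i < 2 ^ e) n (nim e.+1 x (2 ^ e + i))
      = \sum_(0 <= i < 2 ^ e) n (2 ^ e + i).
  move=> xe; split.
    rewrite -(IH n _ xe); apply: eq_big_nat => i /andP[_ ie].
    by rewrite nimS_lt.
  rewrite -(IH (fun i => n (2 ^ e + i)) _ xe); apply: eq_big_nat => i /andP[_ ie].
  by rewrite nimS_geR.
have [lt|ge] := ltnP a (2 ^ e).
  by have [-> ->] := half _ lt.
have ae' : a - 2 ^ e < 2 ^ e by rewrite ltn_subLR// -expn2S.
rewrite -(subnKC ge) addnC.
rewrite -(IH (fun i => n (2 ^ e + i)) _ ae') -(IH n _ ae'); congr addn.
  apply: eq_big_nat => i /andP[_ ie].
  by congr n; rewrite /= ![(2 ^ e + _ < _)]ltnNge !leq_addr/= !modnDl !modn_small.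
apply: eq_big_nat => i /andP[_ ie].
by congr n; rewrite nimC nimS_geR// nimC.
Qed.

End NimSum.

(** * Words and strings *)

Section Strings.
Local Open Scope nat_scope.
Variables (V : finZmodType) (f : V -> V).
Hypotheses (V2 : char2 V) (fD : {morph f : x y / (x + y)%R}).

Let f0 : f 0%R = 0%R := morph_add0 fD.

Lemma iter_morphD c : {morph iter c f : x y / (x + y)%R}.
Proof. by move=> x y; elim: c => //= c ->; rewrite fD. Qed.

Lemma iter_morph0 c : iter c f 0%R = 0%R.
Proof. exact: morph_add0 (iter_morphD c). Qed.

Lemma iter_kernel_le c c' v : c <= c' -> iter c f v = 0%R -> iter c' f v = 0%R.
Proof. by move=> /subnK <-; rewrite iterD => ->; exact: iter_morph0. Qed.

Variable N : nat.
Local Notation word := {ffun 'I_N -> V}.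

(** A word is an element of the tensor product of [V] with one nilpotent Jordan
    block of size [N], which acts by the shift [X]; [string_op] is [f + X].
    Letters are indexed by all natural numbers, those beyond the end being 0,
    so that the shift needs no case analysis. *)
Definition letter (w : word) t : V := if insub t is Some i then w i else 0%R.
Definition shift (w : word) : word := [ffun i : 'I_N => letter w i.+1].
Definition string_op (w : word) : word :=
  [ffun i : 'I_N => (f (letter w i) + letter w i.+1)%R].

Lemma letter_ord w (i : 'I_N) : letter w i = w i.
Proof. by rewrite /letter valK. Qed.

Lemma letter_out w t : N <= t -> letter w t = 0%R.
Proof. by move=> Nt; rewrite /letter insubF// ltnNge Nt. Qed.

Lemma letter_inj w w' : letter w =1 letter w' -> w = w'.
Proof. by move=> ww'; apply/ffunP => i; rewrite -!letter_ord ww'. Qed.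

Lemma letter_fun (g : nat -> V) t :
  letter [ffun i : 'I_N => g i] t = if t < N then g t else 0%R.
Proof.
case: ltnP => [tN|]; last exact: letter_out.
by rewrite (letter_ord _ (Ordinal tN)) ffunE.
Qed.

Lemma letterD w w' t : letter (w + w')%R t = (letter w t + letter w' t)%R.
Proof.
have [Nt|tN] := leqP N t; first by rewrite !letter_out ?addr0.
by rewrite !(letter_ord _ (Ordinal tN)) ffunE.
Qed.

Lemma letter0 t : letter 0%R t = 0%R.
Proof. by rewrite /letter; case: insub => // i; rewrite ffunE. Qed.

Definition map_word (g : V -> V) (w : word) : word :=
  [ffun i : 'I_N => g (letter w i)].

Lemma letter_map_word (g : V -> V) w t :
  g 0%R = 0%R -> letter (map_word g w) t = g (letter w t).
Proof.
move=> g0; rewrite (letter_fun (fun t => g (letter w t))); case: ltnP => // Nt.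
by rewrite letter_out// g0.
Qed.

Lemma letter_shift w t : letter (shift w) t = letter w t.+1.
Proof.
rewrite (letter_fun (fun i => letter w i.+1)); case: ltnP => // Nt.
by rewrite letter_out// leqW.
Qed.

Lemma letter_string_op w t :
  letter (string_op w) t = (f (letter w t) + letter w t.+1)%R.
Proof.
rewrite (letter_fun (fun i => (f (letter w i) + letter w i.+1)%R)).
by case: ltnP => // Nt; rewrite !letter_out ?f0 ?addr0// leqW.
Qed.

Lemma word2 : char2 {ffun 'I_N -> V}.
Proof. by move=> w; apply/ffunP => i; rewrite !ffunE. Qed.

Lemma shiftD : {morph shift : x y / (x + y)%R}.
Proof.
by move=> x y; apply: letter_inj => t; rewrite letterD !letter_shift letterD.
Qed.

Lemma string_opD : {morph string_op : x y / (x + y)%R}.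
Proof.
move=> x y; apply: letter_inj => t.
by rewrite letterD !letter_string_op !letterD fD addrACA.
Qed.

Lemma letter_iter_shift c w t : letter (iter c shift w) t = letter w (c + t).
Proof. by elim: c t => //= c IH t; rewrite letter_shift IH addnS. Qed.

Lemma iter_opD c : {morph iter c string_op : x y / (x + y)%R}.
Proof. by move=> x y; elim: c => //= c ->; rewrite string_opD. Qed.

Lemma iter_shiftD c : {morph iter c shift : x y / (x + y)%R}.
Proof. by move=> x y; elim: c => //= c ->; rewrite shiftD. Qed.

Lemma shift_op w : shift (string_op w) = string_op (shift w).
Proof.
by apply: letter_inj => t; rewrite letter_shift !letter_string_op !letter_shift.
Qed.

Lemma iter_shift_op i c w :
  iter i shift (iter c string_op w) = iter c string_op (iter i shift w).
Proof.
elim: i => //= i ->; move: (iter i shift w) => {}w.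
by elim: c => //= c <-; rewrite shift_op.
Qed.

(** Since [f] and [X] commute and 2 = 0, [(f + X) ^ (2 ^ k)] is
    [f ^ (2 ^ k) + X ^ (2 ^ k)]. This is where the characteristic enters. *)
Lemma iter_op_frobenius k w t :
  letter (iter (2 ^ k) string_op w) t =
  (iter (2 ^ k) f (letter w t) + letter w (2 ^ k + t))%R.
Proof.
elim: k w t => [|k IH] w t; first exact: letter_string_op.
rewrite expn2S !iterD !IH iter_morphD -!addrA; congr (_ + _)%R.
by rewrite addrA V2 add0r addnA.
Qed.

(** Shorter Jordan blocks, and stable subgroups of [V], are obtained inside the
    same type: letters in [U], and 0 from the [i]-th one on. *)
Definition words (U : {set V}) i : {set word} :=
  [set w in pffun_on 0%R [pred t : 'I_N | t < i] U].

Definition words_ker U i c := [set w in words U i | iter c string_op w == 0%R].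

Lemma mem_words_ker U i c w : (w \in words_ker U i c) =
  (w \in words U i) && (iter c string_op w == 0%R).
Proof. by rewrite inE. Qed.

Section Subspace.
Variable U : {set V}.
Hypothesis (UG : is_subgroup U).

Lemma wordsP i w : reflect
  ((forall t, letter w t \in U) /\ (forall t, i <= t -> letter w t = 0%R))
  (w \in words U i).
Proof.
apply: (iffP idP) => [|[wU w0]]; rewrite inE.
  move=> /pffun_onP[/fintype.subsetP supp im]; split=> t; last first.
    move=> it; have [Nt|tN] := leqP N t; first exact: letter_out.
    rewrite (letter_ord _ (Ordinal tN)); apply/eqP/negPn/negP => wn0.
    by have := supp (Ordinal tN); rewrite !inE wn0 => /(_ isT); rewrite ltnNge it.
  have [Nt|tN] := leqP N t; first by rewrite letter_out//; case: UG.
  rewrite (letter_ord _ (Ordinal tN)).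
  have [wt0|wn0] := eqVneq (w (Ordinal tN)) 0%R; first by rewrite wt0; case: UG.
  by apply: im; apply/fintype.imageP; exists (Ordinal tN) => //; apply: supp; rewrite inE.
apply/pffun_onP; split.
  apply/fintype.subsetP => t; rewrite !inE ltnNge; apply: contra => it.
  by rewrite -letter_ord w0.
by move=> _ /fintype.imageP[t _ ->]; rewrite -letter_ord.
Qed.

Lemma card_words i : i <= N -> #|words U i| = #|U| ^ i.
Proof.
move=> iN; rewrite cardsE card_pffun_on; congr (_ ^ _).
rewrite -[RHS]card_ord -[RHS]sum1_card (big_ord_widen N (fun=> 1) iN) -sum1_card.
exact: eq_bigl.
Qed.

Lemma words_subgroup i : is_subgroup (words U i).
Proof.
have [U0 UD] := UG; split=> [|x y /wordsP[xU x0] /wordsP[yU y0]].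
  by apply/wordsP; split=> t; rewrite letter0.
apply/wordsP; split=> t; rewrite letterD; first exact: UD.
by move=> it; rewrite x0// y0// addr0.
Qed.

Lemma words_ker_subgroup i c : is_subgroup (words_ker U i c).
Proof. exact: (subgroup_kernel (@iter_opD c) (words_subgroup i)). Qed.

Hypothesis Uf : {in U, forall u, f u \in U}.

Lemma words_op i c w : w \in words U i -> iter c string_op w \in words U i.
Proof.
move=> wU; elim: c => //= c; move: (iter c _ w) => {wU}w /wordsP[wU w0].
apply/wordsP; split=> t; rewrite letter_string_op.
  by case: UG => _; apply; rewrite ?Uf.
by move=> it; rewrite !w0// ?leqW// f0 addr0.
Qed.

Lemma words_ker0 i c : i = 0 \/ c = 0 -> #|words_ker U i c| = 1.
Proof.
move=> ic; have [z0 _] := words_ker_subgroup i c.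
rewrite -(cards1 (0%R : word)); apply: eq_card => w; rewrite [RHS]inE.
apply/idP/eqP => [|->//].
rewrite inE; case: ic => -> /andP[/wordsP[_ w0]]; last by move=> /eqP.
by move=> _; apply: letter_inj => t; rewrite letter0 w0.
Qed.

Variable k : nat.
Local Notation Q := (2 ^ k).
Hypotheses (QN : Q <= N) (UQ : {in U, forall u, iter Q f u = 0%R}).

Lemma words_nilp w : w \in words U Q -> iter Q string_op w = 0%R.
Proof.
move=> /wordsP[wU w0]; apply: letter_inj => t.
by rewrite letter0 iter_op_frobenius UQ// w0 ?leq_addr// addr0.
Qed.

(** A word killed by [f + X] is determined by its first letter, so each power
    of [f + X] enlarges the kernel by a factor at most [#|U|]. *)
Lemma card_words_ker_le c : #|words_ker U Q c| <= #|U| ^ c.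
Proof.
elim: c => [|c IH]; first by rewrite words_ker0//; right.
rewrite (card_image_kernel word2 (@iter_opD c) (words_ker_subgroup Q c.+1)).
rewrite expnS leq_mul//; last first.
  apply: leq_trans IH; apply: subset_leq_card; apply/fintype.subsetP => w.
  by rewrite inE !mem_words_ker => /andP[/andP[-> _]].
apply: (@leq_trans #|words_ker U Q 1|).
  apply: subset_leq_card; apply/fintype.subsetP => _ /imsetP[w + ->].
  by rewrite !mem_words_ker => /andP[wU]; rewrite words_op.
rewrite -(@card_in_imset _ _ (letter^~ 0)).
  apply: subset_leq_card; apply/fintype.subsetP => _ /imsetP[w + ->].
  by rewrite mem_words_ker => /andP[/wordsP[wU _] _]; exact: wU.
move=> x y; rewrite !mem_words_ker => /andP[_ /eqP zx] /andP[_ /eqP zy] xy0.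
apply: letter_inj; elim=> // t IHt.
have rec z : iter 1 string_op z = 0%R -> letter z t.+1 = f (letter z t).
  move=> /(congr1 (letter^~ t)); rewrite letter0 letter_string_op => z0.
  by apply: (addrI (f (letter z t))); rewrite z0 V2.
by rewrite !rec// IHt.
Qed.

(** Replacing [X] by [f + X] is a change of variable: on words of length
    [2 ^ k], where [f ^ (2 ^ k) = 0], the powers of [f + X] have kernels and
    images as large as those of [X]. The kernels of [(f + X) ^ c] and
    [(f + X) ^ (Q - c)] are at most that large, and the image of the former
    power lies in the kernel of the latter, so counting forces equalities. *)
Lemma words_free c : c <= Q ->
  #|words_ker U Q c| = #|U| ^ c /\
  iter c string_op @: words U Q = words_ker U Q (Q - c).
Proof.
move=> cQ; have U_gt0 : 0 < #|U| by apply/card_gt0P; exists 0%R; case: UG.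
have := card_image_kernel word2 (@iter_opD c) (words_subgroup Q).
rewrite card_words// -[in LHS](subnK cQ) expnD -/(words_ker U Q c).
have sub : iter c string_op @: words U Q \subset words_ker U Q (Q - c).
  apply/fintype.subsetP => _ /imsetP[w wU ->].
  rewrite mem_words_ker words_op// -iterD subnK//.
  by rewrite words_nilp ?eqxx.
have le1 := subset_leq_card sub.
have le2 := card_words_ker_le (Q - c); have le3 := card_words_ker_le c.
have le12 := leq_trans le1 le2.
move=> eq.
have k_gt0 : 0 < #|U| ^ c by rewrite expn_gt0 U_gt0.
have k'_gt0 : 0 < #|U| ^ (Q - c) by rewrite expn_gt0 U_gt0.
have e1 : #|words_ker U Q c| = #|U| ^ c.
  apply/eqP; rewrite eqn_leq le3/= -(leq_pmul2l k'_gt0) eq.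
  by rewrite leq_mul2r le12 orbT.
split=> //; apply/eqP; rewrite eqEcard sub/=; apply: leq_trans le2 _.
by move: eq; rewrite e1 => /eqP; rewrite eqn_pmul2r// => /eqP ->.
Qed.

(** The image under [X ^ (Q - i)] of the kernel of [(f + X) ^ (Q - c)], which
    is the image of [(f + X) ^ c], is also the image under [(f + X) ^ c] of the
    words of length [i]. Counting that set in both ways gives the equality. *)
Lemma words_ker_reflection i c : i <= Q -> c <= Q ->
  #|U| ^ i * #|words_ker U (Q - i) (Q - c)| =
  #|U| ^ (Q - c) * #|words_ker U i c|.
Proof.
move=> iQ cQ.
have shiftS : iter (Q - i) shift @: words U Q = words U i.
  apply/setP => w; apply/imsetP/idP => [[v /wordsP[vU v0] ->]|/wordsP[wU w0]].
    apply/wordsP; split=> t; rewrite letter_iter_shift//.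
    by move=> it; apply: v0; rewrite -leq_subLR subKn.
  exists [ffun t : 'I_N => if t < Q - i then 0%R else letter w (t - (Q - i))].
    apply/wordsP; split=> t;
      rewrite (letter_fun (fun t => if t < Q - i then 0%R else letter w (t - (Q - i)))).
      by case: ifP; [case: ifP => // _ _|]; case: UG.
    move=> Qt; case: ifP => // _; case: ifP => // _; apply: w0; lia.
  apply: letter_inj => t; rewrite letter_iter_shift.
  rewrite (letter_fun (fun t => if t < Q - i then 0%R else letter w (t - (Q - i)))).
  rewrite [_ < Q - i]ltnNge leq_addr/= addKn; case: ltnP => // Nt.
  by rewrite w0//; lia.
have [_ imZ] := words_free cQ; have [cardZ _] := words_free (leq_subr c Q).
have e1 := card_image_kernel word2 (@iter_opD c) (words_subgroup i).
rewrite card_words ?(leq_trans iQ)// -/(words_ker U i c) in e1.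
have e2 := card_image_kernel word2 (@iter_shiftD (Q - i)) (words_ker_subgroup Q (Q - c)).
rewrite cardZ -imZ -imset_comp in e2.
have comp : iter (Q - i) shift @: words_ker U Q (Q - c)
    = iter c string_op @: words U i.
  rewrite -imZ -shiftS -!imset_comp; apply: eq_imset => w /=.
  exact: iter_shift_op.
rewrite imset_comp imZ comp in e2.
have ker : [set w in words_ker U Q (Q - c) | iter (Q - i) shift w == 0%R]
    = words_ker U (Q - i) (Q - c).
  apply/setP => w; rewrite inE !mem_words_ker; apply/idP/idP.
    move=> /andP[/andP[/wordsP[wU w0] ->] /eqP s0]; rewrite andbT.
    apply/wordsP; split=> // t it; rewrite -(subnKC it) -letter_iter_shift s0.
    exact: letter0.
  move=> /andP[/wordsP[wU w0] ->]; rewrite andbT; apply/andP; split.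
    apply/wordsP; split=> // t Qt; apply: w0; lia.
  apply/eqP; apply: letter_inj => t; rewrite letter0 letter_iter_shift w0//.
  exact: leq_addr.
by rewrite ker in e2; rewrite e1 e2 mulnAC.
Qed.

End Subspace.
End Strings.

(** * The kernels of a string *)

Section StringTheorem.
Local Open Scope nat_scope.

Lemma big_nat_complement (F : nat -> nat) i q : i <= q ->
  \sum_(i <= a < q) F a = \sum_(0 <= a < q - i) F (q.-1 - a).
Proof.
move=> iq; rewrite -{1}[i]add0n big_addn big_nat_rev /=.
by apply: eq_big_nat => a /andP[_ ai]; congr F; lia.
Qed.

(** The same reflection holds for the exponents of the expected cardinals: the
    rows and columns of the table of [nim] are permutations, and the table is
    unchanged when both indices are complemented. *)
Lemma nim_box_reflection k (n : nat -> nat) i c : i <= 2 ^ k -> c <= 2 ^ k ->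
  i * \sum_(0 <= b < 2 ^ k) n b
    + \sum_(0 <= a < 2 ^ k - i) \sum_(0 <= b < 2 ^ k - c) n (nim k a b)
  = (2 ^ k - c) * \sum_(0 <= b < 2 ^ k) n b
    + \sum_(0 <= a < i) \sum_(0 <= b < c) n (nim k a b).
Proof.
set q := 2 ^ k => iq cq.
have rows : \sum_(0 <= a < i) \sum_(0 <= b < q) n (nim k a b)
    = i * \sum_(0 <= b < q) n b.
  rewrite (eq_big_nat _ _ (F2 := fun=> \sum_(0 <= b < q) n b)); last first.
    by move=> a /andP[_ ai]; apply: sum_nim; exact: leq_trans iq.
  by rewrite sum_nat_const_nat subn0.
have cols : \sum_(0 <= a < q) \sum_(c <= b < q) n (nim k a b)
    = (q - c) * \sum_(0 <= b < q) n b.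
  rewrite exchange_big_nat /=.
  rewrite (eq_big_nat _ _ (F2 := fun=> \sum_(0 <= b < q) n b)); last first.
    move=> b /andP[_ bq]; rewrite -(sum_nim n bq).
    by apply: eq_big_nat => a _; rewrite nimC.
  by rewrite sum_nat_const_nat.
rewrite -rows -cols.
rewrite [X in _ = X + _](@big_cat_nat _ _ _ i)//= addnC [RHS]addnAC [RHS]addnC.
congr addn.
  rewrite [RHS]big_nat_complement//; apply: eq_big_nat => a ai.
  rewrite [RHS]big_nat_complement//; apply: eq_big_nat => b bi.
  by rewrite nim_compl//; lia.
rewrite -big_split /=; apply: eq_big_nat => a _.
by rewrite addnC -big_cat_nat.
Qed.

Variables (V : finZmodType) (f : V -> V).
Hypotheses (V2 : char2 V) (fD : {morph f : x y / (x + y)%R}).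
Variable N : nat.

Local Notation words_ker := (words_ker f N).

Definition stable_ker (U : {set V}) c := [set u in U | iter c f u == 0%R].

Lemma mem_stable_ker U c u :
  (u \in stable_ker U c) = (u \in U) && (iter c f u == 0%R).
Proof. by rewrite inE. Qed.

(** If [n] is the profile of [f], the sizes of the kernels of [f + X] on a
    string of length [i] are those of the profile [\sum_(a < i) n (nim k a b)].
    The proof is by induction on the number of binary digits: the Frobenius
    identity for the leading digit [R] reduces to the kernel and the image of
    [f ^ R], and the reflection moves long strings to short ones. *)
Theorem card_string_kernel k (U : {set V}) (n : nat -> nat) i c :
  2 ^ k <= N -> is_subgroup U -> {in U, forall u, f u \in U} ->
  {in U, forall u, iter (2 ^ k) f u = 0%R} ->
  (forall c, c <= 2 ^ k -> #|stable_ker U c| = 2 ^ \sum_(0 <= b < c) n b) ->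
  i <= 2 ^ k -> c <= 2 ^ k ->
  #|words_ker U i c| = 2 ^ \sum_(0 <= a < i) \sum_(0 <= b < c) n (nim k a b).
Proof.
have fiD := iter_morphD fD.
elim: k U n i c => [|k IH] U n i c.
  move=> N1 UG Uf U0' Un; have U0 u : u \in U -> f u = 0%R := U0' u.
  have [->|i_gt0] := posnP i.
    by move=> _ _; rewrite words_ker0//; [rewrite big_geq|left].
  have [->|c_gt0] := posnP c.
    move=> _ _; rewrite words_ker0//; last by right.
    by rewrite big1// => a _; rewrite big_geq.
  rewrite expn0 => i1 c1; have -> : i = 1 by lia.
  have -> : c = 1 by lia.
  rewrite !big_nat1 /=; have := Un 1 isT; rewrite big_nat1 => <-.
  have -> : words_ker U 1 1 = words N U 1.
    apply/setP => w; rewrite mem_words_ker andb_idr// => /(wordsP UG)[wU w0].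
    apply/eqP/letter_inj => t.
    by rewrite (letter_string_op fD) U0// w0// addr0 letter0.
  rewrite card_words// expn1; apply: eq_card => u; rewrite mem_stable_ker.
  by rewrite andb_idr// => Uu; rewrite /= U0.
set R := 2 ^ k; rewrite expn2S -/R => RRN UG Uf UQ Un; move: i c.
have RN : R <= N := leq_trans (leq_addr _ _) RRN.
have cardU : #|U| = 2 ^ \sum_(0 <= b < R + R) n b.
  rewrite -Un//; apply: eq_card => u; rewrite mem_stable_ker andb_idr// => Uu.
  by rewrite UQ.
have U'G := subgroup_kernel (fiD R) UG.
have U''G := subgroup_image (fiD R) UG.
(* [(f + X) ^ R = f ^ R + X ^ R], and words of length at most [R] are killed by
   [X ^ R], so that only the kernel of [f ^ R] matters *)
have small i c : i <= R -> c <= R -> #|words_ker U i c| =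
    2 ^ \sum_(0 <= a < i) \sum_(0 <= b < c) n (nim k.+1 a b).
  move=> iR cR.
  have -> : words_ker U i c = words_ker (stable_ker U R) i c.
    apply/setP => w; rewrite !mem_words_ker; apply/idP/idP => /andP[wi /eqP wc].
      rewrite wc eqxx andbT; move: wi => /(wordsP UG)[wU w0].
      apply/(wordsP U'G); split=> // t; rewrite inE wU/=.
      have := iter_kernel_le (string_opD fD (N := N)) cR wc.
      move=> /(congr1 (fun w => letter w t)); rewrite letter0 iter_op_frobenius//.
      by rewrite -/R [letter w (R + t)]w0 ?addr0 => [/eqP|]; lia.
    rewrite wc eqxx andbT; move: wi => /(wordsP U'G)[wU w0].
    by apply/(wordsP UG); split=> // t; move: (wU t); rewrite inE => /andP[].
  rewrite (IH _ n)//.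
  - congr (2 ^ _); apply: eq_big_nat => a /andP[_ ai].
    apply: eq_big_nat => b /andP[_ bc].
    by rewrite nimS_lt//; [exact: leq_trans iR|exact: leq_trans cR].
  - move=> u; rewrite !inE => /andP[Uu /eqP u0]; rewrite Uf//=.
    by rewrite -iterSr iterS u0 (morph_add0 fD).
  - by move=> u; rewrite inE => /andP[_ /eqP].
  - move=> {cR}c cR; rewrite -Un ?(leq_trans cR) ?leq_addr//.
    apply: eq_card => u; rewrite !mem_stable_ker -andbA; congr andb.
    rewrite andb_idl// => /eqP uc; apply/eqP; exact: (iter_kernel_le fD cR uc).
(* on words of length at most [R], [(f + X) ^ (R + c')] is [(f + X) ^ c'] after
   [f ^ R], so that the image and the kernel of [f ^ R] can be treated separately *)
have mixed i c : i <= R -> R <= c <= R + R -> #|words_ker U i c| =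
    2 ^ \sum_(0 <= a < i) \sum_(0 <= b < c) n (nim k.+1 a b).
  move=> iR /andP[Rc cQ]; rewrite -(subnKC Rc); set c' := c - R.
  have c'R : c' <= R by rewrite leq_subLR.
  pose F := map_word (N := N) (iter R f).
  have letterF w t : letter (F w) t = iter R f (letter w t).
    by rewrite letter_map_word// iter_morph0.
  have FD : {morph F : x y / (x + y)%R}.
    by move=> x y; apply: letter_inj => t; rewrite letterD !letterF letterD fiD.
  have ZF w : w \in words N U i -> iter (R + c') (string_op f (N := N)) w
      = iter c' (string_op f (N := N)) (F w).
    move=> /(wordsP UG)[wU w0]; rewrite addnC iterD; congr (iter _ _ _).
    apply: letter_inj => t; rewrite letterF iter_op_frobenius// -/R.
    by rewrite [letter w (R + t)]w0 ?addr0//; lia.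
  rewrite (card_image_kernel (word2 V2 (N := N)) FD); last first.
    exact: words_ker_subgroup.
  have -> : F @: words_ker U i (R + c') = words_ker (iter R f @: U) i c'.
    apply/setP => w; apply/imsetP/idP => [[v + ->]|].
      rewrite !mem_words_ker => /andP[vi /eqP]; rewrite ZF// => ->.
      rewrite eqxx andbT; move: vi => /(wordsP UG)[vU v0].
      apply/(wordsP U''G); split=> t; rewrite letterF; first exact: imset_f.
      by move=> it; rewrite v0// iter_morph0.
    rewrite mem_words_ker => /andP[/(wordsP U''G)[wU w0] wc].
    (* letterwise preimages under [f ^ R] *)
    pose g t := if t < i then odflt 0%R [pick u in U | iter R f u == letter w t]
                else 0%R.
    have gP t : g t \in U /\ iter R f (g t) = letter w t.
      rewrite /g; case: ltnP => [_|it]; last by rewrite w0// iter_morph0//; case: UG.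
      case: pickP => /= [u /andP[Uu /eqP//]|no].
      by move: (wU t) => /imsetP[u Uu e]; have := no u; rewrite Uu e eqxx.
    have letg t : letter [ffun t : 'I_N => g t] t = g t.
      rewrite letter_fun; case: ltnP => // Nt; rewrite /g ltnNge.
      by rewrite (leq_trans iR)// (leq_trans RN).
    have gi : [ffun t : 'I_N => g t] \in words N U i.
      apply/(wordsP UG); split=> t; rewrite letg; first by case: (gP t).
      by move=> it; rewrite /g ltnNge it.
    have Fg : F [ffun t : 'I_N => g t] = w.
      by apply: letter_inj => t; rewrite letterF letg; case: (gP t).
    by exists [ffun t : 'I_N => g t] => //; rewrite mem_words_ker gi ZF// Fg.
  have -> : [set w in words_ker U i (R + c') | F w == 0%R]
      = words N (stable_ker U R) i.
    apply/setP => w; rewrite inE mem_words_ker; apply/idP/(wordsP U'G).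
      move=> /andP[/andP[/(wordsP UG)[wU w0] _] /eqP Fw0]; split=> // t.
      by rewrite mem_stable_ker wU -letterF Fw0 letter0 eqxx.
    move=> [wU w0].
    have Fw : F w = 0%R.
      apply: letter_inj => t; rewrite letterF letter0.
      by move: (wU t); rewrite mem_stable_ker => /andP[_ /eqP].
    have wi : w \in words N U i.
      apply/(wordsP UG); split=> // t.
      by move: (wU t); rewrite mem_stable_ker => /andP[].
    by rewrite wi ZF// Fw (iter_morph0 (@string_opD _ _ fD N)) eqxx.
  rewrite card_words// ?(leq_trans iR)// (IH _ (fun b => n (R + b)))//.
  - rewrite Un ?leq_addr// -expnM -expnD; congr (2 ^ _).
    rewrite [RHS](eq_big_nat _ _ (F2 := fun a => \sum_(0 <= b < R) n b
       + \sum_(0 <= b < c') n (R + nim k a b))); last first.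
      move=> a /andP[_ ai]; have aR := leq_trans ai iR.
      rewrite (@big_cat_nat _ _ _ R) ?leq_addr//; congr addn.
        rewrite -(sum_nim n aR); apply: eq_big_nat => b /andP[_ bR].
        by rewrite nimS_lt.
      rewrite -{1}[R]add0n big_addn addKn; apply: eq_big_nat => b /andP[_ bc].
      by rewrite addnC nimS_geR// (leq_trans bc).
    by rewrite big_split /= sum_nat_const_nat subn0 addnC mulnC.
  - move=> _ /imsetP[u Uu ->]; apply/imsetP; exists (f u); first exact: Uf.
    by rewrite -iterS iterSr.
  - by move=> _ /imsetP[u Uu ->]; rewrite -iterD UQ.
  - move=> c0 c0R.
    have RcQ : R + c0 <= R + R by rewrite leq_add2l.
    have := card_image_kernel V2 (fiD R) (subgroup_kernel (fiD (R + c0)) UG).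
    rewrite -/(stable_ker U (R + c0)) Un// (@big_cat_nat _ _ _ R)//= ?leq_addr//.
    have -> : [set x in stable_ker U (R + c0) | iter R f x == 0%R]
        = stable_ker U R.
      apply/setP => u; rewrite inE !mem_stable_ker -andbA; congr andb.
      rewrite andb_idl// => /eqP uR; apply/eqP.
      exact: (iter_kernel_le fD (leq_addr _ _) uR).
    have -> : iter R f @: stable_ker U (R + c0) = stable_ker (iter R f @: U) c0.
      apply/setP => v; rewrite mem_stable_ker; apply/imsetP/andP.
        move=> [u]; rewrite mem_stable_ker addnC iterD => /andP[Uu u0] ->.
        by split=> //; exact: imset_f.
      move=> [/imsetP[u Uu ->] u0]; exists u => //.
      by rewrite mem_stable_ker Uu addnC iterD.
    rewrite (Un R) ?leq_addr// expnD mulnC => /eqP.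
    rewrite eqn_pmul2r ?expn_gt0// => /eqP <-; congr (2 ^ _).
    by rewrite -{1}[R]add0n big_addn addKn; apply: eq_big_nat => b _; rewrite addnC.
have low i c : i <= R -> c <= R + R -> #|words_ker U i c| =
    2 ^ \sum_(0 <= a < i) \sum_(0 <= b < c) n (nim k.+1 a b).
  move=> iR cQ; have [cR|/ltnW Rc] := leqP c R; first exact: small.
  by apply: mixed => //; rewrite Rc.
move=> i c iQ cQ; have [iR|Ri] := leqP i R; first exact: low.
have := words_ker_reflection V2 fD UG Uf (k := k.+1) (N := N).
rewrite expn2S -/R => /(_ RRN UQ i c iQ cQ).
rewrite low ?leq_subr//; last by lia.
rewrite cardU -!expnM -expnD => e.
have := @nim_box_reflection k.+1 n i c; rewrite expn2S -/R => /(_ iQ cQ).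
rewrite [i * _]mulnC [(R + R - c) * _]mulnC => box; rewrite box expnD in e.
by move/eqP: e; rewrite eqn_pmul2l ?expn_gt0// => /eqP.
Qed.

End StringTheorem.

(** * String systems *)

Section StringSystems.
Local Open Scope nat_scope.

(** A partial successor map on [I], together with a splitting of [I] into the
    strings on which it acts: [ss_enc d t] is the element at position [t] of
    the string [d]. It stands for a nilpotent operator that permutes a basis,
    with the strings as Jordan blocks. *)
Record string_system (I : finType) := StringSystem {
  ss_next : I -> option I;
  ss_index : finType;
  ss_len : ss_index -> nat;
  ss_enc : ss_index -> nat -> I;
  ss_dec : I -> ss_index * nat;
  ss_decK : forall i, ss_enc (ss_dec i).1 (ss_dec i).2 = i;
  ss_dec_lt : forall i, (ss_dec i).2 < ss_len (ss_dec i).1;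
  ss_encK : forall d t, t < ss_len d -> ss_dec (ss_enc d t) = (d, t);
  ss_nextE : forall d t, t < ss_len d ->
    ss_next (ss_enc d t) = if t.+1 < ss_len d then Some (ss_enc d t.+1) else None
}.

Definition ss_pos (I : finType) (s : string_system I) i := (ss_dec s i).2.

Definition system_op (V : finZmodType) (f : V -> V) (I : finType)
    (s : string_system I) (w : {ffun I -> V}) : {ffun I -> V} :=
  [ffun i => (f (w i) + if ss_next s i is Some j then w j else 0)%R].

(** The number [n b] is that of the Jordan blocks of [f] of size larger than
    [b], [V] being regarded as a vector space over the field with two elements. *)
Definition has_profile k (V : finZmodType) (f : V -> V) (n : nat -> nat) :=
  [/\ char2 V, {morph f : x y / (x + y)%R}, forall v, iter (2 ^ k) f v = 0%R &
      forall c, c <= 2 ^ k ->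
        #|[set v | iter c f v == 0%R]| = 2 ^ \sum_(0 <= b < c) n b].

(** Each element lies on one string; hence, in the profile of a system, only
    the positions count, and not the lengths of the strings. *)
Lemma sum_ss_pos (I : finType) (s : string_system I) (g : nat -> nat) :
  \sum_(d : ss_index s) \sum_(0 <= a < ss_len d) g a = \sum_i g (ss_pos s i).
Proof.
rewrite [RHS](partition_big (fun i => (ss_dec s i).1) predT)//=.
apply: eq_bigr => d _.
have -> : \sum_(0 <= a < ss_len d) g a =
    \sum_(i <- [seq ss_enc d a | a <- index_iota 0 (ss_len d)]) g (ss_pos s i).
  rewrite big_map; apply: eq_big_nat => a /andP[_ ad].
  by rewrite /ss_pos ss_encK.
rewrite big_uniq /=; last first.
  rewrite map_inj_in_uniq ?iota_uniq// => x y.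
  rewrite !mem_index_iota /= => xd yd /(congr1 (ss_dec s)).
  by rewrite !ss_encK// => -[].
apply: eq_bigl => i; apply/mapP/eqP => [[a + ->]|<-].
  by rewrite mem_index_iota /= => ad; rewrite ss_encK.
by exists (ss_dec s i).2; rewrite ?ss_decK// mem_index_iota ss_dec_lt.
Qed.

Lemma is_subgroupT (V : finZmodType) : is_subgroup [set: V].
Proof. by split=> [|x y _ _]; rewrite inE. Qed.

(** The operator acts separately on each string, where it is [string_op], so
    that its kernels are products of kernels of strings. *)
Theorem profile_system k (V : finZmodType) (f : V -> V) (n : nat -> nat)
    (I : finType) (s : string_system I) :
  (forall d : ss_index s, ss_len d <= 2 ^ k) ->
  has_profile k f n ->
  has_profile k (system_op f s) (fun b => \sum_i n (nim k (ss_pos s i) b)).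
Proof.
move=> sQ [V2 fD fQ fn]; set N := 2 ^ k.
pose word_of (w : {ffun I -> V}) (d : ss_index s) : {ffun 'I_N -> V} :=
  [ffun t : 'I_N => if t < ss_len d then w (ss_enc d t) else 0%R].
have letter_word w d t :
    letter (word_of w d) t = if t < ss_len d then w (ss_enc d t) else 0%R.
  rewrite (@letter_fun V N (fun t => if t < ss_len d then w (ss_enc d t) else 0%R)).
  case: (ltnP t (ss_len d)) => [td|_]; last by case: ifP.
  by rewrite (leq_trans td).
have word_mem w d : word_of w d \in words N [set: V] (ss_len d).
  apply/(wordsP (is_subgroupT V)); split=> t; first by rewrite inE.
  by rewrite letter_word ltnNge => ->.
have word_op w d : word_of (system_op f s w) d = string_op f (word_of w d).
  apply: letter_inj => t; rewrite (letter_string_op fD) !letter_word.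
  case: (ltnP t) => [td|dt].
    by rewrite ffunE ss_nextE//; case: ifP.
  by rewrite ltnNge leqW// addr0 (morph_add0 fD).
have word_iter c w d :
    word_of (iter c (system_op f s) w) d = iter c (string_op f (N := N)) (word_of w d).
  by elim: c => //= c <-; rewrite word_op.
have word_inj w w' : word_of w =1 word_of w' -> w = w'.
  move=> ww'; apply/ffunP => i; rewrite -(ss_decK s i).
  have := congr1 (fun x => letter x (ss_dec s i).2) (ww' (ss_dec s i).1).
  by rewrite !letter_word ss_dec_lt.
have word0 d : word_of 0%R d = 0%R.
  by apply: letter_inj => t; rewrite letter_word letter0 ffunE; case: ifP.
split.
- by move=> w; apply/ffunP => i; rewrite !ffunE.
- move=> x y; apply/ffunP => i; rewrite !ffunE fD addrACA.
  by case: ss_next => [j|]; rewrite ?ffunE // !addr0.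
- move=> w; apply: word_inj => d; rewrite word_iter word0.
  have wN : word_of w d \in words N [set: V] N.
    apply/(wordsP (is_subgroupT V)); split=> t; first by rewrite inE.
    move=> Nt; have /(wordsP (is_subgroupT V))[_ w0] := word_mem w d.
    by apply: w0; exact: leq_trans (sQ d) Nt.
  by apply: (words_nilp V2 fD (is_subgroupT V)) wN.
move=> c cN.
pose F d := mem (words_ker f N [set: V] (@ss_len _ s d) c).
have -> : #|[set w | iter c (system_op f s) w == 0%R]| =
    #|(family F : pred {ffun ss_index s -> {ffun 'I_N -> V}})|.
  pose G (w : {ffun I -> V}) := [ffun d => word_of w d].
  have G_inj : injective G.
    move=> w w' GG; apply: word_inj => d.
    by have /ffunP/(_ d) := GG; rewrite !ffunE.
  rewrite -(card_imset _ G_inj); apply: eq_card => g.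
  apply/imsetP/familyP => [[w + ->] d|gF].
    rewrite inE => /eqP w0; rewrite ffunE mem_words_ker word_mem -word_iter w0.
    by rewrite word0 eqxx.
  pose w := [ffun i => letter (g (ss_dec s i).1) (ss_dec s i).2].
  have gw d : g d = word_of w d.
    apply: letter_inj => t; rewrite letter_word; case: ltnP => [td|dt].
      by rewrite ffunE ss_encK.
    have := gF d; rewrite mem_words_ker => /andP[/(wordsP (is_subgroupT V))[_ ->]//].
  exists w; last by apply/ffunP => d; rewrite ffunE.
  rewrite inE; apply/eqP; apply: word_inj => d; rewrite word0 word_iter -gw.
  by have := gF d; rewrite mem_words_ker => /andP[_ /eqP].
rewrite card_family foldrE big_map big_enum /=.
rewrite (eq_bigr (fun d => 2 ^ \sum_(0 <= a < @ss_len _ s d)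
    \sum_(0 <= b < c) n (nim k a b))) => [|d _]; last first.
  apply: (card_string_kernel V2 fD) => //; first exact: is_subgroupT.
  by move=> c' c'N; rewrite -fn//; apply: eq_card => v; rewrite !inE.
rewrite -expn_sum; congr (2 ^ _).
rewrite (sum_ss_pos s (fun a => \sum_(0 <= b < c) n (nim k a b))).
by rewrite exchange_big.
Qed.

Lemma profile_transfer k (V W : finZmodType) (f : V -> V) (g : W -> W)
    (phi : V -> W) n :
  char2 W -> {morph g : x y / (x + y)%R} ->
  bijective phi -> {morph phi : x y / (x + y)%R} ->
  (forall v, phi (f v) = g (phi v)) ->
  has_profile k f n -> has_profile k g n.
Proof.
move=> W2 gD [psi phiK psiK] phiD fg [V2 fD fQ fn].
have it c v : phi (iter c f v) = iter c g (phi v).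
  by elim: c => //= c <-; rewrite fg.
split=> // [w|c cQ]; first by rewrite -(psiK w) -it fQ (morph_add0 phiD).
rewrite -fn// -(card_imset _ (can_inj phiK)); apply: eq_card => w.
rewrite inE; apply/eqP/imsetP => [w0|[v + ->]].
  exists (psi w); rewrite ?psiK// inE -(inj_eq (can_inj phiK)).
  by rewrite it psiK w0 (morph_add0 phiD).
by rewrite inE => /eqP v0; rewrite -it v0 (morph_add0 phiD).
Qed.

Lemma profile_base k : has_profile k (fun _ : 'F_2 => 0%R) (fun b => b == 0).
Proof.
split.
- by move=> v; apply/val_inj; case: v => -[|[|]].
- by move=> x y; rewrite addr0.
- by move=> v; have := expn_gt0 2 k; case: (2 ^ k).
case=> [|c] _.
  rewrite big_geq// expn0 -[RHS](cards1 (0%R : 'F_2)); apply: eq_card => v.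
  by rewrite !inE.
rewrite big_nat_recl//= big1// addn0.
transitivity #|'F_2|; last by rewrite card_Fp.
by apply: eq_card => v; rewrite !inE /= eqxx.
Qed.

End StringSystems.

(** * Monomials acting on truncated polynomials *)

Section MonomialSystems.
Local Open Scope nat_scope.
Variables (q : nat) (q_gt0 : 0 < q).

(** Only its values below [q] matter. *)
Definition cut x : 'I_q := insubd (Ordinal q_gt0) x.

Lemma cutE x : x < q -> cut x = x :> nat.
Proof. by move=> xq; rewrite /cut insubdK. Qed.

Lemma cut_ord (i : 'I_q) : cut i = i.
Proof. by apply/val_inj; rewrite /= cutE. Qed.

Definition pow_next r (i : 'I_q) : option 'I_q := insub (i + r).

Lemma pow_nextE r (i : 'I_q) :
  pow_next r i = if i + r < q then Some (cut (i + r)) else None.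
Proof.
rewrite /pow_next; case: ltnP => [iq|qi]; last by rewrite insubF// ltnNge qi.
by rewrite insubT; congr Some; apply/val_inj; rewrite /= cutE.
Qed.

Definition pair_next (ij : 'I_q * 'I_q) : option ('I_q * 'I_q) :=
  if (pow_next 1 ij.1, pow_next 1 ij.2) is (Some i, Some j) then Some (i, j)
  else None.

Section Power.
Variables (r : nat) (r_gt0 : 0 < r).

Let len (d : 'I_r) := (q + r - 1 - d) %/ r.
Let enc (d : 'I_r) t := cut (t * r + d).
Let dec (i : 'I_q) : 'I_r * nat := (Ordinal (ltn_pmod i r_gt0), i %/ r).

Let lenP d t : (t < len d) = (t * r + d < q).
Proof. by have := ltn_ord d; rewrite /len leq_divRL// mulSn; lia. Qed.

Let decK i : enc (dec i).1 (dec i).2 = i.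
Proof. by apply/val_inj; rewrite /= cutE -divn_eq. Qed.

Let dec_lt i : (dec i).2 < len (dec i).1.
Proof. by rewrite lenP/= -divn_eq. Qed.

Let encK d t : t < len d -> dec (enc d t) = (d, t).
Proof.
rewrite lenP => dq; rewrite /dec; congr pair; last first.
  by rewrite cutE// divnMDl// divn_small ?addn0.
by apply/val_inj; rewrite /= cutE// modnMDl modn_small.
Qed.

Let nextE d t : t < len d ->
  pow_next r (enc d t) = if t.+1 < len d then Some (enc d t.+1) else None.
Proof.
rewrite !lenP => dq; rewrite pow_nextE cutE// /enc.
by have -> : t.+1 * r + d = t * r + d + r by rewrite mulSn; lia.
Qed.

(** Multiplication by [x ^ r] on the powers of [x] below [x ^ q]: the strings
    are the classes modulo [r], and [i] has position [i %/ r]. *)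
Definition pow_system : string_system 'I_q :=
  StringSystem decK dec_lt encK nextE.

Lemma pow_system_pos i : ss_pos pow_system i = i %/ r.
Proof. by []. Qed.

Lemma pow_system_len (d : ss_index pow_system) : ss_len d <= q.
Proof.
rewrite leqNgt; apply/negP; rewrite [X in _ < X]/(len d) lenP; apply/negP.
by rewrite -leqNgt; apply: leq_trans (leq_addr _ _); rewrite leq_pmulr.
Qed.
End Power.

Section Pair.
Let len (d : 'I_q * bool) := if (d.1 == 0 :> nat) && d.2 then 0 else q - d.1.
Let enc (d : 'I_q * bool) t :=
  if d.2 then (cut t, cut (t + d.1)) else (cut (t + d.1), cut t).
Let dec (ij : 'I_q * 'I_q) : ('I_q * bool) * nat :=
  if ij.1 < ij.2 then ((cut (ij.2 - ij.1), true), nat_of_ord ij.1)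
  else ((cut (ij.1 - ij.2), false), nat_of_ord ij.2).

Let sub_lt (i j : 'I_q) : i - j < q.
Proof. exact: leq_ltn_trans (leq_subr _ _) (ltn_ord i). Qed.

Let decK ij : enc (dec ij).1 (dec ij).2 = ij.
Proof.
case: ij => i j; rewrite /enc /dec /=; case: (ltnP i j) => ij /=;
by rewrite !cutE// subnKC ?(ltnW ij)// !cut_ord.
Qed.

Let dec_lt ij : (dec ij).2 < len (dec ij).1.
Proof.
case: ij => i j; rewrite /len /dec /=; case: (ltnP i j) => ij /=;
  rewrite !cutE// ?andbT ?andbF.
  have -> /= : (j - i == 0) = false by lia.
  by have := ltn_ord j; lia.
by have := ltn_ord i; lia.
Qed.

Let encK d t : t < len d -> dec (enc d t) = (d, t).
Proof.
case: d => a b; rewrite /len /dec /enc; case: b => /=; rewrite ?andbT ?andbF.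
  case: eqP => // /eqP; rewrite -lt0n => a_gt0 ts.
  rewrite !cutE; try lia.
  rewrite -[X in X < _]addn0 ltn_add2l a_gt0 addKn; congr (_, _, _).
  exact: cut_ord.
move=> ts; rewrite !cutE; try lia.
rewrite ltnNge leq_addr/= addKn; congr (_, _, _).
exact: cut_ord.
Qed.

Let nextE d t : t < len d ->
  pair_next (enc d t) = if t.+1 < len d then Some (enc d t.+1) else None.
Proof.
case: d => a b; rewrite /len /enc /pair_next !pow_nextE.
case: b => /=; rewrite ?andbT ?andbF.
  case: eqP => // _ ts; rewrite !cutE ?addn1; try lia.
  have -> : (t.+1 < q - a) = ((t + a).+1 < q) by lia.
  case: (ltnP (t + a).+1 q) => [t1|t1]; last by case: ifP.
  by rewrite ifT//; lia.
move=> ts; rewrite !cutE ?addn1; try lia.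
have -> : (t.+1 < q - a) = ((t + a).+1 < q) by lia.
case: (ltnP (t + a).+1 q) => [t1|//].
by rewrite ifT//; lia.
Qed.

(** Multiplication by [x * y] on the monomials [x ^ i * y ^ j]: the strings are
    the diagonals, indexed by the absolute value of [j - i] and by its sign.
    The main diagonal must occur once, so one of the two indices with
    difference 0 gets the length 0. *)
Definition pair_system : string_system ('I_q * 'I_q)%type :=
  StringSystem decK dec_lt encK nextE.

Lemma pair_system_pos ij : ss_pos pair_system ij = minn ij.1 ij.2.
Proof. by rewrite /ss_pos /= /dec /minn; case: ifP. Qed.

Lemma pair_system_len (d : ss_index pair_system) : ss_len d <= q.
Proof. by rewrite /= /len; case: ifP => // _; exact: leq_subr. Qed.
End Pair.
End MonomialSystems.

(** * Binary characters *)

Section BinaryCharacters.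
Implicit Types (j e a b i l : nat).

(** The [j]-th Rademacher function, that is, a sign read from the [j]-th binary
    digit. It is a character for the exclusive or. *)
Definition chi j a : int := (-1) ^+ odd (a %/ 2 ^ j).

Lemma chi_shift j a c : chi j (c * 2 ^ j + a)%N = (-1) ^+ c * chi j a.
Proof.
by rewrite /chi divnMDl ?expn_gt0// oddD signr_addb signr_odd.
Qed.

Lemma chi_lt j a : (a < 2 ^ j)%N -> chi j a = 1.
Proof. by move=> aj; rewrite /chi divn_small. Qed.

Lemma chi_ge j a : (a < 2 ^ j)%N -> chi j (2 ^ j + a)%N = -1.
Proof. by move=> aj; rewrite -[X in (X + _)%N]mul1n chi_shift chi_lt. Qed.

Lemma chi_addl j e a : (j < e)%N -> chi j (2 ^ e + a)%N = chi j a.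
Proof.
move=> je; rewrite -(subnK je) expnD expnS mulnA chi_shift.
by rewrite mulnC exprM sqrrN !expr1n mul1r.
Qed.

Lemma chi_nim e j a b : (j < e)%N -> (a < 2 ^ e)%N -> (b < 2 ^ e)%N ->
  chi j (nim e a b) = chi j a * chi j b.
Proof.
elim: e a b => // e IH a b; rewrite ltnS leq_eqVlt => je.
have step x y : (x < 2 ^ e)%N -> (y < 2 ^ e)%N ->
    [/\ chi j (nim e.+1 x y) = chi j x * chi j y,
        chi j (nim e.+1 x (2 ^ e + y)%N) = chi j x * chi j (2 ^ e + y)%N &
        chi j (nim e.+1 (2 ^ e + x)%N (2 ^ e + y)%N)
          = chi j (2 ^ e + x)%N * chi j (2 ^ e + y)%N].
  move=> xe ye.
  have -> : nim e.+1 (2 ^ e + x)%N (2 ^ e + y)%N = nim e x y.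
    by rewrite /= ![(2 ^ e + _ < _)%N]ltnNge !leq_addr/= !modnDl !modn_small.
  rewrite nimS_lt// nimS_geR//; have nl := nim_lt e x y.
  case/predU1P: je => [je|je]; last by rewrite !chi_addl// IH.
  by subst j; rewrite !chi_ge// !chi_lt.
move=> ae be.
have half x : (x < 2 ^ e.+1)%N -> (2 ^ e <= x)%N -> exists2 y, (y < 2 ^ e)%N & x = (2 ^ e + y)%N.
  rewrite expn2S => xe ex; exists (x - 2 ^ e)%N; last by rewrite subnKC.
  by rewrite ltn_subLR.
have [al|/(half _ ae)[a' al ->]] := ltnP a (2 ^ e);
  have [bl|/(half _ be)[b' bl ->]] := ltnP b (2 ^ e).
- by have [] := step a b al bl.
- by have [] := step a b' al bl.
- by rewrite nimC mulrC; have [] := step b a' bl al.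
- by have [] := step a' b' al bl.
Qed.

Lemma sum_halfz (n : nat -> int) r :
  \sum_(0 <= i < r + r) n i =
  \sum_(0 <= i < r) n i + \sum_(0 <= i < r) n (r + i)%N.
Proof.
rewrite (@big_cat_nat _ _ _ r)//= ?leq_addr//; congr (_ + _).
by rewrite -{1}[r]add0n big_addn addnK; apply: eq_bigr => i _; rewrite addnC.
Qed.

Lemma sum_chi e l : (l < e)%N -> \sum_(0 <= i < 2 ^ e) chi l i = 0.
Proof.
elim: e => // e IH; rewrite ltnS leq_eqVlt expn2S sum_halfz.
case/predU1P => [->|le].
  rewrite -big_split /= big_nat big1// => i /andP[_ ie].
  by rewrite chi_lt// chi_ge.
rewrite (eq_bigr _ (fun i _ => chi_addl i le)) IH//.
Qed.

(** Both indices are split according to their digit of weight [2 ^ e]. If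
    [l < e], the two mixed quarters vanish and the two others agree; if
    [l = e], the others cancel and each mixed quarter contributes the square of
    [2 ^ e]. *)
Lemma sum_chi_min e l : (l < e)%N ->
  \sum_(0 <= i < 2 ^ e) \sum_(0 <= j < 2 ^ e) chi l (minn i j)
  = (2 ^ l * 2 ^ e)%:Z.
Proof.
elim: e => // e IH; rewrite ltnS leq_eqVlt expn2S => le.
pose q := (2 ^ e)%N; rewrite -/q.
rewrite (eq_big_nat _ _ (F2 := fun i => \sum_(0 <= j < q) chi l (minn i j)
   + \sum_(0 <= j < q) chi l (minn i (q + j)))); last by move=> i _; rewrite sum_halfz.
rewrite big_split /= !sum_halfz.
set ll := \sum_(0 <= i < q) \sum_(0 <= i0 < q) chi l (minn i i0).
have hl : \sum_(0 <= i < q) \sum_(0 <= j < q) chi l (minn (q + i) j)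
    = \sum_(0 <= i < q) chi l i *+ q.
  rewrite exchange_big_nat /=; apply: eq_big_nat => i /andP[_ iq].
  rewrite (eq_bigr (fun=> chi l i)) ?sumr_const_nat ?subn0// => j _.
  by rewrite (minn_idPr _)//; lia.
have lh : \sum_(0 <= i < q) \sum_(0 <= j < q) chi l (minn i (q + j))
    = \sum_(0 <= i < q) chi l i *+ q.
  apply: eq_big_nat => i /andP[_ iq].
  rewrite (eq_bigr (fun=> chi l i)) ?sumr_const_nat ?subn0// => j _.
  by rewrite (minn_idPl _)//; lia.
rewrite hl lh sumrMnl.
have hh : \sum_(0 <= i < q) \sum_(0 <= j < q) chi l (minn (q + i) (q + j))
    = \sum_(0 <= i < q) \sum_(0 <= j < q) chi l (q + minn i j).
  by apply: eq_bigr => i _; apply: eq_bigr => j _; rewrite addn_minr.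
rewrite hh; case/predU1P: le => [le|le].
  subst l.
  have one : \sum_(0 <= i < q) chi e i = q%:Z.
    rewrite (eq_big_nat _ _ (F2 := fun=> 1)) => [|i /andP[_ iq]]; last exact: chi_lt.
    by rewrite sumr_const_nat subn0 natz.
  have -> : ll = (q * q)%:Z.
    rewrite /ll (eq_big_nat _ _ (F2 := fun=> q%:Z)) => [|i /andP[_ iq]].
      by rewrite sumr_const_nat subn0 -mulr_natr natz PoszM.
    rewrite (eq_big_nat _ _ (F2 := fun=> 1)) => [|j /andP[_ jq]].
      by rewrite sumr_const_nat subn0 natz.
    by rewrite chi_lt// gtn_min iq.
  rewrite one (eq_big_nat _ _ (F2 := fun=> - q%:Z)) => [|i /andP[_ iq]].
    rewrite sumr_const_nat subn0 mulNrn subrr addr0 -mulr_natr natz mulnDr.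
    by rewrite PoszD !PoszM.
  rewrite (eq_big_nat _ _ (F2 := fun=> -1)) => [|j /andP[_ jq]].
    by rewrite sumr_const_nat subn0 mulNrn natz.
  by rewrite chi_ge// gtn_min iq.
rewrite sum_chi// mul0rn.
under eq_bigr => i _ do under eq_bigr => j _ do rewrite chi_addl//.
rewrite -/ll /ll IH// addr0 add0r -PoszD mulnDr.
by [].
Qed.

(** As [1 - chi l b] is twice the [l]-th digit of [b], the sum on the right is
    [2 ^ e - 1 - 2 * b]. *)
Lemma chi_sum_id e b : (b < 2 ^ e)%N ->
  (2 * (2 ^ e - b))%:Z - 1 = (2 ^ e)%:Z + \sum_(l < e) (2 ^ l)%:Z * chi l b.
Proof.
elim: e b => [|e IH] b; first by rewrite ltnS leqn0 big_ord0 => /eqP ->.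
have low x : (x < 2 ^ e)%N -> \sum_(l < e) (2 ^ l)%:Z * chi l (2 ^ e + x)%N
    = \sum_(l < e) (2 ^ l)%:Z * chi l x.
  by move=> xe; apply: eq_bigr => l _; rewrite chi_addl.
rewrite expn2S big_ord_recr/=; have [be _|eb be] := ltnP b (2 ^ e).
  rewrite [chi e b]chi_lt// mulr1; have := IH _ be.
  by set S := \sum_(l < e) _; set r := (2 ^ e)%N in be *; lia.
have be' : (b - 2 ^ e < 2 ^ e)%N by rewrite ltn_subLR.
rewrite -[in RHS](subnKC eb) low// chi_ge//; have := IH _ be'.
by set S := \sum_(l < e) _; set r := (2 ^ e)%N in be be' eb *; lia.
Qed.

(** The function summed changes sign under translation by [3 * 2 ^ l], so its
    sum over a window of length [3 * 2 ^ l.+1] is 0. If [e = e' + 2] with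
    [e' > l], the numbers from [2 ^ e'] to [2 ^ e] fill such windows, so the
    sum does not change when [e] decreases by 2. *)
Lemma sum_chi_third e l : (l < e)%N ->
  \sum_(0 <= i < 2 ^ e) chi l (i %/ 3) = (2 ^ l.+1)%:Z.
Proof.
pose g i := chi l (i %/ 3).
have g_period i : g (3 * 2 ^ l + i)%N = - g i.
  rewrite /g mulnC divnMDl// -[X in (X + _)%N]mul1n chi_shift expr1.
  by rewrite mulN1r.
have window i0 c : \sum_(i0 <= i < c * (3 * 2 ^ l.+1) + i0) g i = 0.
  rewrite -{1}[i0]add0n big_addn addnK; elim: c => [|c IHc].
    by rewrite mul0n big_geq.
  rewrite mulSn addnC (@big_cat_nat _ _ _ (c * (3 * 2 ^ l.+1))) ?leq_addr//= IHc.
  set i1 := (c * _)%N.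
  rewrite add0r -{1}[i1]add0n big_addn addKn expn2S mulnDr sum_halfz.
  rewrite -big_split big1// => i _ /=.
  by rewrite -[(3 * 2 ^ l + i + i1)%N]addnA -[(3 * 2 ^ l + _ + i0)%N]addnA g_period addrN.
elim: e {-2}e (leqnn e) => [|k IH] e ek le; first by move: ek le; rewrite leqn0 => /eqP ->.
have [el|le1] := leqP e l.+1.
  have -> : e = l.+1 by apply/eqP; rewrite eqn_leq el.
  rewrite (eq_big_nat _ _ (F2 := fun=> 1)) => [|i /andP[_ il]].
    by rewrite sumr_const_nat subn0 natz.
  by apply: chi_lt; rewrite ltn_divLR// (leq_trans il)// expnS mulnC leq_mul2l orbT.
have [e2|le2] := leqP e l.+2.
  have -> : e = l.+2 by apply/eqP; rewrite eqn_leq e2.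
  have e4 : (2 ^ l.+2 = 3 * 2 ^ l + 2 ^ l)%N by rewrite !expnS; lia.
  rewrite e4; set r := (3 * 2 ^ l)%N.
  have tail : \sum_(r <= i < r + 2 ^ l) g i = \sum_(0 <= i < 2 ^ l) g (i + r)%N.
    by rewrite -{1}[r]add0n big_addn addKn.
  rewrite (@big_cat_nat _ _ _ r) ?leq_addr//= tail.
  rewrite (eq_big_nat _ _ (F2 := fun=> 1)) => [|i /andP[_ il]]; last first.
    by apply: chi_lt; rewrite ltn_divLR// mulnC.
  rewrite [X in _ + X](eq_big_nat _ _ (F2 := fun=> -1)) => [|i /andP[_ il]]; last first.
    by rewrite addnC g_period /g chi_lt// (leq_ltn_trans (leq_div _ _)).
  rewrite !sumr_const_nat !subn0 mulNrn !natz expnS /r; lia.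
have [e' ee'] : exists e', e = e'.+2 by exists e.-2; lia.
have le' : (l < e')%N by lia.
have -> : (2 ^ e = 2 ^ (e' - l.+1) * (3 * 2 ^ l.+1) + 2 ^ e')%N.
  by rewrite ee' mulnCA -expnD subnK// !expnS; lia.
rewrite (@big_cat_nat _ _ _ (2 ^ e')) ?leq_addl//= window addr0.
by apply: IH => //; lia.
Qed.

(** All the profiles met below are affine combinations of binary characters. *)
Definition chi_profile e (n : nat -> nat) (alpha : int) (beta : nat -> int) :=
  forall b, (b < 2 ^ e)%N -> (n b)%:Z = alpha + \sum_(l < e) beta l * chi l b.

(** As [chi l] is multiplicative for the exclusive or, a string system
    multiplies its coefficient by the sum of [chi l] over the positions: all
    systems act diagonally. *)
Lemma sum_ord_chi e n alpha beta (I : finType) (pos : I -> nat) b :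
  chi_profile e n alpha beta -> (b < 2 ^ e)%N -> (forall x, pos x < 2 ^ e)%N ->
  (\sum_x n (nim e (pos x) b))%N%:Z =
  alpha *+ #|I| + \sum_(l < e) beta l * (\sum_x chi l (pos x)) * chi l b.
Proof.
move=> ne be posq; rewrite -natz natr_sum.
rewrite (eq_bigr (fun x => alpha + \sum_(l < e) beta l * (chi l (pos x) * chi l b))).
  rewrite big_split /= sumr_const; congr (_ + _).
  rewrite exchange_big /=; apply: eq_bigr => l _.
  by rewrite -mulrA mulr_suml mulr_sumr; apply: eq_bigr => i _.
move=> i _; rewrite natz ne ?nim_lt//; congr (_ + _).
by apply: eq_bigr => l _; rewrite chi_nim.
Qed.

Lemma sum_pair_pos (q : nat) (R : nmodType) (q0 : (0 < q)%N) (g : nat -> R) :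
  \sum_ij g (ss_pos (pair_system q0) ij) =
  \sum_(0 <= i < q) \sum_(0 <= j < q) g (minn i j).
Proof.
under eq_bigr => ij _ do rewrite pair_system_pos.
rewrite -(pair_bigA _ (fun i j : 'I_q => g (minn i j))) big_mkord /=.
by apply: eq_bigr => i _; rewrite big_mkord.
Qed.

Lemma chi_profile_pair e (q0 : (0 < 2 ^ e)%N) n alpha beta :
  chi_profile e n alpha beta ->
  chi_profile e (fun b => (\sum_ij n (nim e (ss_pos (pair_system q0) ij) b))%N)
    (alpha * (2 ^ e * 2 ^ e)%:Z) (fun l => beta l * (2 ^ l * 2 ^ e)%:Z).
Proof.
move=> ne b be; rewrite (sum_ord_chi ne be) => [|ij]; last first.
  by rewrite pair_system_pos gtn_min ltn_ord.
rewrite card_prod !card_ord -mulr_natr natz; congr (_ + _).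
by apply: eq_bigr => l _; rewrite sum_pair_pos sum_chi_min.
Qed.

Lemma nim_eq0 e a b : (a < 2 ^ e)%N -> (b < 2 ^ e)%N ->
  (nim e a b == 0%N) = (a == b).
Proof.
elim: e a b => [[|[]]// [|[]]//|e IH a b ae be].
have [eq h] : (a = a %/ 2 ^ e * 2 ^ e + a %% 2 ^ e)%N /\ (b = b %/ 2 ^ e * 2 ^ e + b %% 2 ^ e)%N.
  by rewrite -!divn_eq.
have hp x : (x < 2 ^ e.+1)%N -> (x %/ 2 ^ e = ~~ (x < 2 ^ e))%N.
  move=> xe; case: ltnP => [lt|ge]; first by rewrite divn_small.
  apply/eqP; rewrite eqn_leq -ltnS ltn_divLR ?expn_gt0// -expnS xe/=.
  by rewrite leq_divRL ?expn_gt0// mul1n.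
rewrite /= addn_eq0 IH ?ltn_pmod ?expn_gt0//.
rewrite [in RHS]eq [in RHS]h !hp//.
have p : (2 ^ e == 0)%N = false by rewrite expn_eq0.
have lta : (a %% 2 ^ e < 2 ^ e)%N by rewrite ltn_pmod ?expn_gt0.
have ltb : (b %% 2 ^ e < 2 ^ e)%N by rewrite ltn_pmod ?expn_gt0.
case: (a < _)%N; case: (b < _)%N; rewrite /= ?mul0n ?add0n ?mul1n ?eqn_add2l ?p//=.
  by apply/esym/eqP; lia.
by apply/esym/eqP; lia.
Qed.

(** For a single block of size 1, the value at [b] counts the pairs with
    minimum [b], of which there are [2 * (q - b) - 1]. *)
Lemma chi_profile_pair_base e (q0 : (0 < 2 ^ e)%N) :
  chi_profile e
    (fun b => (\sum_ij (nim e (ss_pos (pair_system q0) ij) b == 0))%N)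
    (2 ^ e)%:Z (fun l => (2 ^ l)%:Z).
Proof.
move=> b be; rewrite -chi_sum_id//; set q := (2 ^ e)%N in q0 be *.
have -> : (\sum_ij (nim e (ss_pos (pair_system q0) ij) b == 0) =
    \sum_(0 <= i < q) \sum_(0 <= j < q) (minn i j == b))%N.
  rewrite -(sum_pair_pos q0 (fun a => (a == b) : nat)).
  apply: eq_bigr => ij _; rewrite nim_eq0//.
  by rewrite pair_system_pos gtn_min ltn_ord.
have count_ge x : (\sum_(0 <= j < q) (x <= j) = q - x)%N.
  elim: (q) => [|r IHr]; first by rewrite big_geq// sub0n.
  by rewrite big_nat_recr//= IHr; case: leqP => /=; lia.
have row i : (\sum_(0 <= j < q) (minn i j == b) =
    (i == b) * (q - b) + (b < i))%N.
  have [ib|bi|->] := ltngtP i b.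
  - by rewrite big1// => j _; apply/eqP; rewrite eqb0; apply/eqP; lia.
  - rewrite (bigD1_seq b) ?iota_uniq ?mem_index_iota//= (minn_idPr (ltnW bi)) eqxx.
    rewrite big1// => j jb; apply/eqP; rewrite eqb0; lia.
  rewrite mul1n addn0 -count_ge; apply: eq_bigr => j _; congr nat_of_bool.
  by apply/eqP/idP; lia.
under eq_bigr => i _ do rewrite row.
rewrite big_split /= count_ge.
rewrite (bigD1_seq b) ?iota_uniq ?mem_index_iota//= eqxx mul1n.
rewrite big1 => [|i /negPf ->//]; lia.
Qed.

(** The value at 0 of the profile obtained by adding a cube, which is the
    dimension of the kernel of the whole operator. *)
Lemma sum_third e n alpha beta : chi_profile e n alpha beta ->
  (\sum_(i < 2 ^ e) n (nim e (i %/ 3) 0))%N%:Z =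
  alpha * (2 ^ e)%:Z + \sum_(l < e) beta l * (2 ^ l.+1)%:Z.
Proof.
move=> ne.
have posq (x : 'I_(2 ^ e)) : (x %/ 3 < 2 ^ e)%N.
  exact: leq_ltn_trans (leq_div _ _) (ltn_ord x).
rewrite (sum_ord_chi ne _ posq) ?expn_gt0//.
rewrite card_ord -mulr_natr natz; congr (_ + _); apply: eq_bigr => l _.
rewrite [chi l 0]chi_lt ?expn_gt0// mulr1 -(sum_chi_third (ltn_ord l)).
by rewrite [in RHS]big_mkord.
Qed.

(** Each number below [2 ^ e] is the half of two indices, so the profile is 2
    below [2 ^ e] and 0 above, that is, [1 + chi e]. *)
Lemma chi_profile_square e (q0 : (0 < 2 ^ e.+1)%N) :
  chi_profile e.+1
    (fun b => (\sum_x (nim e.+1 (ss_pos (pow_system q0 (isT : 0 < 2)) x) b == 0))%N)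
    1 (fun l => (l == e)%:R).
Proof.
move=> b be; rewrite [in RHS]big_ord_recr/= eqxx mul1r [in RHS]big1 ?add0r => [|l _]; last first.
  by have /negPf -> := ltn_eqF (ltn_ord l); rewrite mul0r.
have -> : (\sum_(i < 2 ^ e.+1) (nim e.+1 (ss_pos (pow_system q0 (isT : 0 < 2)) i) b == 0)
    = (b < 2 ^ e) * 2)%N.
  transitivity (\sum_(0 <= i < 2 ^ e.+1) (i %/ 2 == b))%N.
    rewrite big_mkord; apply: eq_bigr => i _.
    rewrite nim_eq0// pow_system_pos.
    by exact: leq_ltn_trans (leq_div _ _) (ltn_ord i).
  rewrite expnS mulnC; elim: (2 ^ e)%N => [|r IHr]; first by rewrite big_geq.
  rewrite mulSn !addSn add0n !big_nat_recr//= IHr.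
  have -> : (r * 2 %/ 2 = r)%N by lia.
  have -> : ((r * 2).+1 %/ 2 = r)%N by lia.
  by rewrite ltnS [(b <= r)%N]leq_eqVlt eq_sym; case: ltngtP.
have [lt|ge] := ltnP b (2 ^ e); first by rewrite chi_lt.
rewrite -(subnKC ge) chi_ge// ltn_subLR// -expn2S.
by [].
Qed.

(** Halving runs twice through the numbers below [2 ^ e], on which all
    characters but the leading one sum to 0. *)
Lemma sum_chi_half e l : (l <= e)%N ->
  \sum_(0 <= i < 2 ^ e.+1) chi l (i %/ 2) = (l == e)%:R * (2 ^ e.+1)%:Z.
Proof.
have -> : \sum_(0 <= i < 2 ^ e.+1) chi l (i %/ 2) = (\sum_(0 <= a < 2 ^ e) chi l a) * 2.
  rewrite expnS mulnC; elim: (2 ^ e)%N => [|r IHr]; first by rewrite !big_geq// mul0r.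
  rewrite mulSn !addSn add0n !big_nat_recr//= IHr.
  have -> : (r * 2 %/ 2 = r)%N by lia.
  have -> : ((r * 2).+1 %/ 2 = r)%N by lia.
  by rewrite mulrDl -addrA; congr (_ + _); rewrite mulrDr mulr1.
rewrite leq_eqVlt => /predU1P[->|le]; last first.
  by rewrite sum_chi// (ltn_eqF le) !mul0r.
rewrite eqxx mul1r (eq_big_nat _ _ (F2 := fun=> 1)) => [|i /andP[_ ie]].
  by rewrite sumr_const_nat subn0 !natz expnSr PoszM.
exact: chi_lt.
Qed.

Lemma chi_profile_square_mul e (q0 : (0 < 2 ^ e.+1)%N) n alpha beta :
  chi_profile e.+1 n alpha beta ->
  chi_profile e.+1
    (fun b => (\sum_x n (nim e.+1 (ss_pos (pow_system q0 (isT : 0 < 2)) x) b))%N)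
    (alpha * (2 ^ e.+1)%:Z) (fun l => (l == e)%:R * (beta l * (2 ^ e.+1)%:Z)).
Proof.
move=> ne b be; rewrite (sum_ord_chi ne be) => [|x]; last first.
  exact: leq_ltn_trans (leq_div _ _) (ltn_ord x).
rewrite card_ord -mulr_natr natz; congr (_ + _); apply: eq_bigr => l _.
have := sum_chi_half (ltn_ord l : (l <= e)%N); rewrite big_mkord => ->.
by congr (_ * _); rewrite mulrCA.
Qed.

End BinaryCharacters.

(** * Contractions on a box of exponents *)

Section BoxContraction.
Local Open Scope nat_scope.

(** A function on [I * E] is a function on [I] with values in the functions on
    [E]. *)
Lemma profile_extend k (E E' I : finType) (s : string_system I)
    (op : {ffun E -> 'F_2} -> {ffun E -> 'F_2})
    (op' : {ffun E' -> 'F_2} -> {ffun E' -> 'F_2})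
    (theta : E' -> I * E) (theta' : I * E -> E') n :
  (forall d : ss_index s, ss_len d <= 2 ^ k) ->
  cancel theta theta' -> cancel theta' theta ->
  (forall w a, op' w a =
    (op [ffun x => w (theta' ((theta a).1, x))] (theta a).2 +
     if ss_next s (theta a).1 is Some j then w (theta' (j, (theta a).2)) else 0)%R) ->
  has_profile k op n ->
  has_profile k op' (fun b => \sum_i n (nim k (ss_pos s i) b)).
Proof.
move=> sQ tK tK' opE opn.
pose phi (w : {ffun I -> {ffun E -> 'F_2}}) : {ffun E' -> 'F_2} :=
  [ffun a => w (theta a).1 (theta a).2].
pose psi (w : {ffun E' -> 'F_2}) : {ffun I -> {ffun E -> 'F_2}} :=
  [ffun i => [ffun x => w (theta' (i, x))]].
have phiK : cancel phi psi.
  by move=> w; apply/ffunP => i; apply/ffunP => x; rewrite !ffunE tK'.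
have psiK : cancel psi phi.
  by move=> w; apply/ffunP => a; rewrite !ffunE -surjective_pairing tK.
have phiD : {morph phi : x y / (x + y)%R}.
  by move=> x y; apply/ffunP => a; rewrite !ffunE.
have phi_op w : phi (system_op op s w) = op' (phi w).
  apply/ffunP => a; rewrite opE !ffunE; congr (_ + _)%R.
    by congr (op _ _); apply/ffunP => x; rewrite !ffunE tK'.
  by case: ss_next => [j|]; rewrite !ffunE ?tK'.
have [s2 sD _ _] := profile_system sQ opn.
have op'D : {morph op' : x y / (x + y)%R}.
  move=> x y; rewrite -(psiK x) -(psiK y) -phiD -!phi_op -phiD.
  by congr phi; exact: sD.
apply: (profile_transfer _ op'D (Bijective phiK psiK) phiD phi_op).
  move=> w; apply/ffunP => a; rewrite !ffunE.
  by apply/val_inj; case: (w a) => -[|[|]].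
exact: profile_system.
Qed.

Variables (q : nat) (q_gt0 : 0 < q).

Definition box n := {ffun 'I_n -> 'I_q}.

(** Exponent vectors are sequences indexed by all natural numbers, so that the
    same monomial makes sense in any number of variables. *)
Definition box_shift n (mu : nat -> nat) (a : box n) : option (box n) :=
  if [forall i, a i + mu i < q] then Some [ffun i => cut q_gt0 (a i + mu i)]
  else None.

(** The transpose of the multiplication by the sum of the monomials in [ms], on
    polynomials with all exponents below [q]. *)
Definition contract n (ms : seq (nat -> nat)) (w : {ffun box n -> 'F_2}) :
    {ffun box n -> 'F_2} :=
  [ffun a => (\sum_(mu <- ms) if box_shift mu a is Some b then w b else 0)%R].

Lemma profile_contract0 k : has_profile k (@contract 0 [::]) (fun b => b == 0).
Proof.
pose phi (x : 'F_2) : {ffun box 0 -> 'F_2} := [ffun=> x].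
have a0 (a b : box 0) : a = b by apply/ffunP => -[].
have [pt _] : exists a : box 0, true by exists [ffun i => cut q_gt0 0].
apply: (profile_transfer (phi := phi) _ _ _ _ _ (profile_base k)).
- move=> w; apply/ffunP => a; rewrite !ffunE.
  by apply/val_inj; case: (w a) => -[|[|]].
- by move=> x y; apply/ffunP => a; rewrite !ffunE !big_nil addr0.
- exists (fun w : {ffun box 0 -> 'F_2} => w pt) => [x|w]; first by rewrite ffunE.
  by apply/ffunP => a; rewrite ffunE (a0 a pt).
- by move=> x y; apply/ffunP => a; rewrite !ffunE.
- by move=> x; apply/ffunP => a; rewrite !ffunE big_nil.
Qed.

Definition box_res n m (a : box (n + m)) : box n := [ffun i => a (lshift m i)].
Definition box_cat n m (x : box n) (y : box m) : box (n + m) :=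
  [ffun i => match fintype.split i with inl j => x j | inr j => y j end].
Definition box_tail n m (a : box (n + m)) : box m := [ffun i => a (rshift n i)].

Lemma box_catK n m (a : box (n + m)) : box_cat (box_res a) (box_tail a) = a.
Proof.
apply/ffunP => i; rewrite ffunE; case: splitP => j ij; rewrite ffunE;
by congr (a _); apply/val_inj.
Qed.

Lemma box_cat_l n m (x : box n) (y : box m) i : box_cat x y (lshift m i) = x i.
Proof. by rewrite ffunE; case: (unsplitK (inl i : 'I_n + 'I_m)%type) => ->. Qed.

Lemma box_cat_r n m (x : box n) (y : box m) i : box_cat x y (rshift n i) = y i.
Proof. by rewrite ffunE; case: (unsplitK (inr i : 'I_n + 'I_m)%type) => ->. Qed.

Lemma box_res_cat n m (x : box n) (y : box m) : box_res (box_cat x y) = x.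
Proof. by apply/ffunP => i; rewrite ffunE box_cat_l. Qed.

Lemma box_tail_cat n m (x : box n) (y : box m) : box_tail (box_cat x y) = y.
Proof. by apply/ffunP => i; rewrite ffunE box_cat_r. Qed.

Lemma box_shift_split n m mu (x : box n) (y : box m) :
  box_shift mu (box_cat x y) =
  if box_shift mu x is Some x' then
    if box_shift (fun i => mu (n + i)) y is Some y' then Some (box_cat x' y')
    else None
  else None.
Proof.
have -> : box_shift mu (box_cat x y) =
    if [forall i : 'I_n, x i + mu i < q] && [forall i : 'I_m, y i + mu (n + i) < q]
    then Some (box_cat [ffun i : 'I_n => cut q_gt0 (x i + mu i)]
                    [ffun i : 'I_m => cut q_gt0 (y i + mu (n + i))])
    else None.
  rewrite /box_shift; have -> : [forall i : 'I_(n + m), box_cat x y i + mu i < q] =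
     [forall i : 'I_n, x i + mu i < q] && [forall i : 'I_m, y i + mu (n + i) < q].
    apply/forallP/andP => [PP|[/forallP P1 /forallP P2] i].
      split; apply/forallP => i; first by have := PP (lshift m i); rewrite box_cat_l.
      by have := PP (rshift n i); rewrite box_cat_r.
    by rewrite ffunE; case: splitP => j ->.
  case: ifP => // _; congr Some; apply/ffunP => i; rewrite !ffunE.
  by case: splitP => j ij; rewrite !ffunE ij.
rewrite /box_shift; case: [forall i, x i + mu i < q] => //=.
by case: ifP.
Qed.

Lemma box_shift0 n mu (x : box n) :
  (forall i, i < n -> mu i = 0) -> box_shift mu x = Some x.
Proof.
move=> mu0; rewrite /box_shift ifT; last first.
  by apply/forallP => i; rewrite mu0 ?addn0.
by congr Some; apply/ffunP => i; rewrite ffunE mu0 ?addn0 ?cut_ord.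
Qed.

(** A monomial in new variables only acts on the new factor of the tensor
    product, where it is a string system. *)
Lemma profile_contract_extend k n m ms nu (I : finType) (s : string_system I) p
    (to_box : I -> box m) (of_box : box m -> I) :
  (forall d : ss_index s, ss_len d <= 2 ^ k) ->
  cancel to_box of_box -> cancel of_box to_box ->
  (forall y, omap to_box (ss_next s (of_box y))
             = box_shift (fun i => nu (n + i)) y) ->
  (forall i, i < n -> nu i = 0) ->
  (forall mu, List.In mu ms -> forall i, n <= i -> mu i = 0) ->
  has_profile k (@contract n ms) p ->
  has_profile k (@contract (n + m) (rcons ms nu))
    (fun b => \sum_i p (nim k (ss_pos s i) b)).
Proof.
move=> sQ tK oK next nu0 ms0.
apply: (profile_extend
  (theta := fun a : box (n + m) => (of_box (box_tail a), box_res a))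
  (theta' := fun ix => box_cat ix.2 (to_box ix.1)) sQ).
- by move=> a /=; rewrite oK box_catK.
- by case=> i x; rewrite /= box_tail_cat box_res_cat tK.
move=> w a /=; rewrite !ffunE -cats1 big_cat big_seq1 /=; congr (_ + _)%R.
  elim: ms ms0 => [|mu ms IH] ms0; first by rewrite !big_nil.
  rewrite !big_cons IH => [|mu' i]; last by apply: ms0; right.
  congr (_ + _)%R; rewrite -{1}(box_catK a) box_shift_split.
  case: box_shift => [x'|//]; rewrite box_shift0.
    by rewrite ffunE oK.
  by move=> i _; apply: ms0; [left|exact: leq_addr].
rewrite -{1}(box_catK a) box_shift_split box_shift0// -next.
by case: ss_next.
Qed.

End BoxContraction.

(** * The contraction by the equation *)

Section A2Contraction.
Local Open Scope nat_scope.
Definition pair_mon i (v : nat) : nat := (v == i.*2) || (v == i.*2.+1).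
Definition pow_mon i r (v : nat) : nat := if v == i then r else 0.
Definition pair_mons k := [seq pair_mon i | i <- iota 0 k].

Lemma pair_monsS k : pair_mons k.+1 = rcons (pair_mons k) (pair_mon k).
Proof. by rewrite /pair_mons -addn1 iotaD map_cat cats1. Qed.

Lemma in_pair_mons k mu : List.In mu (pair_mons k) ->
  forall v, k.*2 <= v -> mu v = 0.
Proof.
elim: k => // k IH; rewrite pair_monsS -cats1 => in_cat v kv.
have [in_k|[<-|[]]] := List.in_app_or _ _ _ in_cat; first by apply: IH => //; lia.
by rewrite /pair_mon; case: eqP; case: eqP => //; lia.
Qed.

Variables (q : nat) (q_gt0 : 0 < q).

Local Notation contract n ms := (@contract q q_gt0 n ms).

Lemma profile_contract_pair e n p ms : q = 2 ^ e ->
  (forall mu, List.In mu ms -> forall i, n.*2 <= i -> mu i = 0) ->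
  has_profile e (contract n.*2 ms) p ->
  has_profile e (contract n.+1.*2 (rcons ms (pair_mon n)))
    (fun b => \sum_ij p (nim e (ss_pos (pair_system q_gt0) ij) b)).
Proof.
move=> qe ms0 pn; have -> : n.+1.*2 = n.*2 + 2 by lia.
apply: (@profile_contract_extend _ _ _ _ _ _ _ _ (pair_system q_gt0) _
  (fun ij => [ffun v : 'I_2 => if v == ord0 then ij.1 else ij.2])
  (fun y : box q 2 => (y ord0, y ord_max))) => //.
- by move=> d; rewrite -qe; exact: pair_system_len.
- by case=> i j; rewrite !ffunE.
- by move=> y; apply/ffunP => -[[|[|]]// iq]; rewrite ffunE; congr (y _); apply/val_inj.
- move=> y.
  have -> : ss_next (pair_system q_gt0) = @pair_next q by [].
  rewrite /pair_next !(pow_nextE q_gt0) /box_shift /=.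
  have v0 : pair_mon n (n.*2 + 0) = 1 by rewrite /pair_mon addn0 eqxx.
  have v1 : pair_mon n (n.*2 + 1) = 1 by rewrite /pair_mon addn1 eqxx orbT.
  have -> : [forall i : 'I_2, y i + pair_mon n (n.*2 + i) < q] =
      (y ord0 + 1 < q) && (y ord_max + 1 < q).
    apply/forallP/andP => [yy|[y0 y1] [[|[|]]// iq]].
    + by split; [have := yy ord0; rewrite v0|have := yy ord_max; rewrite v1].
    + by rewrite v0; move: y0; congr (y _ + _ < _); apply/val_inj.
    + by rewrite v1; move: y1; congr (y _ + _ < _); apply/val_inj.
  case: (y ord0 + 1 < q); case: (y ord_max + 1 < q) => //=.
  congr Some; apply/ffunP => -[[|[|]]// iq]; rewrite !ffunE /=.
    by rewrite v0; congr (cut _ (y _ + _)); apply/val_inj.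
  by rewrite v1; congr (cut _ (y _ + _)); apply/val_inj.
- by move=> v vn; rewrite /pair_mon; case: eqP; case: eqP => //; lia.
Qed.

Lemma profile_contract_pow e n p ms r (r_gt0 : 0 < r) : q = 2 ^ e ->
  (forall mu, List.In mu ms -> forall i, n <= i -> mu i = 0) ->
  has_profile e (contract n ms) p ->
  has_profile e (contract n.+1 (rcons ms (pow_mon n r)))
    (fun b => \sum_i p (nim e (ss_pos (pow_system q_gt0 r_gt0) i) b)).
Proof.
move=> qe ms0 pn; rewrite -addn1.
apply: (@profile_contract_extend _ _ _ _ _ _ _ _ (pow_system q_gt0 r_gt0) _
  (fun i => [ffun v : 'I_1 => i]) (fun y : box q 1 => y ord0)) => //.
- by move=> d; rewrite -qe; exact: pow_system_len.
- by move=> i; rewrite ffunE.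
- by move=> y; apply/ffunP => i; rewrite ffunE (ord1 i).
- move=> y.
  have -> : ss_next (pow_system q_gt0 r_gt0) = @pow_next q r by [].
  rewrite (pow_nextE q_gt0) /box_shift.
  have -> : [forall i : 'I_1, y i + pow_mon n r (n + i) < q] = (y ord0 + r < q).
    apply/forallP/idP => [/(_ ord0)|yr i]; rewrite /pow_mon ?addn0 ?eqxx//.
    have -> : i = ord0 by apply/val_inj; case: i => -[].
    by rewrite /= addn0 eqxx.
  case: ifP => //= _; congr Some; apply/ffunP => i.
  have -> : i = ord0 by apply/val_inj; case: i => -[].
  by rewrite !ffunE /pow_mon /= addn0 eqxx.
- by move=> v vn; rewrite /pow_mon; case: eqP => //; lia.
Qed.

Variable e : nat.
Hypothesis qe : q = 2 ^ e.

(** Each of the [k] pairs after the first multiplies the constant by [q ^ 2]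
    and the coefficient of [chi l] by [2 ^ l * q]. *)
Lemma pair_mons_profile k : exists2 p,
  has_profile e (contract k.+1.*2 (pair_mons k.+1)) p &
  chi_profile e p (q ^ k.*2.+1)%:Z (fun l => (q ^ k * 2 ^ (l * k.+1))%:Z).
Proof.
elim: k => [|k [p pp cp]].
  exists (fun b => \sum_ij (nim e (ss_pos (pair_system q_gt0) ij) b == 0)).
    rewrite pair_monsS.
    apply: (@profile_contract_pair e 0 (fun b => b == 0)) => //.
    exact: profile_contract0.
  move: (q_gt0); rewrite qe => q0 b be.
  rewrite (chi_profile_pair_base q0 be) expn1; congr (_ + _)%R.
  by apply: eq_bigr => l _; rewrite expn0 mul1n muln1.
exists (fun b => \sum_ij p (nim e (ss_pos (pair_system q_gt0) ij) b)).
  rewrite pair_monsS; apply: profile_contract_pair => //.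
  exact: in_pair_mons.
move: (q_gt0) cp; rewrite qe => q0 cp b be.
rewrite (chi_profile_pair q0 cp be); congr (_ + _)%R.
  by rewrite -PoszM mulnn -expnD; congr (Posz (_ ^ _)); lia.
apply: eq_bigr => l _; congr (_ * _)%R; rewrite -PoszM; congr Posz.
by rewrite [2 ^ l * _]mulnC mulnACA -expnSr -expnD -mulnSr.
Qed.

(** The square multiplies the constant and the coefficient of the leading
    character by [q], and cancels the others. *)
Lemma pair_square_profile k f : e = f.+1 -> exists2 p,
  has_profile e (contract k.*2.+1 (rcons (pair_mons k) (pow_mon k.*2 2))) p &
  chi_profile e p (q ^ k.*2)%:Z (fun l => (l == f)%:R * (q ^ k * 2 ^ (l * k))%:Z)%R.
Proof.
move=> ef; have qf : q = 2 ^ f.+1 by rewrite qe ef.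
case: k => [|k].
  exists (fun b => \sum_x (nim e (ss_pos (pow_system q_gt0 (isT : 0 < 2)) x) b == 0)).
    apply: (@profile_contract_pow e 0 (fun b => b == 0)) => //.
    exact: profile_contract0.
  move: (q_gt0); rewrite ef qf => q0 b be.
  rewrite (chi_profile_square q0 be); congr (_ + _)%R.
  by apply: eq_bigr => l _; rewrite muln0 expn0 mulr1.
have [p pp cp] := pair_mons_profile k.
exists (fun b => \sum_x p (nim e (ss_pos (pow_system q_gt0 (isT : 0 < 2)) x) b)).
  by apply: profile_contract_pow => //; exact: in_pair_mons.
move: (q_gt0) cp; rewrite ef qf => q0 cp b be.
rewrite (chi_profile_square_mul q0 cp be); congr (_ + _)%R.
  by rewrite -PoszM -expnSr.
apply: eq_bigr => l _; congr (_ * _ * _)%R; rewrite -PoszM; congr Posz.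
by rewrite mulnAC -expnSr.
Qed.

Lemma card_kernel_cube n ms p alpha beta :
  (forall mu, List.In mu ms -> forall i, n <= i -> mu i = 0) ->
  has_profile e (contract n ms) p -> chi_profile e p alpha beta ->
  exists2 D, #|[set w | contract n.+1 (rcons ms (pow_mon n 3)) w == 0%R]| = 2 ^ D &
    D%:Z = (alpha * q%:Z + \sum_(l < e) beta l * (2 ^ l.+1)%:Z)%R.
Proof.
move=> ms0 pp cp; have [_ _ _] := profile_contract_pow (isT : 0 < 3) qe ms0 pp.
move=> /(_ 1); rewrite expn_gt0 => /(_ isT); rewrite big_nat1 => card.
exists (\sum_x p (nim e (ss_pos (pow_system q_gt0 (isT : 0 < 3)) x) 0)).
  by rewrite -card; apply: eq_card => w; rewrite !inE.
move: (q_gt0) cp; rewrite qe => q0 cp; rewrite -(sum_third cp).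
by congr Posz; apply: eq_bigr.
Qed.

End A2Contraction.

(** * Coefficients and weights of power series *)

Section SeriesCoefficients.
Variables (n : nat) (k : comNzRingType).
Local Notation series := (mpseries n k).
Local Notation index := {ffun 'I_n -> nat}.
Implicit Types (f g h : series) (a b u v : index).

Lemma series_eqP f g : mpcoef f =1 mpcoef g -> f = g.
Proof. by move=> fg; apply/mpseriesP. Qed.

Lemma mpcoef0 a : mpcoef (0 : series) a = 0.
Proof. by []. Qed.

Lemma mpcoef1 a : mpcoef (1 : series) a = (a == 0)%:R.
Proof. by []. Qed.

Lemma mpcoefN f a : mpcoef (- f) a = - mpcoef f a.
Proof. by []. Qed.

Lemma mpcoefB f g a : mpcoef (f - g) a = mpcoef f a - mpcoef g a.
Proof. by []. Qed.

Lemma mpcoef_sum (I : Type) (r : seq I) (P : pred I) (F : I -> series) a :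
  mpcoef (\sum_(i <- r | P i) F i) a = \sum_(i <- r | P i) mpcoef (F i) a.
Proof.
elim: r => [|i r IH]; first by rewrite !big_nil.
by rewrite !big_cons; case: ifP => _; rewrite ?mpcoefD IH.
Qed.

Lemma mpcoef_mul f g a : mpcoef (f * g) a =
  \sum_(u <- mps_box a) \sum_(v <- mps_box a)
    (u + v == a)%:R * (mpcoef f u * mpcoef g v).
Proof. exact: mpcoefM (mps_box_uniq a) (@mem_mps_box n a). Qed.

Lemma mpcoef_mul_eq f g f' g' a :
  (forall u v, u + v = a -> mpcoef f u * mpcoef g v = mpcoef f' u * mpcoef g' v) ->
  mpcoef (f * g) a = mpcoef (f' * g') a.
Proof.
move=> fg; rewrite !mpcoef_mul; apply: eq_bigr => u _; apply: eq_bigr => v _.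
by have [uv|_] := eqVneq (u + v) a; rewrite ?mul0r// fg.
Qed.

Lemma mpcoef_mul_single f g u v :
  (forall u' v', u' + v' = u + v -> mpcoef f u' * mpcoef g v' != 0 ->
     u' = u /\ v' = v) ->
  mpcoef (f * g) (u + v) = mpcoef f u * mpcoef g v.
Proof.
move=> uniq_uv; rewrite mpcoef_mul.
have ub : u \in mps_box (u + v) by exact: (@mem_mps_box n _ u v).
have vb : v \in mps_box (u + v) by apply: (@mem_mps_box n _ v u); rewrite addrC.
rewrite (bigD1_seq u) ?mps_box_uniq//= (bigD1_seq v) ?mps_box_uniq//=.
have out u' v' : (u' != u) || (v' != v) ->
    (u' + v' == u + v)%:R * (mpcoef f u' * mpcoef g v') = 0.
  move=> ne; have [uv|] := eqVneq (u' + v') (u + v); last by rewrite mul0r.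
  have [->|nz] := eqVneq (mpcoef f u' * mpcoef g v') 0; first by rewrite mulr0.
  by have [eu ev] := uniq_uv u' v' uv nz; rewrite eu ev !eqxx in ne.
rewrite eqxx mul1r [X in _ + X + _]big1 => [|v' vv]; last by rewrite out ?vv ?orbT.
by rewrite big1 ?addr0// => u' uu; rewrite big1// => v' _; rewrite out// uu.
Qed.

Lemma mpcoef_mul_eq0 f g a :
  (forall u v, u + v = a -> mpcoef f u * mpcoef g v = 0) -> mpcoef (f * g) a = 0.
Proof.
move=> fg0; rewrite (mpcoef_mul_eq (f' := 0) (g' := 0)) ?mulr0// => u v uv.
by rewrite fg0// mpcoef0 mul0r.
Qed.

Definition mono a : series := MPSeries (fun b => (b == a)%:R).

Lemma mpcoef_mono a b : mpcoef (mono a) b = (b == a)%:R.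
Proof. by []. Qed.

Lemma index_addK a : injective (+%R a).
Proof.
by move=> u v /ffunP uv; apply/ffunP => i; have := uv i; rewrite !ffunE => /addnI.
Qed.

Lemma index_subK a b : (forall i, (a i <= b i)%N) ->
  b = a + [ffun i => (b i - a i)%N].
Proof. by move=> ab; apply/ffunP => i; rewrite !ffunE; apply/esym/subnKC. Qed.

Lemma mpcoef_monoM a f b : mpcoef (mono a * f) (a + b) = mpcoef f b.
Proof.
rewrite mpcoef_mul_single ?mpcoef_mono ?eqxx ?mul1r// => u v uv.
rewrite mpcoef_mono; case: (u =P a) => [ua _|_]; last by rewrite mul0r eqxx.
by split=> //; apply: (@index_addK a); rewrite -uv ua.
Qed.

Lemma mpcoef_monoM0 a f b : (exists i, (b i < a i)%N) -> mpcoef (mono a * f) b = 0.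
Proof.
move=> [i bi]; apply: mpcoef_mul_eq0 => u v uv; rewrite mpcoef_mono.
case: eqP => [ua|_]; last by rewrite mul0r.
by move: bi; rewrite -uv ua !ffunE ltnNge leq_addr.
Qed.

Lemma monoD a b : mono (a + b) = mono a * mono b.
Proof.
apply: series_eqP => c.
case: (pickP (fun i => (c i < a i)%N)) => [i ci|ac].
  rewrite mpcoef_monoM0 ?mpcoef_mono; last by exists i.
  by case: eqP ci => // ->; rewrite !ffunE ltnNge leq_addr.
rewrite (@index_subK a c) => [|i]; last by rewrite leqNgt ac.
by rewrite mpcoef_monoM !mpcoef_mono (inj_eq (@index_addK a)).
Qed.

Lemma mono0 : mono 0 = 1.
Proof. by []. Qed.

Lemma mpsX_exp i c : mpsX k i ^+ c = mono [ffun j => (c * (j == i))%N].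
Proof.
elim: c => [|c IH].
  by rewrite expr0 -mono0; congr mono; apply/ffunP => j; rewrite !ffunE.
rewrite exprS IH -[mpsX k i]/(mono _) -monoD; congr mono.
by apply/ffunP => j; rewrite !ffunE mulSn.
Qed.

Lemma mono_prod a : mono a = \prod_i mpsX k i ^+ a i.
Proof.
rewrite (eq_bigr _ (fun i _ => mpsX_exp i (a i))).
rewrite -(big_morph mono monoD mono0); congr mono; apply/ffunP => j.
rewrite sum_ffunE (bigD1 j)//= ffunE eqxx muln1 big1 ?addr0// => i ij.
by rewrite ffunE eq_sym (negPf ij) muln0.
Qed.

Lemma mpsX_mono i : mpsX k i = mono [ffun j => nat_of_bool (j == i)].
Proof. by []. Qed.

Definition wdeg (w : 'I_n -> nat) a : nat := (\sum_i w i * a i)%N.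

Lemma wdegD w a b : wdeg w (a + b) = (wdeg w a + wdeg w b)%N.
Proof.
by rewrite /wdeg -big_split; apply: eq_bigr => i _; rewrite !ffunE mulnDr.
Qed.

(** The weighted order of [f] is at least [s]. *)
Definition vanish w s f := forall a, (wdeg w a < s)%N -> mpcoef f a = 0.

Lemma vanish0 w s : vanish w s 0.
Proof. by []. Qed.

Lemma vanish_any w f : vanish w 0 f.
Proof. by []. Qed.

Lemma vanishD w s f g : vanish w s f -> vanish w s g -> vanish w s (f + g).
Proof. by move=> fs gs a aws; rewrite mpcoefD fs// gs// addr0. Qed.

Lemma vanishN w s f : vanish w s f -> vanish w s (- f).
Proof. by move=> fs a aws; rewrite mpcoefN fs// oppr0. Qed.

Lemma vanishB w s f g : vanish w s f -> vanish w s g -> vanish w s (f - g).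
Proof. by move=> fs gs; apply: vanishD => //; exact: vanishN. Qed.

Lemma vanishM w s t f g : vanish w s f -> vanish w t g -> vanish w (s + t) (f * g).
Proof.
move=> fs gt a aw; apply: mpcoef_mul_eq0 => u v uv.
have [us|su] := ltnP (wdeg w u) s; first by rewrite fs// mul0r.
rewrite gt ?mulr0//; move: aw; rewrite -uv wdegD; lia.
Qed.

Lemma vanish_le w s t f : (s <= t)%N -> vanish w t f -> vanish w s f.
Proof. by move=> st ft a aw; apply: ft; exact: leq_trans aw st. Qed.

Lemma vanish_sum w s (I : Type) (r : seq I) (P : pred I) (F : I -> series) :
  (forall i, P i -> vanish w s (F i)) -> vanish w s (\sum_(i <- r | P i) F i).
Proof. by move=> Fs; elim/big_ind: _ => //; exact: vanishD. Qed.

Lemma vanish_eq0 w f : (forall s, vanish w s f) -> f = 0.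
Proof. by move=> fs; apply: series_eqP => a; exact: (fs (wdeg w a).+1). Qed.

Lemma vanish_mono w a : vanish w (wdeg w a) (mono a).
Proof.
move=> b ba; rewrite mpcoef_mono; have [eq_ba|//] := eqVneq b a.
by rewrite eq_ba ltnn in ba.
Qed.

End SeriesCoefficients.

Section Completeness.

Definition complete_filtration (G : zmodType) (FG : nat -> G -> Prop) :=
  forall u : nat -> G, (forall s, FG s (u s)) ->
    exists U, forall s, FG s (U - \sum_(t < s) u t).

(** Successive approximation: the error of order [s] is removed by a correction
    of order [s], up to an error of order [s + 1], and completeness adds up the
    corrections. Both the inverses of series and the finiteness over fewer
    variables are obtained in this way. *)
Lemma complete_surjective (G H : zmodType) (FG : nat -> G -> Prop)
    (FH : nat -> H -> Prop) (L : G -> H) :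
  {morph L : x y / x - y} ->
  complete_filtration FG ->
  (forall s x y, FH s x -> FH s y -> FH s (x - y)) ->
  (forall h, (forall s, FH s h) -> h = 0) ->
  (forall s g, FG s g -> FH s (L g)) ->
  (forall s h, FH s h -> exists2 g, FG s g & FH s.+1 (h - L g)) ->
  forall h, FH 0%N h -> exists g, L g = h.
Proof.
move=> LB compl FHB FH0 FL step h h0.
have L0 : L 0 = 0 by rewrite -[0 in LHS](subrr 0) LB subrr.
have LN x : L (- x) = - L x by rewrite -sub0r LB L0 sub0r.
have LD : {morph L : x y / x + y} by move=> x y; rewrite -{1}[y]opprK LB LN opprK.
have step' s x : exists g, FH s x -> FG s g /\ FH s.+1 (x - L g).
  have [xs|nxs] := pselect (FH s x); last by exists 0.
  by have [g gs xg] := step s x xs; exists g.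
have [corr corrP] : exists corr : nat -> H -> G, forall s x,
    FH s x -> FG s (corr s x) /\ FH s.+1 (x - L (corr s x)).
  have /choice[c cP] : forall sx : nat * H, exists g,
      FH sx.1 sx.2 -> FG sx.1 g /\ FH sx.1.+1 (sx.2 - L g).
    by move=> [s x]; exact: step'.
  by exists (fun s x => c (s, x)) => s x; exact: (cP (s, x)).
pose fix rest s := if s is s'.+1 then rest s' - L (corr s' (rest s')) else h.
have restP s : FH s (rest s) by elim: s => //= s IH; have [] := corrP s _ IH.
pose u s := corr s (rest s).
have uP s : FG s (u s) by have [] := corrP s _ (restP s).
have [U UP] := compl u uP.
have restE s : rest s = h - L (\sum_(t < s) u t).
  elim: s => [|s IH] /=; first by rewrite big_ord0 L0 subr0.
  by rewrite {1}IH big_ord_recr /= LD opprD addrA.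
exists U; apply/esym/eqP; rewrite -subr_eq0; apply/eqP/FH0 => s.
have -> : h - L U = rest s - L (U - \sum_(t < s) u t).
  by rewrite restE LB opprB addrA subrK.
by apply: FHB => //; exact: FL.
Qed.

(** The coefficient at [a] of the sum only involves the terms up to
    [wdeg w a + c]. *)
Lemma complete_vanish n (k : comNzRingType) (w : 'I_n -> nat) c :
  complete_filtration (fun s (f : mpseries n k) => vanish w (s - c) f).
Proof.
move=> u uP.
exists (MPSeries (fun a => \sum_(t < (wdeg w a + c).+1) mpcoef (u t) a)) => s a aw.
rewrite mpcoefB mpcoef_sum /=; apply/eqP; rewrite subr_eq0; apply/eqP.
have sle : ((wdeg w a + c).+1 <= s)%N by lia.
rewrite [in RHS](big_ord_widen _ (fun t => mpcoef (u t) a) (leqnn s)).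
rewrite (big_ord_widen _ (fun t => mpcoef (u t) a) sle).
rewrite big_mkcond [RHS]big_mkcond; apply: eq_bigr => t _.
rewrite ltn_ord; case: ltnP => // tw; rewrite uP//; lia.
Qed.

Lemma series_unit n (k : comNzRingType) (f : mpseries n k) :
  mpcoef f 0 = 1 -> exists g, f * g = 1.
Proof.
move=> f1; pose w (i : 'I_n) := 1%N.
have wdeg0 a : wdeg w a = 0%N -> a = 0.
  move=> /eqP; rewrite sum_nat_eq0 => /forallP a0; apply/ffunP => i.
  by have := a0 i; rewrite mul1n !ffunE => /eqP.
apply: (@complete_surjective _ _ _ (vanish w) ( *%R f)
  _ (@complete_vanish n k w 0)) => //.
- by move=> x y; rewrite mulrBr.
- by move=> s x y; exact: vanishB.
- exact: vanish_eq0.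
- by move=> s g; rewrite subn0 -{2}[s]add0n; apply: vanishM; exact: vanish_any.
move=> s h hs; exists h; first by rewrite subn0.
rewrite -{1}[h]mul1r -mulrBl -add1n; apply: vanishM hs => a.
rewrite ltnS leqn0 => /eqP/wdeg0 ->.
by rewrite mpcoefB mpcoef1 eqxx f1 subrr.
Qed.

End Completeness.

(** * Chains and length *)

Section ChainLength.
Local Open Scope classical_set_scope.

Lemma chain_length_eq (T : Type) (C : set T -> Prop) l :
  has_chain C l -> (forall m, has_chain C m -> (m <= l)%N) -> chain_length C = l.
Proof.
move=> Cl Cmax; rewrite /chain_length; set A := [set _ | _].
have Al : A l by [].
have [Cx xmax] : A (xget 0%N A) by exact: xgetPex (ex_intro _ l Al).
by apply/eqP; rewrite eqn_leq Cmax// xmax.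
Qed.

Lemma has_chain_rcons (T : Type) (C : set T -> Prop) l (N : nat -> set T) N' :
  (forall i, (i <= l)%N -> C (N i)) ->
  (forall i, (i < l)%N -> N i `<` N i.+1) -> C N' -> N l `<` N' ->
  exists N2 : nat -> set T, [/\ forall i, (i <= l.+1)%N -> C (N2 i),
    forall i, (i < l.+1)%N -> N2 i `<` N2 i.+1 & N2 l.+1 = N'].
Proof.
move=> CN ltN CN' ltN'; exists (fun i => if (i <= l)%N then N i else N').
split; last by rewrite ltnn.
  by move=> i _; case: ifP => // il; exact: CN.
move=> i; rewrite ltnS => il; rewrite il; case: ltnP => [/ltN//|li].
by have -> : i = l by apply/eqP; rewrite eqn_leq il.
Qed.

End ChainLength.

Section LengthOfFiniteModule.
Variables (R : comNzRingType) (M : lmodType R) (T : finZmodType) (rho : T -> M).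
Variables (F : nat -> T -> Prop) (B : nat).
Hypotheses (T2 : char2 T) (rhoD : {morph rho : x y / x + y}).
Hypothesis rho_surj : forall m, exists t, rho t = m.
Hypotheses (F0 : forall t, F 0%N t) (FB : forall t, F B t -> t = 0).
(* [R] is local with residue field of two elements, [eps] being the residue of
   [r], and its maximal ideal moves the filtration [F] one step deeper *)
Hypothesis F_step : forall r : R, exists eps : bool, forall s t, F s t ->
  exists2 t', F s.+1 t' & rho t' = r *: rho t - (if eps then rho t else 0).

Let rho0 : rho 0 = 0.
Proof. by apply: (addIr (rho 0)); rewrite -rhoD !add0r. Qed.

Let M2 (m : M) : m + m = 0.
Proof. by have [t <-] := rho_surj m; rewrite -rhoD T2 rho0. Qed.

Let pre (N : set M) : {set T} := [set t | `[< N (rho t) >]].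

Let preP N t : reflect (N (rho t)) (t \in pre N).
Proof. by rewrite inE; exact: asboolP. Qed.

Let submodD (N : set M) x y : is_submod N -> N x -> N y -> N (x + y).
Proof. by move=> [_ ND] Nx Ny; rewrite -[x]scale1r; exact: ND. Qed.

Let card_pre_proper (N N' : set M) : is_submod N -> is_submod N' ->
  (N `<` N')%classic -> (2 * #|pre N| <= #|pre N'|)%N.
Proof.
move=> subN subN' [NN' nN'N].
have [x N'x nNx] : exists2 x, N' x & ~ N x.
  by apply: contrapT => no; apply: nN'N => x N'x; apply: contrapT => nx; apply: no; exists x.
have [t tx] := rho_surj x; pose shifted := [set s + t | s in pre N]%SET.
have disj : [disjoint pre N & shifted].
  rewrite finset.disjoints_subset; apply/fintype.subsetP => s /preP Ns; rewrite inE.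
  apply/imsetP => -[s' /preP Ns' e]; apply: nNx.
  have -> : x = rho s + rho s' by rewrite e rhoD tx addrAC M2 add0r.
  exact: submodD.
rewrite mul2n -addnn -{2}(card_imset (pre N) (addIr t)) -/shifted.
have := (leq_card_setU (pre N) shifted).2; rewrite disj => /eqP <-.
apply: subset_leq_card; apply/fintype.subsetP => s; rewrite finset.in_setU => /orP[/preP Ns|].
  by apply/preP; exact: NN'.
move=> /imsetP[s' /preP Ns' ->]; apply/preP; rewrite rhoD tx.
by apply: submodD => //; exact: NN'.
Qed.

Let card_pre0 (N : set M) : is_submod N ->
  (#|[set t | rho t == 0%R]| <= #|pre N|)%N.
Proof.
move=> [N0 _]; apply: subset_leq_card; apply/fintype.subsetP => t.
by rewrite finset.in_set => /eqP t0; apply/preP; rewrite t0.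
Qed.

(* The last layer of the filtration not contained in [N] supplies an element
   outside [N] that the maximal ideal moves into [N]. *)
Let socle_mod (N : set M) t0 : ~ N (rho t0) -> N 0 ->
  exists t s, [/\ ~ N (rho t), F s t & forall t', F s.+1 t' -> N (rho t')].
Proof.
move=> Nt0 N0.
have exs : exists s, `[< forall t, F s t -> N (rho t) >].
  by exists B; apply/asboolP => t /FB ->; rewrite rho0.
case: (ex_minnP exs) => -[|s] /asboolP Fs smin; first by case: Nt0; exact/Fs/F0.
have [t Ft Nt] : exists2 t, F s t & ~ N (rho t).
  apply: contrapT => no; have : (s.+1 <= s)%N; last by rewrite ltnn.
  apply: smin; apply/asboolP => t Ft; apply: contrapT => nt; apply: no.
  by exists t.
by exists t, s.
Qed.

Let submod_extend (N : set M) : is_submod N -> (#|pre N| < #|T|)%N ->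
  exists N' : set M, [/\ is_submod N', (N `<` N')%classic &
    #|pre N'| = (2 * #|pre N|)%N].
Proof.
move=> subN ltN; have [N0 NZD] := subN.
have [t0 Nt0] : exists t0, ~ N (rho t0).
  apply: contrapT => no; move: ltN; rewrite ltnNge => /negP; apply.
  rewrite -cardsT; apply: subset_leq_card; apply/fintype.subsetP => t _.
  by apply/preP; apply: contrapT => Nt; apply: no; exists t.
have [t [s [Nt Ft deep]]] := socle_mod Nt0 N0.
pose N' : set M := fun m => N m \/ N (m + rho t).
have N'D x y : N' x -> N' y -> N' (x + y).
  move=> [Nx|Nx] [Ny|Ny]; [left|right|right|left]; first exact: submodD.
  - by rewrite -addrA; exact: submodD.
  - by rewrite addrAC; exact: submodD.
  - have -> : x + y = (x + rho t) + (y + rho t).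
      by rewrite addrACA M2 addr0.
    exact: submodD.
have NZ r x : N x -> N (r *: x) by move=> Nx; rewrite -[_ *: _]addr0; exact: NZD.
have subN' : is_submod N'.
  split=> [|r x y N'x N'y]; first by left.
  apply: N'D => //; case: N'x => [Nx|Nxt]; first by left; exact: NZ.
  have [eps epsP] := F_step r; have [t' Ft' t'E] := epsP s t Ft.
  have Nt' := deep _ Ft'.
  have rxt : N (r *: x + rho t' + if eps then rho t else 0).
    have -> : r *: x + rho t' + (if eps then rho t else 0) = r *: (x + rho t).
      by rewrite t'E scalerDr -addrA subrK.
    exact: NZ.
  have {}rxt : N (r *: x + if eps then rho t else 0).
    have -> : r *: x + (if eps then rho t else 0) =
        (r *: x + rho t' + if eps then rho t else 0) + rho t'.
      by rewrite addrAC -[r *: x + _ + rho t']addrA M2 addr0.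
    exact: submodD.
  by move: rxt; case: eps {epsP t'E} => H; [right|left; rewrite -[_ *: _]addr0].
have NN' : (N `<` N')%classic.
  split=> [x Nx|N'N]; first by left.
  by apply: Nt; apply: N'N; right; rewrite M2.
exists N'; split=> //; apply/eqP; rewrite eqn_leq card_pre_proper// andbT.
rewrite mul2n -addnn -{2}(card_imset (pre N) (addIr t)).
apply: leq_trans (leq_card_setU _ _); apply: subset_leq_card.
apply/fintype.subsetP => x /preP[Nx|Nx]; rewrite finset.in_setU; apply/orP; [left|right].
  exact/preP.
apply/imsetP; exists (x + t); last by rewrite -addrA T2 addr0.
by apply/preP; rewrite rhoD.
Qed.

(** When the residue field has two elements, the length is the binary logarithm
    of the cardinal. A proper inclusion of submodules at least doubles the
    cardinal; and a proper submodule can be enlarged by adding one element that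
    the maximal ideal moves into it, which exactly doubles its cardinal.
    Cardinals are taken in a finite group [T] mapped onto [M], and include
    those of the kernel. *)
Theorem module_length_log l :
  #|T| = (2 ^ l * #|[set t | rho t == 0%R]|)%N -> module_length M = l.
Proof.
move=> cardT; set K := #|_| in cardT.
have K_gt0 : (0 < K)%N.
  by apply/card_gt0P; exists 0; rewrite finset.in_set rho0.
apply: chain_length_eq; last first.
  move=> m [N [subN ltN]].
  have grow i : (i <= m)%N -> (2 ^ i * K <= #|pre (N i)|)%N.
    elim: i => [_|i IH im]; first by rewrite mul1n; exact/card_pre0/subN.
    apply: leq_trans (card_pre_proper (subN _ (ltnW im)) (subN _ im) (ltN _ im)).
    by rewrite expnS -mulnA leq_mul2l IH// ltnW.
  have := leq_trans (grow m (leqnn m)) (max_card _).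
  by rewrite cardT leq_pmul2r// leq_exp2l.
have [j [-> [N [subN ltN _]]]] : exists j, j = l /\ exists N : nat -> set M,
    [/\ forall i, (i <= j)%N -> is_submod (N i),
        forall i, (i < j)%N -> (N i `<` N i.+1)%classic &
        #|pre (N j)| = (2 ^ j * K)%N]; last by exists N.
exists l; split=> //; elim: {-2}l (leqnn l) => [_|j IH jl].
  exists (fun=> [set 0]%classic); split=> // [_ _|].
    by split=> [//|r x y /= -> ->]; rewrite scaler0 addr0.
  rewrite mul1n; apply: eq_card => t; rewrite [RHS]finset.in_set.
  by apply/preP/eqP.
have [N [subN ltN cardN]] := IH (ltnW jl).
have [|N' [subN' NN' cardN']] := submod_extend (subN j (leqnn j)).
  by rewrite cardN cardT ltn_pmul2r// ltn_exp2l.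
have [N2 [subN2 ltN2 N2E]] := has_chain_rcons subN ltN subN' NN'.
by exists N2; split=> //; rewrite N2E cardN' cardN mulnA expnS.
Qed.

End LengthOfFiniteModule.

(** * Truncation to a box of exponents *)

Section BoxTruncation.
Variables (n : nat) (k : comNzRingType) (q : nat).
Local Notation series := (mpseries n k).
Local Notation index := {ffun 'I_n -> nat}.
Implicit Types (f g h : series) (a b : index).

(** Each monomial outside the box is assigned to the first variable whose
    exponent is at least [q]. *)
Lemma box_ideal f : (forall a, (forall i, a i < q)%N -> mpcoef f a = 0) ->
  exists h : 'I_n -> series, f = \sum_i mpsX k i ^+ q * h i.
Proof.
move=> f0; pose e i : index := [ffun j => (q * (j == i))%N].
pose first a := [pick j | (q <= a j)%N].
exists (fun i => MPSeries (fun b => if first (e i + b) == Some i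
                                    then mpcoef f (e i + b) else 0)).
apply: series_eqP => a; rewrite mpcoef_sum.
have term i (g : series) : mpcoef (mpsX k i ^+ q * g) a =
    if (q <= a i)%N then mpcoef g [ffun j => (a j - e i j)%N] else 0.
  rewrite mpsX_exp; case: ltnP => [ai|qa].
    by rewrite mpcoef_monoM0//; exists i; rewrite ffunE eqxx muln1.
  rewrite {1}(@index_subK _ (e i) a) ?mpcoef_monoM// => j.
  by rewrite ffunE; case: eqP => [->|_]; rewrite ?muln1 ?muln0.
under eq_bigr => i _ do rewrite term /=.
have back i : (q <= a i)%N -> e i + [ffun j => (a j - e i j)%N] = a.
  move=> qa; rewrite -index_subK// => j.
  by rewrite ffunE; case: eqP => [->|_]; rewrite ?muln1 ?muln0.
case E: (first a) => [j|].
  have qj : (q <= a j)%N by move: E; rewrite /first; case: pickP => // j' qj' [<-].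
  rewrite (bigD1 j)//= qj back// E eqxx big1 ?addr0// => i ij.
  case: ifP => // qi; rewrite back// E; case: eqP => // -[ji].
  by rewrite ji eqxx in ij.
have no i : (a i < q)%N.
  by move: E; rewrite /first; case: pickP => // no _; rewrite ltnNge no.
by rewrite f0// big1// => i _; rewrite leqNgt no.
Qed.

Definition box_index (a : box q n) : index := [ffun i => nat_of_ord (a i)].

Definition trunc f : {ffun box q n -> k} := [ffun a => mpcoef f (box_index a)].

Lemma truncD : {morph trunc : f g / f + g}.
Proof. by move=> f g; apply/ffunP => a; rewrite !ffunE. Qed.

Lemma truncB : {morph trunc : f g / f - g}.
Proof. by move=> f g; apply/ffunP => a; rewrite !ffunE. Qed.

Lemma trunc0 : trunc 0 = 0.
Proof. by apply/ffunP => a; rewrite !ffunE. Qed.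

Lemma truncP f g : trunc f = trunc g <->
  (forall a, (forall i, a i < q)%N -> mpcoef f a = mpcoef g a).
Proof.
split=> [fg a aq|fg]; last first.
  by apply/ffunP => a; rewrite !ffunE; apply: fg => i; rewrite ffunE.
have -> : a = box_index [ffun i => Ordinal (aq i)].
  by apply/ffunP => i; rewrite !ffunE.
by move/ffunP: fg => /(_ [ffun i => Ordinal (aq i)]); rewrite !ffunE.
Qed.

Lemma trunc_mul f g h : trunc f = trunc g -> trunc (h * f) = trunc (h * g).
Proof.
move=> /truncP fg; apply/truncP => a aq; apply: mpcoef_mul_eq => u v uv.
congr (_ * _); apply: fg => i; apply: leq_ltn_trans (aq i).
by rewrite -uv ffunE leq_addl.
Qed.

Lemma trunc_Xq i h : trunc (mpsX k i ^+ q * h) = 0.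
Proof.
rewrite -trunc0; apply/truncP => a aq; rewrite mpsX_exp mpcoef_monoM0//.
by exists i; rewrite ffunE eqxx muln1.
Qed.

Lemma trunc_eq0 f : trunc f = 0 ->
  exists h : 'I_n -> series, f = \sum_i mpsX k i ^+ q * h i.
Proof. by rewrite -trunc0 => /truncP f0; apply: box_ideal => a /f0. Qed.

Hypothesis q_gt0 : (0 < q)%N.

Definition box_lift (t : {ffun box q n -> k}) : series := MPSeries (fun a =>
  if [forall i, (a i < q)%N] then t [ffun i => cut q_gt0 (a i)] else 0).

Lemma box_liftK t : trunc (box_lift t) = t.
Proof.
apply/ffunP => a; rewrite ffunE /= ifT; last first.
  by apply/forallP => i; rewrite ffunE.
by congr (t _); apply/ffunP => i; rewrite !ffunE cut_ord.
Qed.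

Lemma box_liftD : {morph box_lift : t u / t + u}.
Proof.
move=> t u; apply: series_eqP => a; rewrite mpcoefD /=.
by case: ifP => _; rewrite ?addr0 ?ffunE.
Qed.

End BoxTruncation.

Section MultiplicationOnBox.
Variables (n q : nat) (q_gt0 : (0 < q)%N) (ms : seq (nat -> nat)).
Local Notation series := (mpseries n 'F_2).

Definition mono_seq : series :=
  \sum_(mu <- ms) mono 'F_2 [ffun i : 'I_n => mu i].

Definition rev_box (a : box q n) : box q n := [ffun i => rev_ord (a i)].

Lemma rev_boxK : involutive rev_box.
Proof. by move=> a; apply/ffunP => i; rewrite !ffunE rev_ordK. Qed.

Definition rev_fun (t : {ffun box q n -> 'F_2}) : {ffun box q n -> 'F_2} :=
  [ffun a => t (rev_box a)].

Lemma rev_funK : involutive rev_fun.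
Proof. by move=> t; apply/ffunP => a; rewrite !ffunE rev_boxK. Qed.

(** Reversing the exponents in the box exchanges multiplication and
    contraction. *)
Lemma trunc_mono_seq t :
  trunc q (mono_seq * box_lift q_gt0 t) = rev_fun (contract q_gt0 ms (rev_fun t)).
Proof.
apply/ffunP => a; rewrite !ffunE /mono_seq mulr_suml mpcoef_sum.
apply: eq_bigr => mu _; rewrite /box_shift; case: ifP => [/forallP inb|/negbT].
  rewrite (@index_subK _ [ffun i : 'I_n => mu i] (box_index a)) => [|i]; last first.
    have := inb i; rewrite !ffunE /=; move: (ltn_ord (a i)).
    by move: (nat_of_ord (a i)) (mu i) => x y; lia.
  rewrite mpcoef_monoM /= ifT; last first.
    by apply/forallP => i; rewrite !ffunE; exact: leq_ltn_trans (leq_subr _ _) (ltn_ord _).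
  rewrite ffunE; congr (t _); apply/ffunP => i; rewrite !ffunE.
  apply/val_inj; have := inb i; rewrite !ffunE /= => lt.
  rewrite !cutE//; last by exact: leq_ltn_trans (leq_subr _ _) (ltn_ord _).
  by move: (ltn_ord (a i)) lt; move: (nat_of_ord (a i)) (mu i) => x y; lia.
rewrite negb_forall => /existsP[i ge].
rewrite mpcoef_monoM0//; exists i; move: ge; rewrite !ffunE /= => ge.
by move: (ltn_ord (a i)) ge; move: (nat_of_ord (a i)) (mu i) => x y; lia.
Qed.

Lemma card_ker_mono_seq :
  #|[set t | trunc q (mono_seq * box_lift q_gt0 t) == 0]| =
  #|[set w | contract q_gt0 (n := n) ms w == 0]|.
Proof.
rewrite -[LHS](card_imset _ (inv_inj rev_funK)); apply: eq_card => w.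
have rev0 : rev_fun 0 = 0 by apply/ffunP => a; rewrite !ffunE.
rewrite [RHS]finset.in_set; apply/imsetP/eqP => [[t + ->]|w0].
  rewrite finset.in_set trunc_mono_seq => /eqP t0.
  by rewrite -[LHS]rev_funK t0.
exists (rev_fun w); rewrite ?rev_funK// finset.in_set trunc_mono_seq rev_funK.
by rewrite w0 rev0.
Qed.

End MultiplicationOnBox.

Definition A2_mons d := rcons
  (if odd d then rcons (pair_mons d./2) (pow_mon d.-1 2) else pair_mons d./2)
  (pow_mon d 3).

Lemma A2_polyE d : A2_poly d = mono_seq d.+1 (A2_mons d).
Proof.
have X i c : (i <= d)%N ->
    mpsX 'F_2 (inord i : 'I_d.+1) ^+ c = mono 'F_2 [ffun j : 'I_d.+1 => pow_mon i c j].
  move=> id; rewrite mpsX_exp; congr mono; apply/ffunP => j; rewrite !ffunE.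
  by rewrite -val_eqE /= inordK// /pow_mon; case: eqP; rewrite ?muln1 ?muln0.
have pairs : \sum_(i < d./2) mpsX 'F_2 (inord i.*2 : 'I_d.+1) *
      mpsX 'F_2 (inord i.*2.+1 : 'I_d.+1) = mono_seq d.+1 (pair_mons d./2).
  rewrite /mono_seq big_map -[in RHS](subn0 d./2) -/(index_iota 0 d./2) big_mkord.
  apply: eq_bigr => i _; have := ltn_ord i => id.
  rewrite -[mpsX _ (inord i.*2)]expr1 -[mpsX _ (inord i.*2.+1)]expr1 !X; try lia.
  rewrite -monoD; congr mono; apply/ffunP => j; rewrite !ffunE /pow_mon /pair_mon.
  by case: eqP => [->|_]; case: eqP => //; lia.
have rc s mu : mono_seq d.+1 (rcons s mu) =
    mono_seq d.+1 s + mono 'F_2 [ffun i : 'I_d.+1 => mu i].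
  by rewrite /mono_seq -cats1 big_cat big_seq1.
rewrite /A2_poly /A2_mons rc; case: (boolP (odd d)) => dodd.
  by rewrite rc pairs !X// leq_pred.
by rewrite pairs X.
Qed.

(** * The Hilbert-Kunz function as a kernel *)

Section A2Ring.
Local Open Scope quotient_scope.
Variable d : nat.
Local Notation series := (mpseries d.+1 'F_2).
Local Notation S := (A2_ring d).

Definition A2_pi (f : series) : S := \pi_{ideal_quot A2_ideal d} f.

Lemma A2_piD f g : A2_pi (f + g) = A2_pi f + A2_pi g.
Proof. exact: rmorphD. Qed.

Lemma A2_piB f g : A2_pi (f - g) = A2_pi f - A2_pi g.
Proof. exact: rmorphB. Qed.

Lemma A2_piM f g : A2_pi (f * g) = A2_pi f * A2_pi g.
Proof. exact: rmorphM. Qed.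

Lemma A2_pi1 : A2_pi 1 = 1.
Proof. exact: rmorph1. Qed.

Lemma A2_pi0 : A2_pi 0 = 0.
Proof. exact: rmorph0. Qed.

Lemma A2_piX f m : A2_pi (f ^+ m) = A2_pi f ^+ m.
Proof. exact: rmorphXn. Qed.

Lemma A2_pi_surj (s : S) : exists f, A2_pi f = s.
Proof. by exists (repr s); exact: reprK. Qed.

Lemma gen_ideal1P (R : comNzRingType) (p x : R) :
  gen_ideal [set p]%classic x <-> exists y, x = p * y.
Proof.
split=> [px|[y ->] I [[I0 IM] pI]]; last first.
  by rewrite mulrC -[_ * _]addr0; apply: IM => //; exact: pI.
apply: (px [set x | exists y, x = p * y]%classic); split.
  split=> [|a _ _ [y ->] [z ->]]; first by exists 0; rewrite mulr0.
  by exists (a * y + z); rewrite mulrDr mulrCA.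
by move=> _ ->; exists 1; rewrite mulr1.
Qed.

Lemma A2_pi_eq0 f : A2_pi f = 0 <-> exists g, f = A2_poly d * g.
Proof.
rewrite -gen_ideal1P -A2_pi0; split=> [/eqP|H].
  by rewrite -[_ == _]Quotient.idealrBE subr0 => /asboolP.
by apply/eqP; rewrite -[_ == _]Quotient.idealrBE subr0; apply/asboolP.
Qed.

Lemma F2P (x : 'F_2) : x = 0 \/ x = 1.
Proof. by case: x => -[|[|]]// ?; [left|right]; apply/val_inj. Qed.

Lemma series2 (f : series) : f + f = 0.
Proof.
apply: series_eqP => a; rewrite mpcoefD mpcoef0.
by case: (F2P (mpcoef f a)) => ->; apply/val_inj.
Qed.

Lemma exprD_2exp (R : comNzRingType) (x y : R) e :
  (forall z : R, z + z = 0) -> (x + y) ^+ (2 ^ e) = x ^+ (2 ^ e) + y ^+ (2 ^ e).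
Proof.
move=> R2; elim: e => [//|e IH]; rewrite expnSr !exprM IH sqrrD.
by rewrite mulr2n R2 addr0.
Qed.

Lemma sum_2exp (R : comNzRingType) (I : finType) (F : I -> R) e :
  (forall z : R, z + z = 0) ->
  (\sum_i F i) ^+ (2 ^ e) = \sum_i F i ^+ (2 ^ e).
Proof.
move=> R2; elim/big_rec2: _ => [|i x y _ <-]; last exact: exprD_2exp.
by rewrite expr0n; have := expn_gt0 2 e; case: (2 ^ e)%N.
Qed.

(** A series with constant term 1 is invertible. *)
Lemma max_idealP f : max_ideal S (A2_pi f) <-> mpcoef f 0 = 0.
Proof.
split=> [nu|f0 [s]].
  have [//|f1] := F2P (mpcoef f 0); case: nu.
  have [g fg] := series_unit f1; exists (A2_pi g).
  by rewrite -A2_piM fg A2_pi1.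
have [g <-] := A2_pi_surj s; rewrite -A2_piM -A2_pi1 => /eqP.
rewrite -subr_eq0 -A2_piB => /eqP/A2_pi_eq0[h].
move=> /(congr1 (fun z : series => mpcoef z 0)); rewrite mpcoefB !mpcoef0M f0 A2_poly_coef0 !mul0r.
by rewrite mpcoef1 eqxx.
Qed.

Variable e : nat.
Let q := (2 ^ e)%N.
Hypothesis q_gt0 : (0 < 2 ^ e)%N.

Let X : set S := [set a ^+ q | a in max_ideal S]%classic.

(** Since taking [q]-th powers is additive, the [q]-th powers of the elements
    of the maximal ideal generate the same ideal as the [x_i ^ q]. *)
Lemma frobenius_idealP f : gen_ideal X (A2_pi f) <->
  exists g, trunc q f = trunc q (A2_poly d * g).
Proof.
split=> [Xf|[g fg] I [[I0 IM] XI]]; last first.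
  have [|h fh] := @trunc_eq0 _ _ q (f - A2_poly d * g).
    by rewrite truncB fg subrr.
  have -> : A2_pi f = A2_pi (\sum_i mpsX 'F_2 i ^+ q * h i).
    rewrite -fh A2_piB [X in _ - X](_ : _ = 0) ?subr0//.
    by apply/A2_pi_eq0; exists g.
  elim/big_rec: _ => [|i x _ Ix]; first by rewrite A2_pi0.
  rewrite A2_piD A2_piM mulrC; apply: IM => //; apply: XI.
  exists (A2_pi (mpsX _ i)); last by rewrite A2_piX.
  by apply/max_idealP; exact: mpcoef0X.
pose I := [set s | exists f g, A2_pi f = s /\ trunc q f = trunc q (A2_poly d * g)]%classic.
have [|f' [g [ff' f'g]]] := Xf I.
- split.
    split; first by exists 0, 0; rewrite A2_pi0 mulr0.
    move=> a _ _ [f1 [g1 [<- t1]]] [f2 [g2 [<- t2]]].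
    have [b <-] := A2_pi_surj a; exists (b * f1 + f2), (b * g1 + g2).
    rewrite A2_piD A2_piM; split=> //.
    by rewrite truncD (trunc_mul _ t1) t2 -truncD mulrDr mulrCA.
  move=> _ [a ma <-]; have [b ba] := A2_pi_surj a.
  move: ma; rewrite -ba => /max_idealP b0.
  have [|h bh] := @box_ideal _ _ 1 b.
    move=> a' a'0; rewrite (_ : a' = 0) ?b0//; apply/ffunP => i.
    by rewrite ffunE; have := a'0 i; case: (a' i).
  exists (b ^+ q), 0; rewrite A2_piX mulr0 trunc0; split=> //.
  rewrite bh sum_2exp; last exact: series2.
  elim/big_rec: _ => [|i x _ x0]; first exact: trunc0.
  by rewrite truncD x0 addr0 expr1 exprMn trunc_Xq.
have [h f'fh] : exists h, f' - f = A2_poly d * h.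
  by apply/A2_pi_eq0; rewrite A2_piB ff' subrr.
exists (g - h); rewrite mulrBr -f'fh truncB -f'g truncB opprB addrC subrK.
by [].
Qed.

Let T : finZmodType := {ffun box q d.+1 -> 'F_2}.
Let M := quot_module X.
Let rho (t : T) : M := qm_pi X (A2_pi (box_lift q_gt0 t)).
Let w1 (i : 'I_d.+1) := 1%N.

Lemma qm_piB (x y : S) : qm_pi X (x - y) = qm_pi X x - qm_pi X y.
Proof. exact: (raddfB \pi_{ideal_quot gen_idealb X}). Qed.

Lemma qm_pi_truncE f : qm_pi X (A2_pi f) = rho (trunc q f).
Proof.
apply/qm_piP; rewrite -A2_piB; apply/frobenius_idealP; exists 0.
by rewrite truncB box_liftK subrr mulr0 trunc0.
Qed.

(** With [T] the space of truncated polynomials, the quotient of the ring by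
    the [q]-th powers of its maximal ideal is [T / P T], which has as many
    elements as the kernel of [P] on [T]. *)
Theorem HK_contract D :
  #|[set w | contract q_gt0 (n := d.+1) (A2_mons d) w == 0]| = (2 ^ D)%N ->
  HK 2 S e = D.
Proof.
move=> cardD.
have T2 : char2 T.
  move=> t; apply/ffunP => a; rewrite !ffunE.
  by case: (F2P (t a)) => ->; apply/val_inj.
have rhoD : {morph rho : x y / x + y}.
  by move=> x y; rewrite /rho box_liftD A2_piD qm_piD.
apply: (@module_length_log _ _ _ rho
  (fun s t => vanish w1 s (box_lift q_gt0 t)) (d.+1 * q)%N T2 rhoD).
- move=> m; have [f fm] := A2_pi_surj (repr m).
  by exists (trunc q f); rewrite -qm_pi_truncE fm qm_piK.
- by move=> t; exact: vanish_any.
- move=> t t0; rewrite -(box_liftK q_gt0 t) -(trunc0 _ _ q); apply/truncP => a aq.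
  rewrite t0//; apply: (@leq_ltn_trans (\sum_(i < d.+1) q.-1)).
    by apply: leq_sum => i _; rewrite mul1n -ltnS prednK.
  by rewrite sum_nat_const card_ord ltn_pmul2l// prednK.
- move=> r; have [f fr] := A2_pi_surj r.
  pose eps := mpcoef f 0 == 1; pose f' := f - (nat_of_bool eps)%:R.
  have f'0 : mpcoef f' 0 = 0.
    rewrite /f' /eps; case: (F2P (mpcoef f 0)) => f0.
      by rewrite f0 /= subr0.
    by rewrite f0 eqxx mpcoefB mpcoef1 eqxx f0 subrr.
  exists eps => s t ts; exists (trunc q (f' * box_lift q_gt0 t)).
    have v : vanish w1 s.+1 (f' * box_lift q_gt0 t).
      change (vanish w1 (1 + s) (f' * box_lift q_gt0 t)).
      apply: vanishM ts => a; rewrite ltnS leqn0 => a0.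
      rewrite (_ : a = 0) ?f'0//; apply/ffunP => i; rewrite ffunE; apply/eqP.
      by move: a0; rewrite sum_nat_eq0 => /forallP/(_ i); rewrite mul1n.
    move=> a aw /=; case: ifP => // /forallP aq; rewrite ffunE.
    rewrite [box_index _](_ : _ = a) ?v//; apply/ffunP => i.
    by rewrite !ffunE cutE// aq.
  rewrite -qm_pi_truncE mulrBl A2_piB qm_piB; congr (_ - _).
    by rewrite A2_piM fr; apply/esym; exact: qm_scale_pi.
  rewrite /eps; case: eqP => _; first by rewrite mul1r.
  by rewrite mul0r A2_pi0; exact: (raddf0 \pi_{ideal_quot gen_idealb X}).
pose mulP (t : T) : T := trunc q (A2_poly d * box_lift q_gt0 t).
have mulPD : {morph mulP : x y / x + y}.
  by move=> x y; rewrite /mulP box_liftD mulrDr truncD.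
have := card_image_kernel T2 mulPD (is_subgroupT T).
rewrite cardsT => ->; rewrite mulnC; congr muln.
  rewrite -cardD -(@card_ker_mono_seq d.+1 q q_gt0) -A2_polyE.
  by apply: eq_card => t; rewrite !finset.in_set.
apply: eq_card => t; rewrite [RHS]finset.in_set; apply/imsetP/eqP => [[u _ ->]|rt].
  rewrite /rho /mulP -[RHS](raddf0 \pi_{ideal_quot gen_idealb X}).
  apply/qm_piP; rewrite subr0; apply/frobenius_idealP.
  by exists (box_lift q_gt0 u); rewrite box_liftK.
have /frobenius_idealP[g tg] : gen_ideal X (A2_pi (box_lift q_gt0 t)).
  rewrite -[A2_pi _]subr0; apply/qm_piP; rewrite -/(rho t) rt.
  exact/esym/(raddf0 \pi_{ideal_quot gen_idealb X}).
exists (trunc q g) => //; rewrite /mulP -[LHS](box_liftK q_gt0) tg.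
by apply: trunc_mul; rewrite box_liftK.
Qed.

End A2Ring.

(** * Leading monomials and coordinate primes *)

Section LeadingMonomial.
Variable n : nat.
Local Notation index := {ffun 'I_n -> nat}.
Implicit Types (a u : index).

Let ext a i : nat := if insub i is Some j then a j else 0%N.

Let ext_ord a (i : 'I_n) : ext a i = a i.
Proof. by rewrite /ext valK. Qed.

Let weight B a t : nat := (\sum_(0 <= i < t) B ^ i * ext a i)%N.

Let weight_lt B a t : (0 < B)%N -> (forall i, ext a i < B)%N -> (weight B a t < B ^ t)%N.
Proof.
move=> B_gt0 aB; elim: t => [|t IH]; first by rewrite /weight big_geq.
rewrite /weight big_nat_recr//= -/(weight B a t) expnSr -(prednK B_gt0) mulnS.
rewrite prednK// -addSn leq_add// leq_mul2l -ltnS prednK// aB.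
by rewrite orbT.
Qed.

Definition pow_weight B (i : 'I_n) : nat := (B ^ i)%N.

(** The exponent [a] is the least one for the lexicographic order that compares
    the last coordinates first. As soon as [B] exceeds the coordinates of [a],
    the weights [B ^ i] put [a] strictly below the other exponents in [E]: the
    coordinates of the latter, however large, only add to their weights. *)
Lemma leading_index (E : index -> Prop) : (exists a, E a) ->
  exists a B0, E a /\ forall B, (B0 <= B)%N -> forall u, E u -> u <> a ->
    (wdeg (pow_weight B) a < wdeg (pow_weight B) u)%N.
Proof.
suff H t : forall E : index -> Prop, (exists a, E a) ->
    exists a B0, E a /\ forall B, (B0 <= B)%N -> forall u, E u ->
      (forall i, (i < t)%N -> ext u i = ext a i) \/ (weight B a t < weight B u t)%N.
  move=> /(H n)[a [B0 [Ea min_a]]]; exists a, B0; split=> // B B0B u Eu ua.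
  have wE v : wdeg (pow_weight B) v = weight B v n.
    by rewrite /weight big_mkord; apply: eq_bigr => i _; rewrite ext_ord.
  rewrite !wE; have [agree|//] := min_a B B0B u Eu; case: ua.
  by apply/ffunP => i; rewrite -!ext_ord agree.
elim: t => [|t IH] {}E [a0 Ea0].
  by exists a0, 0%N; split=> // B _ u _; left.
have exm : exists m, `[< exists2 a, E a & ext a t = m >].
  by exists (ext a0 t); apply/asboolP; exists a0.
case: (ex_minnP exm) => m /asboolP[a1 Ea1 a1m] minm.
have [|a [B0 [[Ea am] min_a]]] := IH (fun a => E a /\ ext a t = m).
  by exists a1.
have [B1 aB1] : exists B1, forall i, (ext a i < B1)%N.
  exists (\sum_j a j).+1 => i; rewrite ltnS /ext; case: insubP => // j _ _.
  by rewrite (bigD1 j)//= leq_addr.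
exists a, (maxn B0 B1); split=> // B; rewrite geq_max => /andP[B0B B1B] u Eu.
have mu : (m <= ext u t)%N by apply: minm; apply/asboolP; exists u.
rewrite /weight !big_nat_recr//= -/(weight B a t) -/(weight B u t) am.
have [um|um] := eqVneq (ext u t) m.
  have [agree|lt] := min_a B B0B u (conj Eu um); [left|right].
    move=> i; rewrite ltnS leq_eqVlt => /predU1P[->|]; last exact: agree.
    by rewrite um am.
  by rewrite um ltn_add2r.
right; have lt_mu : (m < ext u t)%N by rewrite ltn_neqAle eq_sym um.
have B_gt0 : (0 < B)%N by apply: leq_trans B1B; exact: leq_ltn_trans (aB1 0%N).
have aB i : (ext a i < B)%N by exact: leq_trans (aB1 i) B1B.
apply: leq_trans (leq_addl _ _); apply: leq_trans (leq_mul (leqnn _) lt_mu).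
by rewrite mulnS ltn_add2r weight_lt.
Qed.

End LeadingMonomial.

Section CoordinatePrimes.
Variables (n : nat) (k : idomainType).
Local Notation series := (mpseries n k).
Local Notation index := {ffun 'I_n -> nat}.

Definition supported (V : pred 'I_n) (a : index) := forall i, ~~ V i -> a i = 0%N.

(** The ideal generated by the variables outside [V]. *)
Definition coord_ideal (V : pred 'I_n) : set series :=
  fun f => forall a, supported V a -> mpcoef f a = 0.

(** The product of the leading monomials of two series, for a common weight,
    occurs in the product of the series. *)
Lemma coord_ideal_prime V : is_prime_ideal (coord_ideal V).
Proof.
split.
- split=> [|a f g f0 g0 b Vb]; first by [].
  rewrite mpcoefD g0// addr0; apply: mpcoef_mul_eq0 => u v uv.
  rewrite f0 ?mulr0// => i Vi; apply/eqP.
  by have := Vb i Vi; rewrite -uv ffunE => /eqP; rewrite addn_eq0 => /andP[].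
- move=> one; have V0 : supported V 0 by move=> i _; rewrite ffunE.
  by have /eqP := one 0 V0; rewrite mpcoef1 eqxx oner_eq0.
move=> f g fg; apply: contrapT => /not_orP[nf ng].
have nz h : ~ coord_ideal V h -> exists a, supported V a /\ mpcoef h a <> 0.
  move=> nh; apply: contrapT => no; apply: nh => a Va; apply: contrapT => ha.
  by apply: no; exists a.
have [a [B1 [[Va fa] min_a]]] := leading_index (nz f nf).
have [b [B2 [[Vb gb] min_b]]] := leading_index (nz g ng).
have := fg (a + b); rewrite mpcoef_mul_single.
  move=> /(_ _)/eqP; rewrite mulf_eq0 => H.
  have /H /orP[/eqP|/eqP]// : supported V (a + b).
  by move=> i Vi; rewrite ffunE Va// Vb.
move=> u v uv uv0; pose w := pow_weight (maxn B1 B2) (n := n).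
have Vuv : supported V u /\ supported V v.
  split=> i Vi; apply/eqP; have /eqP := congr1 (fun c : index => c i) uv;
    by rewrite !ffunE Va// Vb// addn_eq0 => /andP[].
have [fu gv] : mpcoef f u <> 0 /\ mpcoef g v <> 0.
  by move: uv0; rewrite mulf_eq0 negb_or => /andP[/eqP ? /eqP].
have wuv : (wdeg w u + wdeg w v = wdeg w a + wdeg w b)%N by rewrite -!wdegD uv.
have min_a' := min_a _ (leq_maxl B1 B2) u (conj Vuv.1 fu).
have min_b' := min_b _ (leq_maxr B1 B2) v (conj Vuv.2 gv).
have ua : u = a.
  apply: contrapT => /min_a' lt_u.
  have [vb|/eqP/min_b' lt_v] := eqVneq v b; move: wuv lt_u; rewrite /w ?vb; lia.
by split=> //; apply: (@index_addK n a); rewrite -uv ua.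
Qed.

Lemma zero_ideal_prime : is_prime_ideal ([set 0]%classic : set series).
Proof.
have -> : [set 0]%classic = coord_ideal predT; last exact: coord_ideal_prime.
apply/seteqP; split=> [_ -> //|f f0]; apply: series_eqP => a.
by rewrite f0.
Qed.

End CoordinatePrimes.

(** * Substitution *)

Section Substitution.
Variables (m n : nat) (k : comNzRingType).
Variable y : 'I_m -> mpseries n k.
Hypothesis y0 : forall i, mpcoef (y i) 0 = 0.
Implicit Types (g h : mpseries m k) (a : {ffun 'I_m -> nat}) (b : {ffun 'I_n -> nat}).

Let deg1 l (i : 'I_l) := 1%N.

Definition cube N : seq {ffun 'I_m -> nat} :=
  [seq [ffun i => val (c i)] | c : {ffun 'I_m -> 'I_N.+1}].

Lemma cube_uniq N : uniq (cube N).
Proof.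
rewrite map_inj_uniq ?enum_uniq// => c c' /ffunP cc; apply/ffunP => i.
by apply: val_inj; have := cc i; rewrite !ffunE.
Qed.

Lemma mem_cube N a : (forall i, a i <= N)%N -> a \in cube N.
Proof.
move=> aN; have aN' i : (a i < N.+1)%N by rewrite ltnS.
apply/mapP; exists [ffun i => Ordinal (aN' i)]; first by rewrite mem_enum.
by apply/ffunP => i; rewrite !ffunE.
Qed.

Lemma cube_le N a i : a \in cube N -> (a i <= N)%N.
Proof. by move=> /mapP[c _ ->]; rewrite ffunE; exact: ltn_ord (c i). Qed.

Definition ymono a := \prod_i y i ^+ a i.

Lemma ymonoD a a' : ymono (a + a') = ymono a * ymono a'.
Proof.
rewrite /ymono -big_split; apply: eq_bigr => i _; rewrite ffunE.
exact: exprD.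
Qed.

Lemma vanish_exp l (w : 'I_l -> nat) s (f : mpseries l k) c :
  vanish w s f -> vanish w (s * c) (f ^+ c).
Proof.
move=> fs; elim: c => [|c IH]; first by rewrite muln0; exact: vanish_any.
by rewrite mulnS exprS; exact: vanishM.
Qed.

Lemma vanish_ymono (w : 'I_n -> nat) (v : 'I_m -> nat) a :
  (forall i, vanish w (v i) (y i)) -> vanish w (wdeg v a) (ymono a).
Proof.
move=> yv; rewrite /ymono /wdeg; elim/big_rec2: _ => [|i s f _ fs].
  exact: vanish_any.
by apply: vanishM => //; exact: vanish_exp.
Qed.

Lemma ymono_deg a b N : (wdeg (@deg1 n) b <= N)%N -> mpcoef (ymono a) b != 0 ->
  a \in cube N.
Proof.
move=> bN ab; apply: mem_cube => i; apply: leq_trans bN.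
rewrite leqNgt; apply: contra ab => ba; apply/eqP.
apply: (vanish_ymono (w := @deg1 n) (v := @deg1 m)).
  move=> j b'; rewrite ltnS leqn0 sum_nat_eq0 => /forallP b'0.
  have -> : b' = 0 by apply/ffunP => t; rewrite ffunE; have := b'0 t; rewrite mul1n => /eqP.
  exact: y0.
by apply: leq_trans ba _; rewrite /wdeg (bigD1 i)//= mul1n leq_addr.
Qed.

(** The series [g(y_1, ..., y_m)]. The coefficient at [b] is a finite sum,
    since a monomial of degree larger than that of [b] in the [y_i], which have
    no constant term, does not contribute to it. *)
Definition subst g : mpseries n k := MPSeries (fun b =>
  \sum_(a <- cube (wdeg (@deg1 n) b)) mpcoef g a * mpcoef (ymono a) b).

Lemma mpcoef_subst g b N : (wdeg (@deg1 n) b <= N)%N ->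
  mpcoef (subst g) b = \sum_(a <- cube N) mpcoef g a * mpcoef (ymono a) b.
Proof.
move=> bN /=; set F := fun a => mpcoef g a * mpcoef (ymono a) b.
have F0 a : mpcoef (ymono a) b == 0 -> F a = 0 by move=> /eqP a0; rewrite /F a0 mulr0.
have nz N' : \sum_(a <- cube N') F a =
    \sum_(a <- [seq a <- cube N' | mpcoef (ymono a) b != 0]) F a.
  rewrite big_filter [LHS](bigID (fun a => mpcoef (ymono a) b != 0))/=.
  by rewrite [X in _ + X]big1 ?addr0// => a /negPn/F0.
rewrite [LHS]nz [RHS]nz; apply/perm_big/uniq_perm; rewrite ?filter_uniq ?cube_uniq//.
move=> a; rewrite !mem_filter; case: (boolP (_ != 0)) => //= ab.
by rewrite (ymono_deg (leqnn _) ab) (ymono_deg bN ab).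
Qed.

Lemma substD : {morph subst : g h / g + h}.
Proof.
move=> g h; apply: series_eqP => b; rewrite mpcoefD /= -big_split.
by apply: eq_bigr => a _; rewrite mulrDl.
Qed.

Lemma substB : {morph subst : g h / g - h}.
Proof.
move=> g h; apply: series_eqP => b; rewrite mpcoefB /= -sumrB.
by apply: eq_bigr => a _; rewrite mulrBl.
Qed.

Lemma subst_mono a : subst (mono k a) = ymono a.
Proof.
apply: series_eqP => b.
have [ab|ab] := eqVneq (mpcoef (ymono a) b) 0.
  rewrite ab /= big1// => a' _.
  by case: eqP => [->|_]; rewrite ?ab ?mulr0 ?mul0r.
rewrite /= (bigD1_seq a) ?cube_uniq ?(ymono_deg (leqnn _) ab)//= eqxx mul1r.
by rewrite big1 ?addr0// => a' /negPf ->; rewrite mul0r.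
Qed.

Lemma subst1 : subst 1 = 1.
Proof.
rewrite -(mono0 m) subst_mono /ymono big1// => i _; by rewrite ffunE expr0.
Qed.

Lemma substX i : subst (mpsX k i) = y i.
Proof.
rewrite mpsX_mono subst_mono /ymono (bigD1 i)//= ffunE eqxx expr1.
by rewrite big1 ?mulr1// => j ji; rewrite ffunE (negPf ji) expr0.
Qed.

Lemma substM : {morph subst : g h / g * h}.
Proof.
move=> g h; apply: series_eqP => b; set N := wdeg (@deg1 n) b.
have le_box u v : u + v = b ->
    (wdeg (@deg1 n) u <= N)%N /\ (wdeg (@deg1 n) v <= N)%N.
  by rewrite /N => <-; rewrite wdegD leq_addr leq_addl.
(* up to degree [N], both substitutions are sums over the same finite set *)
pose trunc_subst (f : mpseries m k) : mpseries n k :=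
  \sum_(a <- cube N) MPSeries (fun b => mpcoef f a * mpcoef (ymono a) b).
have -> : mpcoef (subst g * subst h) b = mpcoef (trunc_subst g * trunc_subst h) b.
  apply: mpcoef_mul_eq => u v uv; have [uN vN] := le_box u v uv.
  by rewrite !mpcoef_sum (mpcoef_subst g uN) (mpcoef_subst h vN).
rewrite /trunc_subst mulr_suml mpcoef_sum.
under eq_bigr => a _ do rewrite mulr_sumr mpcoef_sum.
rewrite (mpcoef_subst _ (leqnn N)).
transitivity (\sum_(c <- cube N) \sum_(a <- cube N) \sum_(a' <- cube N)
    (a + a' == c)%:R * (mpcoef g a * mpcoef h a') * mpcoef (ymono c) b).
  rewrite !big_seq; apply: eq_bigr => c cN.
  rewrite (mpcoefM g h (cube_uniq N)) => [|u v uv].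
    by rewrite mulr_suml; apply: eq_bigr => a _; rewrite mulr_suml.
  apply: mem_cube => i; apply: leq_trans (cube_le i cN).
  by rewrite -uv ffunE leq_addr.
rewrite exchange_big; apply: eq_bigr => a _; rewrite exchange_big.
apply: eq_bigr => a' _.
have -> : mpcoef (MPSeries (fun b0 => mpcoef g a * mpcoef (ymono a) b0) *
    MPSeries (fun b0 => mpcoef h a' * mpcoef (ymono a') b0)) b =
    mpcoef g a * mpcoef h a' * mpcoef (ymono (a + a')) b.
  rewrite ymonoD !mpcoef_mul mulr_sumr; apply: eq_bigr => u _.
  rewrite mulr_sumr; apply: eq_bigr => v _ /=.
  by rewrite [in LHS]mulrACA [RHS]mulrCA.
have [ab|ab] := eqVneq (mpcoef (ymono (a + a')) b) 0.
  rewrite ab mulr0 big1// => c _; case: eqP => [<-|_]; rewrite ?ab ?mulr0//.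
  by rewrite !mul0r.
rewrite (bigD1_seq (a + a')) ?cube_uniq ?(ymono_deg (leqnn _) ab)//= eqxx mul1r.
by rewrite big1 ?addr0// => c /negPf ne; rewrite eq_sym ne !mul0r.
Qed.

Lemma subst0 : subst 0 = 0.
Proof. by rewrite -[0 in LHS](subrr 0) substB subrr. Qed.

Lemma subst_exp g c : subst (g ^+ c) = subst g ^+ c.
Proof. by elim: c => [|c IH]; rewrite ?expr0 ?subst1// !exprS substM IH. Qed.

Lemma subst_sum (I : finType) (F : I -> mpseries m k) :
  subst (\sum_i F i) = \sum_i subst (F i).
Proof. exact: (big_morph subst substD subst0). Qed.

Lemma vanish_subst (w : 'I_n -> nat) (v : 'I_m -> nat) s g :
  (forall i, vanish w (v i) (y i)) -> vanish v s g -> vanish w s (subst g).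
Proof.
move=> yv gs b bs /=; rewrite big1// => a _.
have [as_|sa] := ltnP (wdeg v a) s; first by rewrite gs// mul0r.
by rewrite (vanish_ymono yv (a := a)) ?mulr0//; exact: leq_trans bs sa.
Qed.

End Substitution.

(** * Incomparability *)

Section Incomparability.
Variables (B C : comNzRingType) (phi : B -> C).
Hypotheses (phiB : {morph phi : x y / x - y}) (phiM : {morph phi : x y / x * y}).
Hypothesis phi1 : phi 1 = 1.

Lemma idealD (R : comNzRingType) (I : set R) x y :
  is_ideal I -> I x -> I y -> I (x + y).
Proof. by move=> [_ IM] Ix Iy; rewrite -[x]mul1r; exact: IM. Qed.

Lemma idealMl (R : comNzRingType) (I : set R) a x : is_ideal I -> I x -> I (a * x).
Proof. by move=> [I0 IM] Ix; rewrite -[_ * _]addr0; exact: IM. Qed.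

Lemma idealB (R : comNzRingType) (I : set R) x y :
  is_ideal I -> I x -> I y -> I (x - y).
Proof. by move=> II Ix Iy; apply: idealD => //; rewrite -mulN1r; exact: idealMl. Qed.

Lemma ideal_sum (R : comNzRingType) (I : set R) (J : Type) (r : seq J)
    (P : pred J) (F : J -> R) :
  is_ideal I -> (forall j, P j -> I (F j)) -> I (\sum_(j <- r | P j) F j).
Proof.
move=> II IF; elim/big_rec: _ => [|j x Pj Ix]; first by case: II.
by apply: idealD => //; exact: IF.
Qed.

(** If [C / p] is generated by finitely many elements over [B], each [g] in
    [p'] satisfies modulo [p] a monic equation with coefficients in [B], by
    Cayley and Hamilton. Its constant term lies in [p'], hence in [p]; as [p]
    is prime, either [g] is in [p] or the degree of the equation can be
    lowered. *)
Lemma incomparable r (e : 'I_r -> C) (p p' : set C) :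
  is_prime_ideal p -> is_prime_ideal p' -> (p `<=` p')%classic ->
  (forall b, p' (phi b) -> p (phi b)) ->
  (forall c, exists a : 'I_r -> B, p (c - \sum_j phi (a j) * e j)) ->
  (p' `<=` p)%classic.
Proof.
move=> [pI p1 pM] [p'I _ _] pp' contr fin g p'g.
pose phi' : {rmorphism B -> C} := HB.pack phi
  (GRing.isZmodMorphism.Build B C phi phiB)
  (GRing.isMonoidMorphism.Build B C phi (conj phi1 phiM)).
have cfu : commr_rmorph phi' g by move=> b; exact: mulrC.
pose ev : {rmorphism {poly B} -> C} := horner_morph cfu.
have evX : ev 'X = g := horner_morphX cfu.
have evC b : ev b%:P = phi b := horner_morphC cfu b.
have [a aP] : exists a : 'I_r -> 'I_r -> B,
    forall i, p (g * e i - \sum_j phi (a i j) * e j).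
  by have [a aP] := choice (fun i => fin (g * e i)); exists a.
pose M := \matrix_(i, j) a i j; pose N := map_mx ev (char_poly_mx M).
have NE i : (N *m \col_j e j) i 0 = g * e i - \sum_j phi (a i j) * e j.
  rewrite !mxE -[g * e i](_ : \sum_j (g *+ (i == j)) * e j = _).
    rewrite -sumrB; apply: eq_bigr => j _; rewrite !mxE rmorphB rmorphMn evX evC.
    by rewrite mulrBl.
  rewrite (bigD1 i)//= eqxx mulr1n big1 ?addr0// => j ji.
  by rewrite eq_sym (negPf ji) mulr0n mul0r.
have det_e j : p (\det N * e j).
  have -> : \det N * e j = (\adj N *m (N *m \col_j e j)) j 0.
    by rewrite mulmxA mul_adj_mx mul_scalar_mx !mxE.
  rewrite mxE; apply: ideal_sum => // i _; apply: idealMl => //.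
  by rewrite NE.
have detN : p (\det N).
  have [c cP] := fin 1.
  rewrite -[\det N]mulr1 -[1](subrK (\sum_j phi (c j) * e j)) mulrDr.
  apply: idealD => //; first exact: idealMl.
  rewrite mulr_sumr; apply: ideal_sum => // j _.
  by rewrite mulrCA; apply: idealMl.
have {detN} : p (ev (char_poly M)) by rewrite /char_poly -det_map_mx.
(* the polynomial stays monic when its degree is lowered; if it became constant,
   then 1 would be in [p] *)
elim/poly_ind: (char_poly M) (char_poly_monic M) => [|h c IH].
  by rewrite monicE lead_coef0 eq_sym oner_eq0.
have [->|h0] := eqVneq h 0.
  rewrite mul0r add0r monicE lead_coefC => /eqP ->.
  by rewrite rmorph1 => /p1.
rewrite monicE lead_coefDl ?lead_coefMX -?monicE; last first.
  by rewrite size_polyC size_mulX//; case: eqP; rewrite // ltnS size_poly_gt0.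
move=> hm; rewrite rmorphD rmorphM evX evC => phgc.
have pc : p (phi c).
  apply: contr; have -> : phi c = (ev h * g + phi c) - ev h * g by rewrite addrAC subrr add0r.
  by apply: idealB => //; [exact: pp'|exact: idealMl].
have /pM[/IH|] : p (ev h * g); last by [].
  have -> : ev h * g = (ev h * g + phi c) - phi c by rewrite addrK.
  exact: idealB.
exact.
Qed.

End Incomparability.

(** * Finiteness over fewer variables *)

Section ProductFiltrations.

Lemma complete_pair (G1 G2 : zmodType) (F1 : nat -> G1 -> Prop)
    (F2 : nat -> G2 -> Prop) :
  complete_filtration F1 -> complete_filtration F2 ->
  complete_filtration (fun s (x : (G1 * G2)%type) => F1 s x.1 /\ F2 s x.2).
Proof.
move=> c1 c2 u uP.
have [U1 U1P] := c1 (fun s => (u s).1) (fun s => (uP s).1).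
have [U2 U2P] := c2 (fun s => (u s).2) (fun s => (uP s).2).
exists (U1, U2) => s /=.
have fst_sum : (\sum_(t < s) u t).1 = \sum_(t < s) (u t).1 by exact: raddf_sum.
have snd_sum : (\sum_(t < s) u t).2 = \sum_(t < s) (u t).2 by exact: raddf_sum.
by rewrite fst_sum snd_sum; split.
Qed.

Lemma complete_ffun (I : finType) (G : zmodType) (F : I -> nat -> G -> Prop) :
  (forall i, complete_filtration (F i)) ->
  complete_filtration (fun s (x : {ffun I -> G}) => forall i, F i s (x i)).
Proof.
move=> cF u uP.
have [U UP] := choice (fun i => cF i (fun s => u s i) (fun s => uP s i)).
exists [ffun i => U i] => s i; rewrite !ffunE sum_ffunE.
exact: UP.
Qed.

End ProductFiltrations.

Section WeierstrassFiniteness.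
Variables (n : nat) (k : fieldType) (B : nat).
Hypothesis B_gt0 : (0 < B)%N.
Local Notation series := (mpseries n.+1 k).
Local Notation index := {ffun 'I_n.+1 -> nat}.
Local Notation W := (@pow_weight n.+1 B).

Let W' (i : 'I_n) : nat := (B ^ i.+1)%N.
Let x0 : series := mpsX k ord0.

(** These series vanish on the monomial curve [x_i = t ^ (B ^ i)], and they are
    homogeneous for the weights [B ^ i] of the variables. A series with a
    single monomial of least weight [r] restricts to the curve as [t ^ r] times
    a unit. *)
Definition curve_coord (i : 'I_n) : series :=
  mpsX k (lift ord0 i) - x0 ^+ (B ^ i.+1).

Local Notation y := curve_coord.
Local Notation phi := (subst y).

Let wdegX i : wdeg W [ffun j => nat_of_bool (j == i)] = W i.
Proof.
rewrite /wdeg (bigD1 i)//= ffunE eqxx muln1 big1 ?addn0// => j /negPf ji.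
by rewrite ffunE ji muln0.
Qed.

Lemma vanishX i : vanish W (W i) (mpsX k i).
Proof. by rewrite -wdegX mpsX_mono; exact: vanish_mono. Qed.

Lemma vanish_x0 j : vanish W j (x0 ^+ j).
Proof.
have x1 : vanish W 1 x0 := @vanishX ord0.
by rewrite -[j in vanish _ j]mul1n; exact: vanish_exp.
Qed.

Lemma vanish_curve_coord i : vanish W (W' i) (y i).
Proof.
have xi : vanish W (W' i) (mpsX k (lift ord0 i)) := @vanishX (lift ord0 i).
by apply: vanishB => //; exact: vanish_x0.
Qed.

Lemma curve_coord0 i : mpcoef (y i) 0 = 0.
Proof.
apply: vanish_curve_coord; rewrite /wdeg big1 => [|j _]; last by rewrite ffunE muln0.
by rewrite expn_gt0 B_gt0.
Qed.

Variables (f : series) (a : index).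
Hypothesis fa : mpcoef f a != 0.
Hypothesis f_min : forall u, mpcoef f u <> 0 -> u <> a -> (wdeg W a < wdeg W u)%N.
Let r := wdeg W a.

Local Notation G := ({ffun 'I_r -> mpseries n k} * series)%type.

Let L (g : G) : series := \sum_j phi (g.1 j) * x0 ^+ j + f * g.2.

Let FG s (g : G) :=
  (forall j, vanish W' (s - nat_of_ord j) (g.1 j)) /\ vanish W (s - r) g.2.

Let LB : {morph L : g h / g - h}.
Proof.
move=> g h; rewrite /L opprD addrACA -mulrBr; congr (_ + _).
by rewrite -sumrB; apply: eq_bigr => j _; rewrite !ffunE substB mulrBl.
Qed.

Let vanish_f : vanish W r f.
Proof.
move=> u ur; apply/eqP; apply: contraTT ur => /eqP fu; rewrite -leqNgt.
have [->//|/eqP ua] := eqVneq u a; exact/ltnW/f_min.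
Qed.

Let vanish_phi s g : vanish W' s g -> vanish W s (phi g).
Proof. by apply: vanish_subst => // i; exact: vanish_curve_coord. Qed.

Let FL s g : FG s g -> vanish W s (L g).
Proof.
move=> [g1 g2]; apply: vanishD.
  apply: vanish_sum => j _; apply: (@vanish_le _ _ _ _ (s - j + j)); first lia.
  by apply: vanishM; [exact/vanish_phi/g1|exact: vanish_x0].
apply: (@vanish_le _ _ _ _ (r + (s - r))); first lia.
exact: vanishM vanish_f g2.
Qed.

(* [h] can be divided by [f] modulo terms of weight larger than [s] *)
Let R s h := exists2 g, FG s g & vanish W s.+1 (h - L g).

Let RB s h h' : R s h -> R s h' -> R s (h - h').
Proof.
move=> [g [g1 g2] hg] [g' [g'1 g'2] hg']; exists (g - g'); last first.
  have -> : h - h' - L (g - g') = (h - L g) - (h' - L g') by rewrite LB; ring.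
  exact: vanishB.
by split=> [j|]; rewrite ?ffunE; exact: vanishB.
Qed.

Let L0 : L 0 = 0.
Proof. by rewrite -[0 in LHS](subrr 0) LB subrr. Qed.

Let R_deep s h : vanish W s.+1 h -> R s h.
Proof.
move=> hs; exists 0; last by rewrite L0 subr0.
by split=> [j|]; rewrite ?ffunE; exact: vanish0.
Qed.

Let R0 s : R s 0.
Proof. exact/R_deep/vanish0. Qed.

Let RN s h : R s h -> R s (- h).
Proof. by rewrite -sub0r; apply: RB. Qed.

Let RD s h h' : R s h -> R s h' -> R s (h + h').
Proof. by move=> Rh Rh'; rewrite -[h']opprK; apply: RB => //; exact: RN. Qed.

Definition cst m (c : k) : mpseries m k := MPSeries (fun u => c *+ (u == 0)).

Lemma mpcoef_cstM m c (h : mpseries m k) u : mpcoef (cst m c * h) u = c * mpcoef h u.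
Proof.
rewrite -[u in LHS]add0r mpcoef_mul_single /= ?eqxx// => u' v' uv'.
case: (u' =P 0) uv' => [->|_ _]; last by rewrite mulr0n mul0r eqxx.
by rewrite !add0r.
Qed.

Lemma subst_cst c : phi (cst n c) = cst n.+1 c.
Proof.
have -> : cst n c = cst n c * 1 by rewrite mulr1.
apply: series_eqP => b; rewrite (mpcoef_subst curve_coord0 _ (leqnn _)).
rewrite (eq_bigr (fun u => c * (mpcoef (1 : mpseries n k) u * mpcoef (ymono y u) b))).
  rewrite -mulr_sumr -(mpcoef_subst curve_coord0 _ (leqnn _)).
  by rewrite (subst1 curve_coord0) mpcoef1 mulr_natr.
by move=> u _; rewrite mpcoef_cstM mulrA.
Qed.

Let vanish_cst m (w : 'I_m -> nat) s c (h : mpseries m k) :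
  vanish w s h -> vanish w s (cst m c * h).
Proof. by move=> hs u us; rewrite mpcoef_cstM hs// mulr0. Qed.

Let RZ s c h : R s h -> R s (cst n.+1 c * h).
Proof.
move=> [g [g1 g2] hg].
exists ([ffun j => cst n c * g.1 j], cst n.+1 c * g.2).
  by split=> [j|]; rewrite ?ffunE; exact: vanish_cst.
have -> : cst n.+1 c * h - L ([ffun j => cst n c * g.1 j], cst n.+1 c * g.2)
    = cst n.+1 c * (h - L g).
  rewrite /L mulrBr mulrDr mulr_sumr /= [f * (_ * _)]mulrCA; congr (_ - (_ + _)).
  apply: eq_bigr => j _; rewrite ffunE substM; last exact: curve_coord0.
  by rewrite subst_cst mulrA.
exact: vanish_cst.
Qed.

(* Additive combinations are enough, because the monomials in the [x_i] have
   integer coefficients in terms of those in [x0] and the [y_i]. *)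
Inductive yspan (P : {ffun 'I_n -> nat} -> nat -> Prop) : series -> Prop :=
| yspan_gen nu j : P nu j -> yspan P (ymono y nu * x0 ^+ j)
| yspan0 : yspan P 0
| yspanB h h' : yspan P h -> yspan P h' -> yspan P (h - h').

Let yspanD P h h' : yspan P h -> yspan P h' -> yspan P (h + h').
Proof.
move=> Ph Ph'; rewrite -[h']opprK; apply: yspanB => //.
by rewrite -sub0r; apply: yspanB => //; exact: yspan0.
Qed.

Let yspan_le (P P' : {ffun 'I_n -> nat} -> nat -> Prop) h :
  (forall nu j, P nu j -> P' nu j) -> yspan P h -> yspan P' h.
Proof.
move=> PP'; elim=> [nu j /PP' Pj||h1 h2 _ h1P _ h2P]; first exact: yspan_gen.
  exact: yspan0.
exact: yspanB.
Qed.

Let yspanM (P Q P' : {ffun 'I_n -> nat} -> nat -> Prop) h h' :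
  (forall nu j nu' j', P nu j -> Q nu' j' -> P' (nu + nu') (j + j')%N) ->
  yspan P h -> yspan Q h' -> yspan P' (h * h').
Proof.
move=> PQ; elim=> [nu j Pj||h1 h2 _ IH1 _ IH2] Qh'.
- elim: Qh' => [nu' j' Qj'||h1 h2 _ IH1 _ IH2].
  + by rewrite mulrACA -ymonoD -exprD; apply: yspan_gen; exact: PQ.
  + by rewrite mulr0; exact: yspan0.
  + by rewrite mulrBr; exact: yspanB.
- by rewrite mul0r; exact: yspan0.
- by rewrite mulrBl; apply: yspanB; [exact: IH1|exact: IH2].
Qed.

Let homog s nu j := (wdeg W' nu + j = s)%N.
Let lower s nu j := homog s nu j /\ (j < s)%N.

Let curve_like s h := yspan (lower s) (h - x0 ^+ s).

Let curve_like_homog s h : curve_like s h -> yspan (homog s) h.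
Proof.
move=> hs; rewrite -[h](subrK (x0 ^+ s)); apply: yspanD.
  by apply: yspan_le hs => nu j [].
have -> : x0 ^+ s = ymono y 0 * x0 ^+ s.
  by rewrite /ymono big1 ?mul1r// => i _; rewrite ffunE expr0.
by apply: yspan_gen; rewrite /homog /wdeg big1 ?add0n// => i _; rewrite ffunE muln0.
Qed.

Let curve_likeM s t h h' :
  curve_like s h -> curve_like t h' -> curve_like (s + t) (h * h').
Proof.
move=> hs ht.
have x0s : yspan (homog s) (x0 ^+ s).
  by apply: curve_like_homog; rewrite /curve_like subrr; exact: yspan0.
rewrite /curve_like exprD.
have -> : h * h' - x0 ^+ s * x0 ^+ t =
    (h - x0 ^+ s) * h' + x0 ^+ s * (h' - x0 ^+ t) by ring.
apply: yspanD.
  apply: (yspanM _ hs (curve_like_homog ht)) => nu j nu' j' [e1 l1] e2.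
  by move: e1 e2; rewrite /lower /homog wdegD; lia.
apply: (yspanM _ x0s ht) => nu j nu' j' e1 [e2 l2].
by move: e1 e2; rewrite /lower /homog wdegD; lia.
Qed.

(** On the curve, a monomial agrees with the power of [x0] of the same weight,
    so that their difference only involves products with some [y_i]. *)
Let curve_like_mono u : curve_like (wdeg W u) (mono k u).
Proof.
rewrite mono_prod /wdeg; elim/big_rec2: _ => [|i s h _ hs].
  by rewrite /curve_like expr0 subrr; exact: yspan0.
apply: curve_likeM => //; elim: (u i) => [|c IH].
  by rewrite muln0 /curve_like !expr0 subrr; exact: yspan0.
rewrite mulnS exprS; apply: curve_likeM => //.
case: (unliftP ord0 i) => [i' ->|->]; last first.
  by rewrite /curve_like expr1 subrr; exact: yspan0.
rewrite /curve_like.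
have -> : mpsX k (lift ord0 i') - x0 ^+ W (lift ord0 i') =
    ymono y [ffun j => nat_of_bool (j == i')] * x0 ^+ 0.
  rewrite mulr1 /ymono (bigD1 i')//= ffunE eqxx expr1 big1 ?mulr1// => j /negPf ji.
  by rewrite ffunE ji expr0.
apply: yspan_gen; rewrite /lower /homog; split; last by rewrite expn_gt0 B_gt0.
rewrite addn0 /wdeg (bigD1 i')//= ffunE eqxx muln1 big1 ?addn0// => j /negPf ji.
by rewrite ffunE ji muln0.
Qed.

(* Powers of [x0] from [x0 ^ r] on are reduced with [f], which trades them for
   terms of larger weight, or of the same weight and smaller degree in [x0]. *)
Let R_gen j nu : R (wdeg W' nu + j) (ymono y nu * x0 ^+ j).
Proof.
elim: {j}j.+1 {-2}j (ltnSn j) nu => // N IH j jN nu.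
have [jr|rj] := ltnP j r.
  pose C : {ffun 'I_r -> mpseries n k} :=
    [ffun i => if i == Ordinal jr then mono k nu else 0].
  exists (C, 0).
    split=> [i|]; last exact: vanish0.
    rewrite ffunE; case: eqP => [->|_]; last exact: vanish0.
    by rewrite addnK; exact: vanish_mono.
  rewrite /L mulr0 addr0 (bigD1 (Ordinal jr))//= ffunE eqxx subst_mono//; last first.
    exact: curve_coord0.
  rewrite big1 ?addr0 ?subrr; first exact: vanish0.
  move=> i /negPf ij; rewrite ffunE ij.
  by rewrite subst0 mul0r.
set s := (wdeg W' nu + j)%N; set h := ymono y nu * x0 ^+ (j - r).
have vh : vanish W (s - r) h.
  have -> : (s - r = wdeg W' nu + (j - r))%N by rewrite /s addnBA.
  apply: vanishM; last exact: vanish_x0.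
  by apply: vanish_ymono => i; exact: vanish_curve_coord.
have -> : ymono y nu * x0 ^+ j = h * mono k a - h * (mono k a - x0 ^+ r).
  by rewrite mulrBr subKr /h -mulrA -exprD subnK.
apply: RB.
  pose c := (mpcoef f a)^-1.
  exists (0, cst n.+1 c * h).
    by split=> [i|]; rewrite ?ffunE; [exact: vanish0|exact: vanish_cst].
  have -> : L (0, cst n.+1 c * h) = h * (cst n.+1 c * f).
    rewrite /L /= big1 ?add0r => [|i _]; first by rewrite mulrC -mulrA mulrCA.
    by rewrite ffunE subst0 mul0r.
  rewrite -mulrBr; apply: (@vanish_le _ _ _ _ (s - r + r.+1)); first by rewrite /s; lia.
  apply: vanishM => // u ur; rewrite mpcoefB mpcoef_cstM mpcoef_mono.
  have [->|ua] := eqVneq u a; first by rewrite mulVf// subrr.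
  rewrite sub0r; apply/eqP; rewrite oppr_eq0 mulf_eq0; apply/orP; right.
  apply: contraTT ur => /eqP fu; rewrite -leqNgt; apply: f_min => //.
  exact/eqP.
have : yspan (fun nu' j' => wdeg W' nu' + j' = s /\ j' < j)%N (h * (mono k a - x0 ^+ r)).
  have hS : yspan (fun nu' j' => nu' = nu /\ j' = (j - r)%N) h by exact: yspan_gen.
  apply: (yspanM _ hS (curve_like_mono a)) => nu1 j1 nu2 j2 [-> ->] [e l].
  by move: e l; rewrite /homog /s wdegD -/r; lia.
elim=> [nu' j' [<- j'j]||h1 h2 _ R1 _ R2]; last exact: RB.
  by apply: IH; exact: leq_trans j'j _.
exact: R0.
Qed.

Let R_step s h : vanish W s h -> R s h.
Proof.
move=> hs; pose top := \sum_(u <- cube n.+1 s | wdeg W u == s)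
  cst n.+1 (mpcoef h u) * mono k u.
rewrite -[h](subrK top); apply: RD.
  apply: R_deep => u; rewrite ltnS leq_eqVlt => /predU1P[us|us]; last first.
    rewrite mpcoefB hs// sub0r mpcoef_sum big1 ?oppr0// => v /eqP vs.
    rewrite mpcoef_cstM mpcoef_mono; case: eqP => [uv|_]; last by rewrite mulr0.
    by rewrite uv vs ltnn in us.
  have uc : u \in cube n.+1 s.
    apply: mem_cube => i; rewrite -us /wdeg (bigD1 i)//=.
    by apply: leq_trans (leq_addr _ _); rewrite leq_pmull// expn_gt0 B_gt0.
  rewrite mpcoefB mpcoef_sum big_mkcond (bigD1_seq u) ?cube_uniq//.
  rewrite ifT; last by rewrite us.
  rewrite mpcoef_cstM mpcoef_mono eqxx mulr1 big1 => [|v vu].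
    by rewrite /= addr0 subrr.
  case: ifP => // _; rewrite mpcoef_cstM mpcoef_mono eq_sym (negPf vu) mulr0.
  by [].
rewrite /top; elim/big_ind: _ => [||u /eqP us]; first exact: R0.
  by move=> *; exact: RD.
apply: RZ; have := curve_like_homog (curve_like_mono u); rewrite us.
elim=> [nu j <-||h1 h2 _ R1 _ R2]; [exact: R_gen|exact: R0|exact: RB].
Qed.

(** Division by [f] with remainder, the [y_i] being regarded as coefficients:
    the ring is generated modulo [f] by the powers of [x0] below the weight [r]
    of the leading monomial of [f]. *)
Theorem weierstrass_finite h : exists (c : 'I_r -> mpseries n k) b,
  h = \sum_j phi (c j) * x0 ^+ j + f * b.
Proof.
have [g Lg] : exists g, L g = h.
  apply: (@complete_surjective _ _ FG (fun s => vanish W s) L) => //.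
  - apply: (@complete_pair _ _
      (fun s (x : {ffun 'I_r -> mpseries n k}) => forall j, vanish W' (s - nat_of_ord j) (x j))
      (fun s x => vanish W (s - r) x)); last exact: complete_vanish.
    apply: (@complete_ffun _ _ (fun (j : 'I_r) s x => vanish W' (s - nat_of_ord j) x)) => j.
    exact: complete_vanish.
  - by move=> s x y'; exact: vanishB.
  - exact: vanish_eq0.
by exists g.1, g.2.
Qed.

End WeierstrassFiniteness.

(** * Upper bound for the dimension *)

Section DimensionOfSeries.

Lemma preim_prime (B C : comNzRingType) (phi : B -> C) (p : set C) :
  {morph phi : x y / x - y} -> {morph phi : x y / x * y} -> phi 1 = 1 ->
  is_prime_ideal p -> is_prime_ideal (phi @^-1` p)%classic.
Proof.
move=> phiB phiM phi1 [pI p1 pM].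
have phi0 : phi 0 = 0 by rewrite -[0 in LHS](subrr 0) phiB subrr.
have phiD x y : phi (x + y) = phi x + phi y.
  by rewrite -{1}[y]opprK phiB -[- y]sub0r phiB phi0 sub0r opprK.
split.
- split=> [|a x y px py]; first by rewrite /preimage /= phi0; case: pI.
  rewrite /preimage /= phiD phiM; exact: pI.2.
- by rewrite /preimage /= phi1.
- by move=> a b; rewrite /preimage /= phiM; exact: pM.
Qed.

Lemma chain_le (T : Type) (N : nat -> set T) l :
  (forall i, (i < l)%N -> (N i `<` N i.+1)%classic) ->
  forall i j, (i <= j <= l)%N -> (N i `<=` N j)%classic.
Proof.
move=> ltN i j /andP[]; elim: j => [|j IH]; first by rewrite leqn0 => /eqP -> _ x.
rewrite leq_eqVlt => /predU1P[-> _ x //|ij] jl x Nx.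
by apply: (ltN j jl).1; apply: (IH ij (ltnW jl)).
Qed.

(** A nonzero series in the second prime of a chain makes the ring finite over
    [n - 1] variables modulo every later prime, so that these primes have
    distinct contractions to the ring of series in [n - 1] variables. *)
Theorem series_dim_le n (k : fieldType) (N : nat -> set (mpseries n k)) l :
  (forall i, (i <= l)%N -> is_prime_ideal (N i)) ->
  (forall i, (i < l)%N -> (N i `<` N i.+1)%classic) -> (l <= n)%N.
Proof.
elim: n N l => [|n IH] N [//|l] primeN ltN.
  have [f N1f N0f] : exists2 f, N 1%N f & ~ N 0%N f.
    have [_ nsub] := ltN 0%N isT; apply: contrapT => no; apply: nsub => f N1f.
    by apply: contrapT => N0f; apply: no; exists f.
  have [N1I N1_1 _] := primeN 1%N isT; case: N1_1.
  have idx0 (u : {ffun 'I_0 -> nat}) : u = 0 by apply/ffunP => -[].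
  have f0 : mpcoef f 0 != 0.
    apply/eqP => f0; apply: N0f; have [[N00 _] _ _] := primeN 0%N isT.
    by have -> : f = 0 by apply: series_eqP => u; rewrite (idx0 u) f0.
  have -> : 1 = cst 0 (mpcoef f 0)^-1 * f; last exact: idealMl.
  apply: series_eqP => u.
  by rewrite mpcoef_cstM (idx0 u) mulVf// mpcoef1 eqxx.
have [f N1f N0f] : exists2 f, N 1%N f & ~ N 0%N f.
  have [_ nsub] := ltN 0%N isT; apply: contrapT => no; apply: nsub => f N1f.
  by apply: contrapT => N0f; apply: no; exists f.
have exf : exists u, mpcoef f u <> 0.
  apply: contrapT => no; apply: N0f; have [[N00 _] _ _] := primeN 0%N isT.
  have -> // : f = 0.
  by apply: series_eqP => u; apply: contrapT => fu; apply: no; exists u.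
have [a [B0 [fa min_a]]] := leading_index exf.
pose B := maxn B0 1; have B_gt0 : (0 < B)%N by rewrite leq_max orbT.
have {}min_a := min_a B (leq_maxl _ _); have {}fa : mpcoef f a != 0 by exact/eqP.
pose phi := subst (@curve_coord n k B).
have y0 := @curve_coord0 n k B B_gt0.
rewrite ltnS; apply: (IH (fun i => phi @^-1` (N i.+1))%classic l) => [i il|i il].
  apply: preim_prime => //; [exact: substB|exact: substM|exact: subst1|].
  exact: primeN.
have [sub nsub] := ltN i.+1 il; split=> [x|phisub]; first exact: sub.
apply: nsub; apply: (@incomparable _ _ phi _ _ _ (wdeg (@pow_weight n.+1 B) a)
  (fun j => mpsX k ord0 ^+ j)) => //.
- exact: substB.
- exact: substM.
- exact: subst1.
- by apply: primeN; rewrite ltnW.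
- exact: primeN.
move=> h; have [c [b ->]] := weierstrass_finite B_gt0 fa min_a h.
exists c; rewrite addrAC subrr add0r mulrC; apply: idealMl.
  by have [] := primeN i.+1 (ltnW il).
by apply: (chain_le ltN (i := 1%N)) N1f; rewrite /= ltnW.
Qed.

End DimensionOfSeries.

Section DimensionOfA2.
Variable d : nat.
Local Notation S := (A2_ring d).

Lemma A2_poly_neq0 : A2_poly d <> 0.
Proof.
have zero_at s (a : {ffun 'I_d.+1 -> nat}) :
    (forall mu, List.In mu s -> mu d = 0%N) -> a ord_max = 3%N ->
    mpcoef (mono_seq d.+1 s) a = 0.
  move=> s0 a3; rewrite /mono_seq; elim: s s0 => [|mu s IH] s0; first by rewrite big_nil.
  rewrite big_cons mpcoefD IH => [|mu' smu]; last by apply: s0; right.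
  rewrite addr0 mpcoef_mono; case: eqP => // am; move: a3.
  by rewrite am ffunE /= s0//; left.
pose a := [ffun i : 'I_d.+1 => pow_mon d 3 i].
move=> /(congr1 (fun f => mpcoef f a)); rewrite A2_polyE /mono_seq /A2_mons -cats1.
rewrite big_cat big_seq1 mpcoefD -/(mono_seq _ _) zero_at ?add0r; last first.
- by rewrite ffunE /pow_mon eqxx.
- have pair0 mu : List.In mu (pair_mons d./2) -> mu d = 0%N.
    by move=> /in_pair_mons; apply; rewrite -{2}(odd_double_half d) leq_addl.
  move=> mu; case: ifP => dodd; last exact: pair0.
  rewrite -cats1 => in_cat; have [/pair0//|[<-|[]]] := List.in_app_or _ _ _ in_cat.
  by rewrite /pow_mon; case: d dodd => // d' _; rewrite eqn_leq /= ltnn.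
by rewrite mpcoef_mono eqxx => /eqP; rewrite oner_eq0.
Qed.

(** The zero ideal can be put below the preimages of a chain of primes, which
    contain the equation. *)
Lemma A2_dim_le m : has_chain (@is_prime_ideal S) m -> (m <= d)%N.
Proof.
move=> [N [primeN ltN]].
pose N' i : set (mpseries d.+1 'F_2) :=
  if i is i'.+1 then (@A2_pi d @^-1` N i')%classic else [set 0]%classic.
have primeN' i : (i <= m)%N -> is_prime_ideal (N' i.+1).
  move=> im; apply: preim_prime; [exact: A2_piB|exact: A2_piM|exact: A2_pi1|].
  exact: primeN.
rewrite -ltnS; apply: (@series_dim_le d.+1 _ N') => [[_|i]|[_|i]].
- exact: zero_ideal_prime.
- by rewrite ltnS; exact: primeN'.
- have [[N00 ND] _ _] := primeN' 0%N isT; split=> [_ -> //|sub].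
  apply: A2_poly_neq0; apply: sub; rewrite /N' /preimage /=.
  have -> : A2_pi (A2_poly d) = 0 by apply/A2_pi_eq0; exists 1; rewrite mulr1.
  by have [[]] := primeN 0%N isT.
rewrite ltnS => im; have [sub nsub] := ltN i im; split=> [f|sub']; first exact: sub.
apply: nsub => s; have [f <-] := A2_pi_surj s; exact: sub'.
Qed.

(** The substitution factors through the quotient by the equation. The primes
    [(t_j, ..., t_(d-1))] are contracted along it, and the contractions are
    distinct when the image contains, for each [i], a monomial that involves
    [t_i] and no later variable. *)
Lemma A2_dim_ge (y : 'I_d.+1 -> mpseries d 'F_2) :
  (forall i, mpcoef (y i) 0 = 0) -> subst y (A2_poly d) = 0 ->
  (forall i : 'I_d, exists g u, [/\ subst y g = mono 'F_2 u, u i <> 0%N &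
      forall j : 'I_d, (i < j)%N -> u j = 0%N]) ->
  has_chain (@is_prime_ideal S) d.
Proof.
move=> y0 yP yg.
pose V i : pred 'I_d := fun j => (j < d - i)%N.
pose N i : set S := fun s => exists2 f, A2_pi f = s & coord_ideal (V i) (subst y f).
have piE i f : N i (A2_pi f) <-> coord_ideal (V i) (subst y f).
  split=> [[g gf Vg]|]; last by exists f.
  have [h fgh] : exists h, g - f = A2_poly d * h.
    by apply/A2_pi_eq0; rewrite A2_piB gf subrr.
  have -> // : subst y f = subst y g.
  by apply/esym/eqP; rewrite -subr_eq0 -substB fgh substM// yP mul0r.
have primeV i := @coord_ideal_prime d 'F_2 (V i).
exists N; split=> [i id|i id].
  have [[V0 VD] V1 VM] := primeV i; split.
  - split=> [|a x x'].
      rewrite -A2_pi0; apply/piE.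
      by rewrite subst0.
    have [fa <-] := A2_pi_surj a; have [fx <-] := A2_pi_surj x.
    have [fx' <-] := A2_pi_surj x' => /piE Nx /piE Nx'.
    by rewrite -A2_piM -A2_piD; apply/piE; rewrite substD substM//; exact: VD.
  - by rewrite -A2_pi1 => /piE; rewrite subst1.
  - move=> a b; have [fa <-] := A2_pi_surj a; have [fb <-] := A2_pi_surj b.
    by rewrite -A2_piM => /piE; rewrite substM// => /VM[?|?]; [left|right]; apply/piE.
split=> [s|sub].
  have [f <-] := A2_pi_surj s => /piE Vf; apply/piE => u Vu; apply: Vf => j Vj.
  by apply: Vu; apply: contra Vj; rewrite /V; lia.
have id' : (d - i.+1 < d)%N by lia.
have [g [u [gu ui uj]]] := yg (Ordinal id').
have /piE/(_ u) : N i (A2_pi g).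
  apply: sub; apply/piE => v Vv; rewrite gu mpcoef_mono; case: eqP => // vu.
  by case: ui; rewrite -vu Vv// /V -leqNgt.
have uV : supported (V i) u by move=> j; rewrite /V -leqNgt => ij; apply: uj => /=; lia.
by rewrite gu mpcoef_mono eqxx => /(_ uV)/eqP; rewrite oner_eq0.
Qed.

End DimensionOfA2.

(** * Lower bound for the dimension *)

Section KrullDimension.

Local Notation t d i := (mpsX 'F_2 (inord i : 'I_d.+1)).

(** In dimension at least 2, a chart of the blow-up of the origin: every
    variable is divisible by the first one, and the equation, divided by the
    square of the first variable, is solved for the second. *)
Definition chart_rest d : mpseries d.+2 'F_2 :=
  \sum_(i < d./2) t d.+1 i.*2.+1 * t d.+1 i.*2.+2
  + (if odd d then t d.+1 d ^+ 2 else 0) + t d.+1 0 * t d.+1 d.+1 ^+ 3.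

Definition chart d (j : nat) : mpseries d.+2 'F_2 :=
  match j with
  | 0 => t d.+1 0
  | 1 => t d.+1 0 * chart_rest d
  | j'.+1 => t d.+1 0 * t d.+1 j'
  end.

Let chart_zero d : subst (fun i : 'I_d.+3 => chart d i) (A2_poly d.+2) = 0.
Proof.
have y0 (i : 'I_d.+3) : mpcoef (chart d i) 0 = 0.
  case: i => -[|[|j]] jd; rewrite /chart ?mpcoef0M mpcoef0X ?mul0r//.
have sX j : (j <= d.+2)%N ->
    subst (fun i : 'I_d.+3 => chart d i) (mpsX 'F_2 (inord j : 'I_d.+3)) = chart d j.
  by move=> jd; rewrite substX// inordK.
have dd := odd_double_half d.
have chartE j : (1 < j)%N -> chart d j = t d.+1 0 * t d.+1 j.-1 by case: j => [|[]].
have sums : subst (fun i : 'I_d.+3 => chart d i)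
    (\sum_(i < d.+2./2) mpsX 'F_2 (inord i.*2 : 'I_d.+3) *
                        mpsX 'F_2 (inord i.*2.+1 : 'I_d.+3)) =
    t d.+1 0 ^+ 2 * (chart_rest d +
      \sum_(i < d./2) t d.+1 i.*2.+1 * t d.+1 i.*2.+2).
  transitivity (chart d 0 * chart d 1 +
      \sum_(i < d./2) chart d i.*2.+2 * chart d i.*2.+3).
    rewrite subst_sum (_ : d.+2./2 = d./2.+1)// big_ord_recl; congr (_ + _).
      by rewrite substM// !sX.
    apply: eq_bigr => i _; have := ltn_ord i => id; rewrite substM//.
    by rewrite lift0 doubleS !sX//; move: dd id; lia.
  rewrite mulrDr; congr (_ + _); first by rewrite expr2 -mulrA.
  rewrite mulr_sumr; apply: eq_bigr => i _.
  by rewrite [chart d i.*2.+2]/= [chart d i.*2.+3]/=; ring.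
have d_gt0 : odd d -> (0 < d)%N := @odd_gt0 d.
rewrite /A2_poly [odd d.+2]/= negbK [d.+2.-1]/=; case: (boolP (odd d)) => dodd.
  rewrite !substD !subst_exp// sums !sX// !chartE ?ltnS ?d_gt0// /chart_rest dodd /=.
  set u := t d.+1 0; set v := t d.+1 d.+1; set w := t d.+1 d; set z := \sum_(i < _) _.
  have -> : u ^+ 2 * (z + w ^+ 2 + u * v ^+ 3 + z) + (u * w) ^+ 2 + (u * v) ^+ 3 =
    (u ^+ 2 * (z + w ^+ 2 + u * v ^+ 3)) + (u ^+ 2 * (z + w ^+ 2 + u * v ^+ 3)) by ring.
  exact: series2.
rewrite !substD !subst_exp// sums !sX// !chartE// /chart_rest (negPf dodd) /=.
set u := t d.+1 0; set v := t d.+1 d.+1; set z := \sum_(i < _) _.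
have -> : u ^+ 2 * (z + 0 + u * v ^+ 3 + z) + (u * v) ^+ 3 =
  (u ^+ 2 * (z + u * v ^+ 3)) + (u ^+ 2 * (z + u * v ^+ 3)) by ring.
exact: series2.
Qed.

Lemma A2_has_chain d : has_chain (@is_prime_ideal (A2_ring d.+1)) d.+1.
Proof.
case: d => [|d].
  (* the cusp [x_0 ^ 2 + x_1 ^ 3 = 0] is parametrized by [(t ^ 3, t ^ 2)] *)
  pose y (i : 'I_2) : mpseries 1 'F_2 := t 0 0 ^+ (if val i == 0%N then 3 else 2).
  have y0 i : mpcoef (y i) 0 = 0.
    by rewrite /y; case: ifP => _; rewrite exprS mpcoef0M mpcoef0X mul0r.
  have sX j : (j < 2)%N -> subst y (mpsX 'F_2 (inord j : 'I_2)) =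
      t 0 0 ^+ (if j == 0%N then 3 else 2).
    by move=> j2; rewrite substX// /y /= inordK.
  apply: (A2_dim_ge y0) => [|i].
    rewrite /A2_poly /= big_ord0 add0r substD !subst_exp// !sX//= -!exprM.
    exact: series2.
  exists (mpsX 'F_2 (inord 0)), [ffun j => (3 * (j == inord 0))%N].
  rewrite sX//= mpsX_exp; split=> // [|j ij]; first by rewrite ffunE !ord1.
  by move: ij; rewrite !ord1.
have y0 (i : 'I_d.+3) : mpcoef (chart d i) 0 = 0.
  by case: i => -[|[|j]] jd; rewrite /chart ?mpcoef0M mpcoef0X ?mul0r.
apply: (A2_dim_ge y0 (chart_zero d)) => i.
pose e (i : 'I_d.+2) : {ffun 'I_d.+2 -> nat} := [ffun j => nat_of_bool (j == i)].
have [->|i0] := eqVneq i ord0.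
  exists (mpsX 'F_2 (inord 0)), (e ord0).
  rewrite substX// inordK//=; split; last first.
  - by move=> j; rewrite ffunE -val_eqE /=; case: (val j).
  - by rewrite ffunE eqxx.
  by rewrite mpsX_mono; congr mono; apply/ffunP => j; rewrite !ffunE -!val_eqE /= inordK.
have i_gt0 : (0 < i)%N by rewrite lt0n; exact: i0.
exists (mpsX 'F_2 (inord i.+1)), (e ord0 + e i).
have id : (i.+1 < d.+3)%N := ltn_ord i.
rewrite substX// inordK//; split.
- case: i {i0} i_gt0 {id} => -[|i] id // _ /=; rewrite !mpsX_mono -monoD; congr mono.
  by apply/ffunP => j; rewrite !ffunE -!val_eqE /= !inordK.
- by rewrite !ffunE eqxx (negPf i0).
move=> j ij; rewrite !ffunE -!val_eqE /= (gtn_eqF ij).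
by rewrite gtn_eqF// (leq_trans _ ij).
Qed.

Theorem krull_dim_A2 d : (0 < d)%N -> krull_dim (A2_ring d) = d.
Proof.
case: d => // d _; apply: chain_length_eq; first exact: A2_has_chain.
by move=> m; exact: A2_dim_le.
Qed.

End KrullDimension.

(** * Closed formulas *)

Section HilbertKunzOfA2.
Variable K : realType.

(** The final cube multiplies the constant by [2 ^ e] and gives the coefficient
    of [chi l] the factor [2 ^ l.+1]. *)
Lemma HK_A2_even k e : exists D : nat, HK 2 (A2_ring k.+1.*2) e = D /\
  D%:Z = ((2 ^ e) ^ k.*2.+2)%N%:Z +
         \sum_(l < e) ((2 ^ e) ^ k * 2 ^ (l * k.+1))%N%:Z * (2 ^ l.+1)%N%:Z.
Proof.
have q0 : (0 < 2 ^ e)%N by rewrite expn_gt0.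
have [p pp cp] := pair_mons_profile q0 (erefl (2 ^ e)%N) k.
have [D cardD DE] := card_kernel_cube (erefl (2 ^ e)%N) (@in_pair_mons k.+1) pp cp.
exists D; split.
  apply: (HK_contract (q_gt0 := q0)); rewrite -cardD /A2_mons.
  by rewrite odd_double doubleK.
by rewrite DE -PoszM -expnSr.
Qed.

Lemma HK_A2_odd k f : exists D : nat, HK 2 (A2_ring k.*2.+1) f.+1 = D /\
  D%:Z = ((2 ^ f.+1) ^ k.*2.+1)%N%:Z +
         ((2 ^ f.+1) ^ k * 2 ^ (f * k))%N%:Z * (2 ^ f.+1)%N%:Z.
Proof.
have q0 : (0 < 2 ^ f.+1)%N by rewrite expn_gt0.
have [p pp cp] := pair_square_profile q0 (erefl (2 ^ f.+1)%N) k (erefl f.+1).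
have ms0 mu : List.In mu (rcons (pair_mons k) (pow_mon k.*2 2)) ->
    forall i, (k.*2.+1 <= i)%N -> mu i = 0%N.
  rewrite -cats1 => in_cat i ki.
  have [/in_pair_mons|[<-|[]]] := List.in_app_or _ _ _ in_cat.
    by apply; exact: ltnW.
  by rewrite /pow_mon gtn_eqF.
have [D cardD DE] := card_kernel_cube (erefl (2 ^ f.+1)%N) ms0 pp cp.
exists D; split.
  apply: (HK_contract (q_gt0 := q0)); rewrite -cardD /A2_mons /=.
  by rewrite odd_double /= uphalf_double.
rewrite DE -PoszM -expnSr big_ord_recr/= eqxx mul1r big1 ?add0r// => l _.
by rewrite (ltn_eqF (ltn_ord l)) !mul0r.
Qed.

Lemma HK_A2_even_closed m e : (0 < m)%N ->
  (HK 2 (A2_ring (2 * m)) e)%:R =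
  (2 ^+ m.+1 + 1) / (2 ^+ m.+1 - 1) * 2 ^+ (2 * m * e)
  - 2 / (2 ^+ m.+1 - 1) * 2 ^+ (e * (m - 1)) :> K.
Proof.
case: m => // k _; have [D [HKD DE]] := HK_A2_even k e.
rewrite mul2n HKD subn1 /=.
have -> : D%:R = D%:Z%:~R :> K by [].
set x : K := 2 ^+ k.+2; have x1 : x - 1 != 0.
  rewrite subr_eq0 gt_eqF// exprn_egt1//; lra.
have -> : D%:Z%:~R = (2 ^+ e) ^+ k.*2.+2 + 2 * (2 ^+ e) ^+ k * \sum_(l < e) x ^+ l :> K.
  rewrite DE rmorphD /= -[X in X + _]/(((2 ^ e) ^ k.*2.+2)%:R : K) !natrX; congr (_ + _).
  rewrite rmorph_sum mulr_sumr; apply: eq_bigr => l _.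
  rewrite -PoszM /= -pmulrn !natrM !natrX -mulrA -exprD /x -exprM.
  have -> : (l * k.+1 + l.+1 = 1 + k.+2 * l)%N by lia.
  by rewrite -exprM exprD expr1 mulrCA mulrA.
have geo : (x - 1) * \sum_(l < e) x ^+ l = (2 ^+ e) ^+ k.+2 - 1.
  by rewrite -exprM mulnC exprM -/x -subrX1.
have -> : \sum_(l < e) x ^+ l = ((2 ^+ e) ^+ k.+2 - 1) / (x - 1).
  by rewrite -geo mulrC mulKf.
have -> : (k.+1.*2 * e = e * k.*2.+2)%N by rewrite mulnC.
rewrite !exprM; set Q : K := 2 ^+ e.
have -> : Q ^+ k.*2.+2 = Q ^+ k * Q ^+ k.+2.
  by rewrite -exprD; congr (_ ^+ _); lia.
by field.
Qed.

Lemma HK_A2_odd_closed m e : (0 < m)%N -> (0 < e)%N ->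
  (HK 2 (A2_ring (2 * m - 1)) e)%:R =
  (2 ^+ (m - 1) + 1) / 2 ^+ (m - 1) * 2 ^+ ((2 * m - 1) * e) :> K.
Proof.
case: m => // k _; case: e => // f _; have [D [HKD DE]] := HK_A2_odd k f.
have -> : (2 * k.+1 - 1 = k.*2.+1)%N by lia.
rewrite HKD subn1 /=.
have -> : D%:R = D%:Z%:~R :> K by [].
have -> : D%:Z%:~R = (2 ^+ f.+1) ^+ k.*2.+1 +
    (2 ^+ f.+1) ^+ k * 2 ^+ (f * k) * 2 ^+ f.+1 :> K.
  rewrite DE rmorphD /= -[X in X + _]/(((2 ^ f.+1) ^ k.*2.+1)%:R : K) !natrX.
  by rewrite -PoszM /= -pmulrn !natrM !natrX.
rewrite [(k.*2.+1 * _)%N]mulnC [in RHS]exprM; set Q : K := 2 ^+ f.+1.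
have x0 : (2 : K) ^+ k != 0 by rewrite expf_neq0// pnatr_eq0.
have -> : Q ^+ k.*2.+1 = Q ^+ k * Q ^+ k * Q.
  by rewrite -!exprD -exprSr; congr (_ ^+ _); lia.
have Qk : Q ^+ k = 2 ^+ (f * k) * 2 ^+ k.
  by rewrite /Q -exprM -exprD; congr (_ ^+ _); lia.
rewrite Qk; move: x0 (2 ^+ (f * k)) => + A; move: (2 ^+ k) Q {Qk} => X Q x0.
by field.
Qed.

Local Open Scope classical_set_scope.

Lemma HK_ratio_A2_cvg d m : (0 < d)%N -> (0 < m)%N ->
  d = (2 * m)%N \/ d = (2 * m - 1)%N ->
  HK_ratio K 2 (A2_ring d) @ \oo -->
    (if d == (2 * m)%N then (2 ^+ m.+1 + 1) / (2 ^+ m.+1 - 1)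
     else (2 ^+ (m - 1) + 1) / 2 ^+ (m - 1) : K).
Proof.
move=> d0 m0 dm.
have pow_neq0 e : (2 : K) ^+ e != 0 by rewrite expf_neq0// pnatr_eq0.
(* the closed formula for odd [d] only starts at [e = 1] *)
rewrite -cvg_shiftS; case: eqP => [dE|dE].
  pose c : K := (2 ^+ m.+1 + 1) / (2 ^+ m.+1 - 1).
  pose c' : K := 2 / (2 ^+ m.+1 - 1) * (2 ^+ m.+1)^-1.
  have rho1 : `|(2 ^+ m.+1)^-1 : K| < 1.
    rewrite ger0_norm ?invr_ge0 ?exprn_ge0// invf_lt1 ?exprn_gt0// exprn_egt1//; lra.
  have -> : [sequence HK_ratio K 2 (A2_ring d) e.+1]_e =
      (fun e => c - c' * (2 ^+ m.+1)^-1 ^+ e).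
    apply/funext => e /=; rewrite /HK_ratio krull_dim_A2// dE HK_A2_even_closed//.
    rewrite -/c mulrBl [(e.+1 * _)%N]mulnC mulfK//; congr (_ - _).
    have -> : (2 * m * e.+1 = e.+1 * (m - 1) + m.+1 * e.+1)%N by nia.
    rewrite exprD invfM mulrA mulfK// exprM /c'; set X : K := 2 ^+ m.+1.
    by rewrite exprS invfM exprVn -!mulrA.
  have : (fun e => c - c' * (2 ^+ m.+1)^-1 ^+ e) @ \oo --> c - c' * 0.
    by apply: cvgB; [exact: cvg_cst|apply: cvgMl_tmp; exact: cvg_expr].
  by rewrite mulr0 subr0.
have {}dE : d = (2 * m - 1)%N by case: dm.
have -> : [sequence HK_ratio K 2 (A2_ring d) e.+1]_e =
    (fun=> (2 ^+ (m - 1) + 1) / 2 ^+ (m - 1)).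
  apply/funext => e /=; rewrite /HK_ratio krull_dim_A2// dE HK_A2_odd_closed//.
  by rewrite [(e.+1 * _)%N]mulnC mulfK.
exact: cvg_cst.
Qed.

End HilbertKunzOfA2.

Theorem theorem3p10 (K : realType) (d m : nat)
    (hd : (1 <= d)%N) (hm : (1 <= m)%N)
    (hdm : d = (2 * m)%N \/ d = (2 * m - 1)%N) :
  (forall e : nat, (1 <= e)%N ->
    (HK 2 (A2_ring d) e)%:R =
      (if d == (2 * m)%N then
         (2 ^+ m.+1 + 1) / (2 ^+ m.+1 - 1) * 2 ^+ (d * e)
         - 2 / (2 ^+ m.+1 - 1) * 2 ^+ (e * (m - 1))
       else (2 ^+ (m - 1) + 1) / 2 ^+ (m - 1) * 2 ^+ (d * e)) :> K) /\
  cvgn (HK_ratio K 2 (A2_ring d)) /\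
  HK_multiplicity K 2 (A2_ring d) =
    (if d == (2 * m)%N then (2 ^+ m.+1 + 1) / (2 ^+ m.+1 - 1)
     else (2 ^+ (m - 1) + 1) / 2 ^+ (m - 1)).
Proof.
have ratio_cvg := @HK_ratio_A2_cvg K d m hd hm hdm.
split; last by split; [exact: cvgP ratio_cvg|exact: cvg_lim ratio_cvg].
move=> e he; case: eqP => [->|d_neq]; first exact: HK_A2_even_closed.
by case: hdm => // ->; exact: HK_A2_odd_closed.
Qed.
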